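(* Assume, in the setting of the context, that the tail function satisfies $h\equiv1$ (so that one may take $d_n=n^{1/\beta}$) and that $E(\tau_0^p)<\infty$ for some $p\in(1,2]$. Then there is absence of localization for $\mathcal X$: for almost every realization of $\tau$, $\sup_{i\in\mathbb Z}P(\mathcal X_t=i\mid\tau)\to0$ as $t\to\infty$.
   Context: Let $\beta\in(1,2]$. Let $(\varepsilon_j)_{j\ge1}$ be i.i.d. integer-valued random variables with $E\varepsilon_1=0$ and $E(e^{it\varepsilon_1})=1$ iff $t\in2\pi\mathbb Z$, in the domain of attraction of a $\beta$-stable law with $P(\varepsilon_1<-x)\sim x^{-\beta}(c^-+o(1))h(x)$, $P(\varepsilon_1>x)\sim x^{-\beta}(c^++o(1))h(x)$, $c^\pm>0$, $h$ slowly varying. Let $X_0=0$, $X_n=\sum_{j\le n}\varepsilon_j$. Let $\tau=(\tau_i)_{i\in\mathbb Z}$ be i.i.d. positive random variables, independent of $X$. The trap model $\mathcal X$ is the continuous-time random walk on $\mathbb Z$ with $\mathcal X_0=0$, embedded chain $X$, and jump rate $\tau_i^{-1}$ at site $i$ (holding times exponential with mean $\tau_i$, conditionally independent given $X,\tau$). *)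

(* Defs.v *)
From HB Require Import structures.
From mathcomp Require Import all_boot all_order all_algebra.
From mathcomp Require Import finmap.
From mathcomp Require Import all_classical all_reals all_analysis.
Set Implicit Arguments. Unset Strict Implicit. Unset Printing Implicit Defensive.
Import Order.TTheory GRing.Theory Num.Theory.
Import numFieldNormedType.Exports.
Local Open Scope classical_set_scope.
Local Open Scope ring_scope.

Definition mutually_independent {d} {T : measurableType d} {R : realType}
  (P : probability T R) {I : choiceType} (X : I -> T -> R) : Prop :=
  (forall i, measurable_fun setT (X i)) /\
  forall (J : {fset I}) (B : I -> set R), (forall i, measurable (B i)) ->
    P (\bigcap_(i in [set` J]) (X i @^-1` B i)) =
    (\prod_(i <- J) P (X i @^-1` B i))%E.

Definition identically_distributed {d} {T : measurableType d} {R : realType}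
  (P : probability T R) {I : Type} (X : I -> T -> R) (i0 : I) : Prop :=
  forall i (B : set R), measurable B -> P (X i @^-1` B) = P (X i0 @^-1` B).

(* Embedded chain X_n = eps_1 + ... + eps_n (here eps is indexed from 0,
   so X_n = \sum_(j < n) eps j). *)
Definition embedded_chain {T : Type} (eps : nat -> T -> int) (n : nat) (w : T) : int :=
  (\sum_(j < n) eps j w)%R.

(* Jump times of the trap model in the (deterministic) environment tau:
   T_0 = 0, T_{n+1} = T_n + tau_{X_n} * e_n, where e_n are standard
   exponential variables, so tau_{X_n} e_n is exponential with mean tau_{X_n}. *)
Definition jump_time {R : realType} {T : Type} (tau : int -> R)
  (eps : nat -> T -> int) (e : nat -> T -> R) (n : nat) (w : T) : R :=
  \sum_(k < n) tau (embedded_chain eps k w) * e k w.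

(* The event {X_t = i} for the trap model in environment tau:
   the walk has made exactly n jumps by time t and X_n = i. *)
Definition trap_event {R : realType} {T : Type} (tau : int -> R)
  (eps : nat -> T -> int) (e : nat -> T -> R) (t : R) (i : int) : set T :=
  [set w | exists n : nat,
     jump_time tau eps e n w <= t < jump_time tau eps e n.+1 w /\
     embedded_chain eps n w = i].

Definition quenched_prob {d} {T : measurableType d} {R : realType}
  (P : probability T R) (tau : int -> R) (eps : nat -> T -> int)
  (e : nat -> T -> R) (t : R) (i : int) : R :=
  fine (P (trap_event tau eps e t i)).

(* Main.v *)
Require Import Defs.
From HB Require Import structures.
From mathcomp Require Import all_boot all_order all_algebra.
From mathcomp Require Import finmap.
From mathcomp Require Import all_classical all_reals all_analysis.
From mathcomp Require Import ring lra zify measurable_realfun.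
Import Order.TTheory GRing.Theory Num.Theory.
Import numFieldNormedType.Exports.
Local Open Scope classical_set_scope.
Local Open Scope ring_scope.

(* The clock is discretised: with D_k the integer part of n tau_(X_k) e_k, the
   holding times become geometric and the walk, killed outside [-N, N],
   satisfies an implicit Euler scheme for the forward equation of the trap
   model.  The argument is carried out for this finite scheme, uniformly in n,
   and transferred by letting n -> oo.

   Let q be the density with respect to tau and E the Dirichlet form of the
   embedded walk.  Fourier analysis on Z/MZ and 1 - Re phi(u) >= c |u|^beta give
   |F(x) - F(y)|^2 <= C |x - y|^(beta - 1) E(F) for F >= 0.  Almost surely every
   block of length r near the origin carries tau-mass at least c r, so a Nash
   argument yields sum_x tau_x q_t(x)^2 <= C t^(-1/beta).  This step uses
   dissipation of the L^2 norm only, hence no reversibility.  Therefore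
   P(X_t = i | tau)^2 <= C tau_i t^(-1/beta), and tau_i = O(|i|^(1/p)) with p > 1
   makes this small for |i| <= N = t^((1 + eta)/beta).  The same inequality
   bounds the Green function, which bounds the probability of leaving [-N, N]
   before time t through the superharmonic defect of 1 - (x/N)^2. *)


Set Implicit Arguments.
Unset Strict Implicit.
Unset Printing Implicit Defensive.

(** * Energy estimates *)

(** With at most [L] jumps, the killed chain is a finite array of nonnegative numbers given by a
    recursion, so no semigroup on infinite volume enters. The scheme is implicit because a holding
    time may round down to zero ticks: the flux at a tick feeds arrivals at the same tick.
    Dissipation then holds for every step size. The energy controls differences only; mass is turned
    into height by averaging over a block, so the Nash inequality is available only above height
    1/nu, nu being the mass of a block, of order r. With r of order t^(1/beta), this floor and the
    decay K/t, K of order r^(beta - 1), are both of order 1/r, so the floor costs nothing. The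
    window obeys opposite constraints: N must exceed r by a power to make exit unlikely, N^(1/p)
    must stay below r for the deepest trap to be harmless, and block estimates reach only r blocks
    on either side. Paths lost by exit or by too many jumps are simply added to the bound at every
    site. *)

Section energy.
Context {R : realType}.
Implicit Types (p F sg : int -> R) (s B : seq int).

Definition form p s F : R :=
  \sum_(j <- s) F j * (F j - \sum_(i <- s) p (j - i) * F i).

(* This is [(F x - F y) ^+ 2 <= 4 * K * form p s F] before optimising over [lam]. *)
Definition var_bound p s (r K : R) := forall F, (forall i, 0 <= F i) ->
  (forall i, i \notin s -> F i = 0) -> forall x y : int, `|x - y|%:~R <= r ->
  forall lam, 0 < lam -> F x - F y <= lam * form p s F + K / lam.

Definition has_blocks sg s (r nu : R) := forall x, x \in s ->
  exists B, [/\ uniq B, {in B, forall y, `|x - y|%:~R <= r} &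
    nu <= \sum_(y <- B) sg y].

Lemma ler_sum_supp B s F : uniq B -> uniq s -> (forall i, 0 <= F i) ->
  (forall i, i \notin s -> F i = 0) -> \sum_(y <- B) F y <= \sum_(i <- s) F i.
Proof.
move=> uB us F0 Fs.
rewrite (bigID (mem s)) /= [X in _ + X]big1 ?addr0; last by move=> i /Fs.
rewrite (bigID (mem B) (r := s) xpredT) /=.
suff -> : \sum_(i <- B | i \in s) F i = \sum_(i <- s | i \in B) F i.
  by rewrite lerDl sumr_ge0.
rewrite -big_filter -[RHS]big_filter; apply: perm_big.
apply: uniq_perm; rewrite ?filter_uniq// => x.
by rewrite !mem_filter andbC.
Qed.

(** Averaging over a block: by the energy bound [F >= F x - del] on [B], and [B] has [sg]-mass at
    least [nu], so [(F x - del) * nu] is at most [m]. No lower bound on a single [sg i] enters;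
    traps may be arbitrarily shallow. *)
Lemma sup_le_form p s sg r K nu m F : uniq s -> 0 < nu -> (forall i, 0 < sg i) ->
  var_bound p s r K -> has_blocks sg s r nu ->
  (forall i, 0 <= F i) -> (forall i, i \notin s -> F i = 0) ->
  \sum_(i <- s) sg i * F i <= m ->
  forall lam, 0 < lam -> forall x, x \in s ->
  F x <= lam * form p s F + K / lam + m / nu.
Proof.
move=> us nu0 sg0 vb hb F0 Fs Fm lam lam0 x xs.
have [B [uB Br Bnu]] := hb _ xs.
set del := lam * _ + _.
have sgF i : 0 <= sg i * F i by rewrite mulr_ge0// ltW.
have Bm : \sum_(y <- B) sg y * F y <= m.
  apply: le_trans Fm; apply: (ler_sum_supp (F := fun i => sg i * F i)) => //.
  by move=> i /Fs ->; rewrite mulr0.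
have m0 : 0 <= m by apply: le_trans Bm; rewrite sumr_ge0.
have [le0|gt0] := lerP (F x - del) 0.
  by rewrite -lerBlDl (le_trans le0)// divr_ge0// ltW.
rewrite -lerBlDl ler_pdivlMr// (le_trans _ Bm)//.
apply: (@le_trans _ _ ((F x - del) * \sum_(y <- B) sg y)).
  by rewrite ler_wpM2l// ltW.
rewrite mulr_sumr big_seq [leRHS]big_seq; apply: ler_sum => y yB.
rewrite mulrC ler_pM2l// lerBlDr -lerBlDl.
exact: (vb F F0 Fs x y (Br _ yB) lam lam0).
Qed.

(** Taking [x = y] gives [0 <= lam * form p s F + K / lam] for every [lam], which a negative form
    violates once [lam] is large. *)
Lemma form_ge0 p s r K F : 0 <= r -> 0 <= K -> var_bound p s r K ->
  (forall i, 0 <= F i) -> (forall i, i \notin s -> F i = 0) -> 0 <= form p s F.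
Proof.
move=> r0 K0 vb F0 Fs; rewrite leNgt; apply/negP => lt0.
set f := form _ _ _ in lt0.
have lam0 : 0 < 1 + K / (- f) by rewrite ltr_wpDr// divr_ge0// oppr_ge0 ltW.
have := vb F F0 Fs 0 0; rewrite subrr normr0 => /(_ r0 _ lam0); rewrite -/f subrr.
set l := 1 + _ in lam0 *.
have hl : l * - f = K - f by rewrite /l; field; rewrite ?oppr_eq0 lt_eqF.
have : K / l < l * - f.
  rewrite ltr_pdivrMr// hl /l; have q0 : 0 <= K / (- f) by rewrite divr_ge0// oppr_ge0 ltW.
  nra.
rewrite mulrN; lra.
Qed.

(** The implicit step is tested with [v] itself: 2 v (v - u) = v^2 - u^2 + (v - u)^2, and the last
    square is dropped. In an explicit scheme it would have the wrong sign. *)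
Lemma form_dissipation p s sg (u v : int -> R) : (forall i, 0 < sg i) ->
  (forall i, 0 <= v i) ->
  (forall j, j \in s -> sg j * (v j - u j) <= \sum_(i <- s) p (j - i) * v i - v j) ->
  \sum_(i <- s) sg i * v i ^+ 2 + 2 * form p s v <= \sum_(i <- s) sg i * u i ^+ 2.
Proof.
move=> sg0 v0 H; rewrite /form mulr_sumr -big_split/=.
rewrite big_seq [leRHS]big_seq; apply: ler_sum => j js.
have := H _ js; set q := \sum_(i <- s) _ => {}H.
have h1 : v j * (sg j * (v j - u j)) <= v j * (q - v j) by rewrite ler_wpM2l.
have h2 : 0 <= sg j * (v j - u j) ^+ 2 by rewrite mulr_ge0 ?sqr_ge0// ltW.
by rewrite !expr2 in h2 *; lra.
Qed.

(** Discrete form of U' <= - (2/c) U^2. The factor 2 pays for the implicit step: the induction needs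
    (m + 4)(m + 1) >= (m + 2)^2, whereas [1 / c] would give (m + 3)(m + 1) = (m + 2)^2 - 1. *)
Lemma nash_iteration (U : nat -> R) (c : R) n : 0 < c -> U 0%N <= c ->
  (forall m, 0 <= U m) ->
  (forall m, (m < n)%N -> U m.+1 + 2 / c * U m.+1 ^+ 2 <= U m) ->
  forall m, (m < n)%N -> U m.+1 <= c / m.+1%:R.
Proof.
move=> c0 U0c Up H; elim=> [|m IH] mn.
  rewrite divr1 (le_trans _ U0c)// (le_trans _ (H 0%N mn))// lerDl.
  by rewrite mulr_ge0// ?sqr_ge0// divr_ge0// ltW.
rewrite leNgt; apply/negP => lt.
have m1 : 0 < m.+1%:R :> R by rewrite ltr0n.
have m2 : 0 < m.+2%:R :> R by rewrite ltr0n.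
have := H m.+1 mn; apply/negP; rewrite -ltNge.
apply: (le_lt_trans (IH (ltnW mn))).
set x := c / m.+2%:R in lt.
have x0 : 0 < x by rewrite divr_gt0.
apply: (@le_lt_trans _ _ (x + 2 / c * x ^+ 2)); last first.
  apply: ltr_leD => //; rewrite ler_pM2l ?divr_gt0//.
  by rewrite lerXn2r// ?nnegrE ltW// (lt_trans x0).
have -> : x + 2 / c * x ^+ 2 = c * (m.+2%:R + 2) / m.+2%:R ^+ 2.
  by rewrite /x; field; rewrite !gt_eqF.
rewrite ler_pdivrMr// mulrAC ler_pdivlMr ?exprn_gt0//.
rewrite -mulrA ler_pM2l//.
rewrite -!(natr1 m.+1) -!(natr1 m).
have : 0 <= m%:R :> R by rewrite ler0n.
rewrite expr2; nra.
Qed.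

(* The energy inequality is used with [lam = 4 K / U]; while [U >= 2 / nu] it
   yields the Nash inequality [U ^+ 2 <= 16 K * form]. *)
Lemma nash_decay p s sg r K nu (v : nat -> int -> R) :
  uniq s -> 0 <= r -> 0 < nu -> 0 < K -> (forall i, 0 < sg i) ->
  var_bound p s r K -> has_blocks sg s r nu ->
  (forall m i, 0 <= v m i) -> (forall m i, i \notin s -> v m i = 0) ->
  (forall m, \sum_(i <- s) sg i * v m i <= 1) ->
  (forall m j, j \in s ->
    sg j * (v m.+1 j - v m j) <= \sum_(i <- s) p (j - i) * v m.+1 i - v m.+1 j) ->
  \sum_(i <- s) sg i * v 0%N i ^+ 2 <= 16 * K ->
  forall m, \sum_(i <- s) sg i * v m.+1 i ^+ 2 <= Num.max (2 / nu) (16 * K / m.+1%:R).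
Proof.
move=> us r0 nu0 K0 sg0 vb hb v0 vs v1 ve; set U := fun m => \sum_(i <- s) sg i * v m i ^+ 2.
rewrite -/(U 0%N) => U0 m; rewrite -/(U m.+1).
have Ug m' : 0 <= U m' by apply: sumr_ge0 => i _; rewrite mulr_ge0 ?sqr_ge0// ltW.
have diss m' : U m'.+1 + 2 * form p s (v m'.+1) <= U m'.
  by apply: form_dissipation => // j js; apply: ve.
have nash m' : 2 / nu <= U m' -> U m' ^+ 2 <= 16 * K * form p s (v m').
  move=> le; have Up : 0 < U m' by rewrite (lt_le_trans _ le)// divr_gt0.
  have lam0 : 0 < 4 * K / U m' by rewrite divr_gt0// mulr_gt0.
  set f := form _ _ _.
  have hU : U m' <= 4 * K / U m' * f + U m' / 4 + U m' / 2.
    set X := 4 * K / U m' * f + K / (4 * K / U m') + 1 / nu.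
    have vX i : i \in s -> v m' i <= X.
      move=> iS; exact: (sup_le_form us nu0 sg0 vb hb (v0 m') (vs m') (v1 m') lam0 iS).
    have X0 : 0 <= X.
      move: Up vX; rewrite /U; case: (s) => [|i s' _ vX]; first by rewrite big_nil ltxx.
      by rewrite (le_trans (v0 m' i))// vX ?mem_head.
    (* [U m'] integrates [v m'] against the measure [sg * v m'], of mass at most 1, so the bound [X]
       on [v m'] also bounds [U m']. *)
    apply: (@le_trans _ _ (X * 1)); last first.
      rewrite mulr1; apply: lerD; last by lra.
      by rewrite lerD2l le_eqVlt; apply/orP; left; apply/eqP; field; rewrite !gt_eqF.
    apply: le_trans (ler_wpM2l X0 (v1 m')).
    rewrite /U mulr_sumr big_seq [leRHS]big_seq; apply: ler_sum => i iS.
    rewrite expr2 mulrA [leRHS]mulrC ler_wpM2l ?vX//.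
    by rewrite mulr_ge0// ltW.
  have : U m' * (U m' / 4) <= U m' * (4 * K / U m' * f) by rewrite ler_pM2l//; lra.
  have -> : U m' * (4 * K / U m' * f) = 4 * K * f by field; rewrite gt_eqF.
  rewrite expr2; lra.
rewrite le_max; apply/orP.
have [lt|le] := ltP (U m.+1) (2 / nu); first by left; exact: ltW.
(* [U] decreases, so if it is still above [2 / nu] at [m.+1], the Nash inequality was available at
   every earlier time. *)
right; have Udec m' : U m'.+1 <= U m'.
  apply: le_trans (diss m'); rewrite lerDl mulr_ge0//.
  exact: (form_ge0 r0 (ltW K0) vb (v0 _) (vs _)).
have Umono := homo_leq (r := fun a b : R => b <= a) (fun x => lexx x)
  (fun y x z h1 h2 => le_trans h2 h1) Udec.
apply: (nash_iteration (n := m.+1)) => //; first by rewrite mulr_gt0.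
move=> m' m'm; apply: le_trans (diss m'); rewrite lerD2l.
have /nash h : 2 / nu <= U m'.+1 by rewrite (le_trans le)// Umono.
by rewrite mulrAC ler_pdivrMr ?mulr_gt0//; move: h; lra.
Qed.
End energy.

(** * The killed chain in discretised time *)

Section killed_chain.
Context {R : realType}.
Variables (p : int -> R) (s : seq int) (th : int -> R).

(* For the walk in discrete time started at 0, holding a geometric time of
   parameter [th i] at [i] and killed outside [s]: [arrival n m i], [occ _ m i]
   and [flux _ m i] are the probabilities that the n-th site is [i] and is
   reached at time [m], resp. is still occupied after time [m], resp. is left
   at time [m]. *)
Definition pending (a : nat -> int -> R) (m : nat) (i : int) : R :=
  \sum_(l < m.+1) th i ^+ (m - l) * a l i.

Definition flux a m i := (1 - th i) * pending a m i.

Definition occ a m i := th i * pending a m i.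

Fixpoint arrival (n : nat) : nat -> int -> R :=
  if n is n'.+1 then
    fun m j => if j \in s then \sum_(i <- s) p (j - i) * flux (arrival n') m i else 0
  else fun m i => ((m == 0%N) && (i == 0))%:R.

(** Mean of the geometric holding time. It stands for [tau], so that [tflux], which is [tocc]
    divided by [hold], stands for the density. *)
Definition hold i : R := th i / (1 - th i).

Hypotheses (us : uniq s) (s0 : 0 \in s) (p0 : forall z, 0 <= p z)
  (p1 : forall i, \sum_(j <- s) p (j - i) <= 1)
  (th01 : forall i, 0 < th i < 1).

Let th0 i : 0 < th i. Proof. by case/andP: (th01 i). Qed.
Let th1 i : 0 < 1 - th i. Proof. by rewrite subr_gt0; case/andP: (th01 i). Qed.

Lemma hold_gt0 i : 0 < hold i.
Proof. by rewrite divr_gt0. Qed.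

Lemma pendingS a m i : pending a m.+1 i = th i * pending a m i + a m.+1 i.
Proof.
rewrite /pending big_ord_recr /= subnn expr0 mul1r; congr (_ + _).
rewrite mulr_sumr; apply: eq_bigr => l _.
by rewrite subSn ?leq_ord// exprS mulrA.
Qed.

Lemma pending_ge0 a m i : (forall m i, 0 <= a m i) -> 0 <= pending a m i.
Proof. by move=> a0; apply: sumr_ge0 => l _; rewrite mulr_ge0// exprn_ge0// ltW. Qed.

Lemma flux_ge0 a m i : (forall m i, 0 <= a m i) -> 0 <= flux a m i.
Proof. by move=> a0; rewrite mulr_ge0 ?pending_ge0// ltW. Qed.

Lemma occ_ge0 a m i : (forall m i, 0 <= a m i) -> 0 <= occ a m i.
Proof. by move=> a0; rewrite mulr_ge0 ?pending_ge0// ltW. Qed.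

Lemma arrival_ge0 n m i : 0 <= arrival n m i.
Proof.
elim: n m i => [|n IH] m i /=; first by rewrite ler0n.
by case: ifP => // _; apply: sumr_ge0 => j _; rewrite mulr_ge0// flux_ge0.
Qed.

Lemma arrival_out n m i : i \notin s -> arrival n m i = 0.
Proof.
case: n => [|n] /=; last by move/negbTE => ->.
by have [->|] := eqVneq i 0; rewrite ?s0// andbF.
Qed.

Lemma flux_out n m i : i \notin s -> flux (arrival n) m i = 0.
Proof.
move=> iS; rewrite /flux /pending big1 ?mulr0// => l _.
by rewrite arrival_out// mulr0.
Qed.

Lemma occ_hold a m i : occ a m i = hold i * flux a m i.
Proof. by rewrite /occ /flux /hold; field; rewrite gt_eqF. Qed.

Lemma occ_flux0 a i : occ a 0%N i + flux a 0%N i = a 0%N i.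
Proof. by rewrite /occ /flux /pending big_ord_recl big_ord0 /= expr0; ring. Qed.

Lemma occ_fluxS a m i : occ a m.+1 i + flux a m.+1 i = occ a m i + a m.+1 i.
Proof. by rewrite /occ /flux !pendingS; ring. Qed.

Lemma occ_cumul a m i :
  occ a m i + \sum_(l < m.+1) flux a l i = \sum_(l < m.+1) a l i.
Proof.
elim: m => [|m IH]; first by rewrite !big_ord_recl !big_ord0 !addr0 occ_flux0.
rewrite big_ord_recr [RHS]big_ord_recr /= -IH.
have := occ_fluxS a m i; lra.
Qed.

Variable L : nat.

(** * Sums over the number of jumps *)

Definition tflux m i := \sum_(n < L) flux (arrival n) m i.
Definition tocc m i := \sum_(n < L) occ (arrival n) m i.

Lemma tflux_ge0 m i : 0 <= tflux m i.
Proof. by apply: sumr_ge0 => n _; apply: flux_ge0 => *; apply: arrival_ge0. Qed.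

Lemma tocc_ge0 m i : 0 <= tocc m i.
Proof. by apply: sumr_ge0 => n _; apply: occ_ge0 => *; apply: arrival_ge0. Qed.

Lemma tflux_out m i : i \notin s -> tflux m i = 0.
Proof. by move=> iS; apply: big1 => n _; apply: flux_out. Qed.

Lemma tocc_hold m i : tocc m i = hold i * tflux m i.
Proof. by rewrite /tocc /tflux mulr_sumr; apply: eq_bigr => n _; rewrite occ_hold. Qed.

(** Only an inequality: [tflux] contains the flux of the last generation, while the arrivals it
    would produce are cut off. This is the direction that dissipation requires. *)
Lemma tarrival_le m j : j \in s -> \sum_(n < L) arrival n m j <=
  ((m == 0%N) && (j == 0))%:R + \sum_(i <- s) p (j - i) * tflux m i.
Proof.
move=> js.
have fl0 n i : 0 <= flux (arrival n) m i by apply: flux_ge0 => *; apply: arrival_ge0.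
rewrite /tflux; case: L => [|L'].
  rewrite big_ord0 addr_ge0// sumr_ge0// => i _; by rewrite big_ord0 mulr0.
rewrite big_ord_recl /= lerD2l.
under eq_bigr do rewrite js.
rewrite exchange_big /=; apply: ler_sum => i _.
by rewrite -mulr_sumr ler_wpM2l// [leRHS]big_ord_recr /= lerDl.
Qed.

(** * Conservation of mass, one jump at a time *)

Definition cflux m n i := \sum_(l < m.+1) flux (arrival n) l i.
Definition carrival m n i := \sum_(l < m.+1) arrival n l i.

Lemma cflux_ge0 m n i : 0 <= cflux m n i.
Proof. by apply: sumr_ge0 => l _; apply: flux_ge0 => *; apply: arrival_ge0. Qed.

Lemma carrivalS m n j : j \in s ->
  carrival m n.+1 j = \sum_(i <- s) p (j - i) * cflux m n i.
Proof.
move=> js; rewrite /carrival /= js exchange_big /=; apply: eq_bigr => i _.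
by rewrite mulr_sumr.
Qed.

Lemma carrival0 m i : carrival m 0 i = (i == 0)%:R.
Proof.
rewrite /carrival /= big_ord_recl /= big1 ?addr0// => l _.
Qed.

Lemma carrival_test m n (phi : int -> R) :
  \sum_(j <- s) phi j * carrival m n.+1 j =
  \sum_(i <- s) (\sum_(j <- s) p (j - i) * phi j) * cflux m n i.
Proof.
under [RHS]eq_bigr do rewrite mulr_suml.
rewrite exchange_big /= big_seq [RHS]big_seq; apply: eq_bigr => j js.
rewrite carrivalS// mulr_sumr; apply: eq_bigr => i _; ring.
Qed.

Lemma tocc_test m (phi : int -> R) : \sum_(i <- s) phi i * tocc m i =
  \sum_(n < L) \sum_(i <- s) phi i * (carrival m n i - cflux m n i).
Proof.
rewrite exchange_big; apply: eq_bigr => i _.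
rewrite -mulr_sumr; congr (_ * _); apply: eq_bigr => n _.
by rewrite /carrival -occ_cumul addrK.
Qed.

Lemma carrival_sum0 m phi : \sum_(i <- s) phi i * carrival m 0 i = phi 0.
Proof.
rewrite (bigD1_seq 0)//= carrival0 eqxx mulr1 big1_seq ?addr0// => i /andP[i0 _].
by rewrite carrival0 (negbTE i0) mulr0.
Qed.

Lemma carrival_mass_le m n :
  \sum_(i <- s) carrival m n.+1 i <= \sum_(i <- s) cflux m n i.
Proof.
have := carrival_test m n (fun=> 1).
under eq_bigr do rewrite mul1r.
move=> ->; apply: ler_sum => i _; rewrite ler_piMl ?cflux_ge0//.
by under eq_bigr do rewrite mulr1.
Qed.

Lemma cflux_le m n i : cflux m n i <= carrival m n i.
Proof.
by rewrite /carrival -occ_cumul lerDr; apply: occ_ge0 => *; apply: arrival_ge0.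
Qed.

(** Telescoping over generations: mass with exactly [n] jumps is arrivals minus departures of
    generation [n], and the departures dominate the next arrivals because [p] has total mass at most
    1. *)
Lemma mass_le1 m : \sum_(i <- s) tocc m i <= 1.
Proof.
have := tocc_test m (fun=> 1).
under eq_bigr do rewrite mul1r.
move=> ->.
suff H l : \sum_(n < l) \sum_(i <- s) 1 * (carrival m n i - cflux m n i) +
    \sum_(i <- s) carrival m l i <= 1.
  apply: le_trans (H L); rewrite lerDl sumr_ge0// => i _.
  by apply: sumr_ge0 => *; apply: arrival_ge0.
elim: l => [|l IH].
  rewrite big_ord0 add0r.
  have := carrival_sum0 m (fun=> 1).
  by under eq_bigr do rewrite mul1r; move=> ->.
rewrite big_ord_recr /= (le_trans _ IH)// -addrA lerD2l.
under eq_bigr do rewrite mul1r.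
rewrite sumrB; have := carrival_mass_le m l; lra.
Qed.

(** A martingale argument in sums: each departure lowers the mean of [phi] by at most [kap], and at
    most [size s * S] departures occur in mean. The term [L%:R^-1] pays for paths with [L] jumps or
    more. *)
Lemma mass_ge (phi : int -> R) kap S m : (0 < L)%N -> 0 <= kap ->
  (forall i, i \in s -> 0 <= phi i <= 1) -> phi 0 = 1 ->
  (forall i, i \in s -> phi i - kap <= \sum_(j <- s) p (j - i) * phi j) ->
  (forall i, i \in s -> \sum_(l < m.+1) tflux l i <= S) ->
  1 - (kap + L%:R^-1) * ((size s)%:R * S) <= \sum_(i <- s) tocc m i.
Proof.
move=> L0 kap0 phi01 phi0 phik hS.
set TH := \sum_(n < L) \sum_(i <- s) cflux m n i.
have THS : TH <= (size s)%:R * S.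
  rewrite /TH exchange_big /= (_ : _ * S = \sum_(i <- s) S); last first.
    by rewrite big_const_seq count_predT iter_addr_0 mulr_natl.
  rewrite big_seq [leRHS]big_seq.
  apply: ler_sum => i iS; apply: le_trans (hS _ iS).
  by rewrite /tflux [leRHS]exchange_big.
apply: (@le_trans _ _ (1 - (kap + L%:R^-1) * TH)).
  by rewrite lerD2l lerN2 ler_wpM2l// addr_ge0// invr_ge0.
apply: (@le_trans _ _ (\sum_(i <- s) phi i * tocc m i)); last first.
  rewrite big_seq [leRHS]big_seq; apply: ler_sum => i iS.
  by rewrite ler_piMl ?tocc_ge0//; case/andP: (phi01 _ iS).
rewrite tocc_test.
have main l : 1 - kap * \sum_(n < l) \sum_(i <- s) cflux m n i <=
    \sum_(n < l) \sum_(i <- s) phi i * (carrival m n i - cflux m n i) +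
    \sum_(i <- s) phi i * carrival m l i.
  elim: l => [|l IH].
    by rewrite !big_ord0 mulr0 subr0 add0r carrival_sum0 phi0.
  rewrite !big_ord_recr /= carrival_test.
  have h1 : \sum_(i <- s) (phi i - kap) * cflux m l i <=
      \sum_(i <- s) (\sum_(j <- s) p (j - i) * phi j) * cflux m l i.
    rewrite big_seq [leRHS]big_seq; apply: ler_sum => i iS.
    by rewrite ler_wpM2r ?cflux_ge0 ?phik.
  have h2 : \sum_(i <- s) (phi i - kap) * cflux m l i =
      \sum_(i <- s) phi i * cflux m l i - kap * \sum_(i <- s) cflux m l i.
    rewrite mulr_sumr -sumrB; apply: eq_bigr => i _; ring.
  have h3 : \sum_(i <- s) phi i * (carrival m l i - cflux m l i) =
      \sum_(i <- s) phi i * carrival m l i - \sum_(i <- s) phi i * cflux m l i.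
    rewrite -sumrB; apply: eq_bigr => i _; ring.
  rewrite h3; rewrite h2 in h1; lra.
(* The mass reaching generation [n] decreases in [n], so at [L] it is at most the average over the
   preceding [L] generations. *)
have tail : \sum_(i <- s) phi i * carrival m L i <= L%:R^-1 * TH.
  rewrite mulrC ler_pdivlMr ?ltr0n//.
  have dec n n' : (n <= n')%N ->
      \sum_(i <- s) carrival m n' i <= \sum_(i <- s) carrival m n i.
    apply: (homo_leq (r := fun a b : R => b <= a) (f := fun n => \sum_(i <- s) carrival m n i)) => // [y x z h1 h2|j].
      exact: le_trans h2 h1.
    by apply: (le_trans (carrival_mass_le m j)); apply: ler_sum => i _; apply: cflux_le.
  apply: (@le_trans _ _ (\sum_(n < L) \sum_(i <- s) carrival m L i)).
    rewrite sumr_const card_ord mulr_natr lerMn2r; apply/orP; right.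
    rewrite big_seq [leRHS]big_seq; apply: ler_sum => i iS.
    rewrite ler_piMl//; first by apply: sumr_ge0 => *; apply: arrival_ge0.
    by case/andP: (phi01 _ iS).
  apply: ler_sum => n _; apply: le_trans (carrival_mass_le m n).
  by apply: dec.
have := main L; rewrite -/TH; lra.
Qed.

(* The time index is shifted by one so that the scheme starts from a unit mass at 0. *)
Definition tstep m : int -> R :=
  if m is m'.+1 then tflux m' else fun i => (i == 0)%:R / hold 0.

(** * Pointwise and Green function bounds for the scheme *)

Variables (r K nu : R).
Hypotheses (r0 : 0 <= r) (nu0 : 0 < nu) (K0 : 0 < K).
Hypotheses (vb : var_bound p s r K) (hb : has_blocks hold s r nu).

Let hold_tstep0 i : hold i * tstep 0 i = (i == 0)%:R.
Proof.
rewrite /=; have [->|] := eqVneq i 0; last by rewrite mul0r mulr0.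
by rewrite mul1r divff// gt_eqF// hold_gt0.
Qed.

(** Keep one term of the L^2 bound and use [tocc = hold i * tflux]. The condition on [hold 0] says
    that the initial L^2 norm, that of a unit mass at 0, is already below the [16 * K] at which the
    iteration starts. *)
Lemma tocc_sqr_le m i : i \in s -> (hold 0)^-1 <= 16 * K ->
  tocc m i ^+ 2 <= hold i * Num.max (2 / nu) (16 * K / m.+1%:R).
Proof.
move=> iS h0.
have tstep_ge0 m' j : 0 <= tstep m' j.
  by case: m' => [|m']; [rewrite /= divr_ge0// ltW// hold_gt0|exact: tflux_ge0].
have step m' j : j \in s ->
    hold j * (tstep m'.+1 j - tstep m' j) <=
    \sum_(i <- s) p (j - i) * tstep m'.+1 i - tstep m'.+1 j.
  move=> js; have := tarrival_le m' js; rewrite mulrBr.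
  have -> : hold j * tstep m'.+1 j = tocc m' j by rewrite tocc_hold.
  case: m' => [|m'].
    rewrite hold_tstep0 eqxx /=.
    have -> : \sum_(n < L) arrival n 0%N j = tocc 0 j + tflux 0 j.
      by rewrite /tocc /tflux -big_split; apply: eq_bigr => n _ /=; rewrite occ_flux0.
    lra.
  have -> : hold j * tstep m'.+1 j = tocc m' j by rewrite tocc_hold.
  have : tocc m' j + \sum_(n < L) arrival n m'.+1 j = tocc m'.+1 j + tflux m'.+1 j.
    by rewrite /tocc /tflux -!big_split; apply: eq_bigr => n _ /=; rewrite occ_fluxS.
  rewrite /=; lra.
have mass m' : \sum_(i <- s) hold i * tstep m' i <= 1.
  case: m' => [|m'].
    under eq_bigr do rewrite hold_tstep0.
    by rewrite (bigD1_seq 0)//= ?eqxx big1 ?addr0// => j /negbTE ->.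
  by under eq_bigr do rewrite -tocc_hold; apply: mass_le1.
have out m' j : j \notin s -> tstep m' j = 0.
  case: m' => [|m']; last exact: tflux_out.
  by have [->|] := eqVneq j 0; rewrite ?s0//= => /negbTE ->; rewrite mul0r.
have U0 : \sum_(i <- s) hold i * tstep 0 i ^+ 2 <= 16 * K.
  rewrite (bigD1_seq 0)//= ?eqxx big1 => [|j /negbTE ->]; last by rewrite mul0r expr0n mulr0.
  by rewrite addr0 mul1r expr2 mulrA divff ?mul1r// gt_eqF// hold_gt0.
have := nash_decay us r0 nu0 K0 hold_gt0 vb hb tstep_ge0 out mass step U0 m.
set U := \sum_(i <- s) _ => hU.
apply: (@le_trans _ _ (hold i * U)); last by rewrite ler_wpM2l// ltW// hold_gt0.
rewrite tocc_hold exprMn (expr2 (hold i)) -mulrA (ler_pM2l (hold_gt0 i)).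
rewrite /U (bigD1_seq i)//=.
  rewrite lerDl sumr_ge0// => j _.
by rewrite mulr_ge0 ?sqr_ge0// ltW// hold_gt0.
Qed.

(** The block inequality for the Green function [h], whose energy is at most [h 0] and whose mass is
    at most [m.+1]. With [lam = 1/2] the term [h 0 / 2] is absorbed at the site 0, and the resulting
    bound on [h 0] passes to the other sites. *)
Lemma green_le m i : i \in s ->
  \sum_(l < m.+1) tflux l i <= 4 * K + 2 * (m.+1%:R / nu).
Proof.
pose h i := \sum_(l < m.+1) tflux l i.
have hg j : 0 <= h j by apply: sumr_ge0 => *; apply: tflux_ge0.
have ho j : j \notin s -> h j = 0 by move=> jS; apply: big1 => l _; apply: tflux_out.
have hm : \sum_(i <- s) hold i * h i <= m.+1%:R.
  rewrite /h; under eq_bigr do rewrite mulr_sumr.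
  rewrite exchange_big /= -[leRHS]mulr1 mulr_natl -[m.+1 in leRHS]card_ord -sumr_const.
  apply: ler_sum => l _; apply: le_trans (mass_le1 l).
  by apply: ler_sum => j _; rewrite tocc_hold.
have hf : form p s h <= h 0.
  rewrite /form; apply: (@le_trans _ _ (\sum_(j <- s) h j * (j == 0)%:R)); last first.
    rewrite (bigD1_seq 0)//= ?eqxx mulr1 big1 ?addr0// => j /negbTE ->.
    by rewrite mulr0.
  rewrite big_seq [leRHS]big_seq; apply: ler_sum => j js; rewrite ler_wpM2l//.
  rewrite lerBlDr.
  have -> : (j == 0)%:R = \sum_(l < m.+1) ((l == 0%N :> nat) && (j == 0))%:R :> R.
    by rewrite big_ord_recl /= big1 ?addr0.
  have -> : \sum_(i <- s) p (j - i) * h i =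
     \sum_(l < m.+1) \sum_(i <- s) p (j - i) * tflux l i.
    by rewrite exchange_big; apply: eq_bigr => i' _; rewrite mulr_sumr.
  rewrite -big_split /=.
  apply: (@le_trans _ _ (\sum_(l < m.+1) \sum_(n < L) arrival n l j)).
    rewrite /h /tflux exchange_big [leRHS]exchange_big /=; apply: ler_sum => n _.
    exact: cflux_le.
  by apply: ler_sum => l _; apply: tarrival_le.
have half : 0 < 2^-1 :> R by rewrite invr_gt0.
have bd j : j \in s -> h j <= 2^-1 * h 0 + K * 2 + m.+1%:R / nu.
  move=> js; have := sup_le_form us nu0 hold_gt0 vb hb hg ho hm half js.
  rewrite invrK => /le_trans; apply.
  by rewrite -!addrA lerD2r ler_pM2l.
have := bd _ s0; rewrite -/(h i) => b0 /bd; lra.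
Qed.

End killed_chain.

(** * Probability of finite unions and independence of the past *)

Section probability_tools.
Context d (T : measurableType d) (R : realType) (P : probability T R).

Definition pr (A : set T) : R := fine (P A).

Lemma prE A : measurable A -> P A = (pr A)%:E.
Proof. by move=> mA; rewrite /pr fineK// fin_num_measure. Qed.

Lemma int_fun_measurable (Y : T -> int) (g : int -> R) :
  (forall z, measurable [set w | Y w = z]) -> measurable_fun setT (g \o Y).
Proof.
move=> mY _ B mB; rewrite setTI.
pose F z := if g z \in B then [set w | Y w = z] else set0.
have mF z : measurable (F z) by rewrite /F; case: ifP.
rewrite (_ : _ @^-1` _ = (\bigcup_m F (Posz m)) `|` (\bigcup_m F (Negz m))).
  by apply: measurableU; apply: bigcupT_measurable.
apply/seteqP; split => w /=.
  move=> wB; have : F (Y w) w by rewrite /F mem_set.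
  by case: (Y w) => m Fm; [left|right]; exists m.
move=> [] [m _]; rewrite /F; case: ifP => // h /= ->; exact: set_mem.
Qed.

Lemma pr_ge0 A : 0 <= pr A.
Proof. exact: fine_ge0. Qed.

Lemma pr_le A B : measurable A -> measurable B -> A `<=` B -> pr A <= pr B.
Proof.
move=> mA mB AB; rewrite -lee_fin -!prE//.
by apply: le_measure; rewrite ?inE.
Qed.

Lemma pr_setC A : measurable A -> pr (~` A) = 1 - pr A.
Proof.
move=> mA; apply: EFin_inj; rewrite -prE ?probability_setC//; last exact: measurableC.
by rewrite prE.
Qed.

Lemma pr_setU A B : measurable A -> measurable B -> pr (A `|` B) <= pr A + pr B.
Proof.
move=> mA mB; rewrite -lee_fin EFinD -!prE//; last exact: measurableU.
exact: measureU2.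
Qed.

Lemma pr_bigcup (I : choiceType) (r : seq I) (A : I -> set T) : uniq r ->
  (forall i, i \in r -> measurable (A i)) -> trivIset [set` r] A ->
  pr (\bigcup_(i in [set` r]) A i) = \sum_(i <- r) pr (A i).
Proof.
move=> ur mA tA; rewrite /pr measure_fin_bigcup//.
rewrite -fsbig_seq// big_seq [in RHS]big_seq sum_fine// => i ir.
by apply: fin_num_measure; apply: mA.
Qed.

(** Fatou's lemma for events. It carries the estimates from the discretised clocks to the continuous
    one. *)
Lemma pr_liminf_le (A : set T) (W : nat -> set T) (b : R) (k1 : nat) :
  measurable A -> (forall k, measurable (W k)) ->
  (forall k, (k1 <= k)%N -> pr (W k) <= b) ->
  (forall w, A w -> exists k0, forall k, (k0 <= k)%N -> W k w) ->
  pr A <= b.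
Proof.
move=> mA mW Wb AW.
pose V n := A `&` \bigcap_(k in [set k | (n <= k)%N]) W k.
have mV n : measurable (V n).
  by apply: measurableI => //; apply: bigcap_measurable => //; exists n => /=.
have VA : \bigcup_n V n = A.
  apply/seteqP; split => [w [n _ []]//|w Aw].
  by have [k0 k0W] := AW _ Aw; exists k0 => //; split => // k /= /k0W.
have nd : {homo V : n m / (n <= m)%N >-> (n <= m)%O}.
  move=> n m nm; apply/subsetPset => w [Aw Vw]; split => // k /= mk.
  by apply: Vw => /=; apply: leq_trans mk.
have := nondecreasing_cvg_mu (mu := P) mV _ nd.
rewrite VA => /(_ mA) cv.
rewrite -lee_fin -prE//; apply: (@cvge_to_le _ \oo _ R _ _ _ cv).
near=> n; rewrite /= prE// lee_fin (le_trans _ (Wb (maxn n k1) _)) ?leq_maxr//.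
apply: pr_le => // w [_ Vw]; apply: Vw; exact: leq_maxl.
Unshelve. all: by end_near. Qed.

End probability_tools.

Section clock.
Context d (T : measurableType d) (R : realType) (P : probability T R).
Variables (eps : nat -> T -> int) (e : nat -> T -> R).

Definition noise (a : nat + nat) (w : T) : R :=
  match a with inl j => (eps j w)%:~R | inr k => e k w end.

Hypothesis ind : mutually_independent P noise.
Hypothesis idd : identically_distributed P (fun j w => (eps j w)%:~R : R) 0%N.
Hypothesis e0 : forall k, P [set w | 0 < e k w] = 1%E.
Hypothesis eS : forall k (x : R), 0 <= x -> P [set w | x < e k w] = (expR (- x))%:E.

Definition jump_law (z : int) : R := pr P [set w | eps 0%N w = z].

Lemma noise_measurable a : measurable_fun setT (noise a).
Proof. exact: ind.1. Qed.

Lemma noise_preim a B : measurable B -> measurable (noise a @^-1` B).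
Proof. by move=> mB; rewrite -[X in measurable X]setTI; exact: noise_measurable. Qed.

Lemma eps_preim n z : [set w | eps n w = z] = noise (inl n) @^-1` [set z%:~R].
Proof.
by apply/seteqP; split => w /= => [->//|/eqP]; rewrite eqr_int => /eqP.
Qed.

Lemma eps_measurable n z : measurable [set w | eps n w = z].
Proof. by rewrite eps_preim; apply: noise_preim. Qed.

Lemma pr_eps n z : pr P [set w | eps n w = z] = jump_law z.
Proof. by rewrite /jump_law !eps_preim /pr; congr fine; apply: idd. Qed.

Definition cylinder (J : {fset nat + nat}) (B : nat + nat -> set R) :=
  \bigcap_(a in [set` J]) (noise a @^-1` B a).

Definition time_index (a : nat + nat) := match a with inl j => j | inr j => j end.

(* [E] is determined by the variables of index below [n]; only this product rule is needed. *)
Definition past n (E : set T) := measurable E /\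
  forall J B, (forall a, measurable (B a)) -> (forall a, a \in J -> (n <= time_index a)%N) ->
  P (E `&` cylinder J B) = (P E * P (cylinder J B))%E.

Lemma past0 : past 0 setT.
Proof. by split => // J B mB _; rewrite setTI probability_setT mul1e. Qed.

Lemma past_set0 n : past n set0.
Proof. by split => // J B mB _; rewrite set0I measure0 mul0e. Qed.

Lemma cylinder_measurable J B : (forall a, measurable (B a)) -> measurable (cylinder J B).
Proof.
by move=> mB; apply: fin_bigcap_measurable => // a _; exact: noise_preim.
Qed.

Definition step_event n B C := noise (inl n) @^-1` B `&` noise (inr n) @^-1` C.

Lemma step_event_measurable n B C : measurable B -> measurable C ->
  measurable (step_event n B C).
Proof. by move=> mB mC; apply: measurableI; exact: noise_preim. Qed.

(** The two variables of index [n] are adjoined to the cylinder as [B'], so a single use of the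
    product rule of [E] covers both the step and everything after it. *)
Lemma past_step_cylinder n E B C J B0 : past n E -> measurable B -> measurable C ->
  (forall a, measurable (B0 a)) -> (forall a, a \in J -> (n.+1 <= time_index a)%N) ->
  P (E `&` step_event n B C `&` cylinder J B0) =
  (P E * (P (noise (inl n) @^-1` B) * P (noise (inr n) @^-1` C) * P (cylinder J B0)))%E.
Proof.
move=> [mE pE] mB mC mB0 Jn.
pose B' a := if a == inl n then B else if a == inr n then C else B0 a.
have mB' a : measurable (B' a) by rewrite /B'; case: ifP => // _; case: ifP.
pose J' := (inl n |` (inr n |` J))%fset.
have nJl : inl n \notin J by apply/negP => /Jn /=; rewrite ltnn.
have nJr : inr n \notin J by apply/negP => /Jn /=; rewrite ltnn.
have B'J a : a \in J -> B' a = B0 a.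
  rewrite /B' => aJ; case: eqP => [aE|_]; first by rewrite -aE aJ in nJl.
  by case: eqP => // aE; rewrite -aE aJ in nJr.
have cE : step_event n B C `&` cylinder J B0 = cylinder J' B'.
  apply/seteqP; split => w.
    move=> [[wB wC] wJ] a /=; rewrite !inE => /orP[/eqP->|/orP[/eqP->|aJ]].
    - by rewrite /B' eqxx.
    - by rewrite /B' eqxx.
    - by rewrite B'J//; apply: wJ.
  move=> wJ; split.
    split; first by have := wJ (inl n); rewrite /B' eqxx; apply => /=; rewrite !inE eqxx.
    by have := wJ (inr n); rewrite /B' eqxx; apply => /=; rewrite !inE eqxx.
  move=> a /= aJ; have := wJ a; rewrite B'J//; apply => /=.
  by rewrite !inE aJ !orbT.
rewrite -setIA cE pE//; last first.
  by move=> a; rewrite !inE => /orP[/eqP->//|/orP[/eqP->//|/Jn/ltnW]].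
congr (_ * _)%E.
rewrite /cylinder (ind.2 _ _ mB') big_fsetU1/=; last by rewrite !inE/= nJl.
rewrite big_fsetU1//= /B' !eqxx /= (ind.2 _ _ mB0) muleA; congr (_ * _)%E.
by apply: eq_big_seq => a aJ; have := B'J _ aJ; rewrite /B' => ->.
Qed.

Lemma past_step n E B C : past n E -> measurable B -> measurable C ->
  past n.+1 (E `&` step_event n B C) /\
  P (E `&` step_event n B C) =
    (P E * (P (noise (inl n) @^-1` B) * P (noise (inr n) @^-1` C)))%E.
Proof.
move=> pE mB mC.
have cyl0 : cylinder fset0 (fun=> setT) = setT.
  by apply/seteqP; split => // w _ a; rewrite /= inE.
have PE : P (E `&` step_event n B C) =
    (P E * (P (noise (inl n) @^-1` B) * P (noise (inr n) @^-1` C)))%E.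
  have := past_step_cylinder (J := fset0) (B0 := fun=> setT) pE mB mC.
  by rewrite cyl0 setIT probability_setT mule1; apply => // a; rewrite inE.
split => //; split => [|J B0 mB0 Jn].
  by apply: measurableI; [exact: pE.1|exact: step_event_measurable].
by rewrite past_step_cylinder// PE muleA.
Qed.

Lemma past_bigcup n (I : choiceType) (r : seq I) (A : I -> set T) : uniq r ->
  (forall i, i \in r -> past n (A i)) -> trivIset [set` r] A ->
  past n (\bigcup_(i in [set` r]) A i).
Proof.
move=> ur pA tA; split => [|J B mB Jn].
  apply: fin_bigcup_measurable => [|i /= ir]; first exact: finite_seq.
  exact: (pA _ ir).1.
have mJ := cylinder_measurable J mB.
rewrite setI_bigcupl measure_fin_bigcup//; last 2 first.
- by move=> i j ir jr [w [[wi _] [wj _]]]; apply: tA => //; exists w.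
- by move=> i /= ir; apply: measurableI => //; exact: (pA _ ir).1.
rewrite measure_fin_bigcup//; last first.
  by move=> i /= ir; exact: (pA _ ir).1.
rewrite -!fsbig_seq//= ge0_sume_distrl//.
by rewrite !big_seq; apply: eq_bigr => i ir; apply: (pA _ ir).2.
Qed.

End clock.

(** * Ticks of the discretised clock *)

Section discrete_clock.
Context d (T : measurableType d) (R : realType) (P : probability T R).
Variables (eps : nat -> T -> int) (e : nat -> T -> R).
Hypothesis ind : mutually_independent P (noise eps e).
Hypothesis idd : identically_distributed P (fun j w => (eps j w)%:~R : R) 0%N.
Hypothesis e0 : forall k, P [set w | 0 < e k w] = 1%E.
Hypothesis eS : forall k (x : R), 0 <= x -> P [set w | x < e k w] = (expR (- x))%:E.
Variables (s : seq int) (c : int -> R).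
Hypotheses (us : uniq s) (s0 : 0 \in s) (c0 : forall i, 0 < c i).

Let p : int -> R := jump_law P eps.
(** Chance that an exponential variable scaled by [c i] lasts one more unit; by memorylessness its
    integer part is geometric with this parameter. *)
Definition tick_prob (i : int) : R := expR (- (c i)^-1).
Let th := tick_prob.

Definition ticks (k : nat) (i : int) (w : T) : nat := Num.truncn (c i * e k w).

Definition total_ticks (n : nat) (w : T) : nat :=
  (\sum_(k < n) ticks k (embedded_chain eps k w) w)%N.

Let tick_ge_set i l : set R := [set x | (l <= Num.truncn (c i * x))%N].

Let tick_ge_measurable i l : measurable (tick_ge_set i l).
Proof.
have [->|l0] := posnP l.
  by rewrite (_ : tick_ge_set i 0 = setT)//; apply/seteqP.
have -> : tick_ge_set i l = `[(l%:R / c i), +oo[%classic.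
  apply/seteqP; split => x /=; rewrite in_itv/= andbT /tick_ge_set /= -(prednK l0) truncn_gt_nat;
  by rewrite ler_pdivrMr// mulrC.
exact: measurable_itv.
Qed.

Lemma ticks_ge n i l :
  P (noise eps e (inr n) @^-1` tick_ge_set i l) = (th i ^+ l)%:E.
Proof.
have me k (x : R) : measurable [set w | x < e k w].
  have -> : [set w | x < e k w] = noise eps e (inr k) @^-1` `]x, +oo[%classic.
    by apply/seteqP; split => w /=; rewrite in_itv/= andbT.
  exact: (noise_preim ind).
have [->|l0] := posnP l.
  rewrite expr0 (_ : _ @^-1` _ = setT) ?probability_setT//; exact/seteqP.
have [c_gt0 cU] := (c0 i, c0 i).
have thl : th i ^+ l = expR (- (l%:R / c i)).
  by rewrite /th /tick_prob -expRM_natl mulrN mulrC mulr_natr // -mulr_natl.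
have lset : noise eps e (inr n) @^-1` tick_ge_set i l = [set w | l%:R / c i <= e n w].
  apply/seteqP; split => x /=; rewrite /tick_ge_set /= -(prednK l0) truncn_gt_nat;
  by rewrite ler_pdivrMr// mulrC.
have x0 : 0 < l%:R / c i by rewrite divr_gt0// ltr0n.
set x := l%:R / c i in x0 thl lset *.
have mle : measurable [set w | x <= e n w] by rewrite -lset; exact: (noise_preim ind).
rewrite lset prE//; congr EFin; apply/eqP; rewrite eq_le; apply/andP; split; last first.
  rewrite -lee_fin -prE// thl -(eS n (ltW x0)).
  by apply: le_measure; rewrite ?inE// => w /=; apply: ltW.
(* The law of [e] is given on open half-lines. The closed one is approached from [y] slightly below
   [x]; the maximum defining [y] keeps it nonnegative, as [eS] demands. *)
rewrite thl; apply/ler_addgt0Pr => eta eta0.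
have cont : expR (- y) @[y --> x] --> expR (- x).
  apply: (@continuous_comp _ _ _ -%R expR); first exact: opp_continuous.
  exact: continuous_expR.
have /cvgrPdist_lt/(_ _ eta0) := cont.
move=> /nbhs_ballP[del /= del0 Hdel].
pose y := Num.max (x / 2) (x - del / 2).
have yx : y < x by rewrite /y gt_max; apply/andP; split; lra.
have y0 : 0 <= y by rewrite /y le_max; apply/orP; left; lra.
have : ball x del y.
  rewrite /ball /= ger0_norm ?subr_ge0 ?ltW//.
  have : x - del / 2 <= y by rewrite /y le_max lexx orbT.
  lra.
move=> /Hdel /=; rewrite ltr_distlC => /andP[_ h].
apply: (@le_trans _ _ (expR (- y))); last exact: ltW.
rewrite -lee_fin -prE// -(eS n y0).
by apply: le_measure; rewrite ?inE// => w /=; apply: lt_le_trans.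
Qed.

Let tick_set i l : set R := [set x | Num.truncn (c i * x) = l].

Let tick_setE i l : tick_set i l = tick_ge_set i l `\` tick_ge_set i l.+1.
Proof.
apply/seteqP; split => x /=; rewrite /tick_set/=.
  by move=> xl; rewrite /tick_ge_set /= xl ltnn.
by move=> [xl /negP]; rewrite /tick_ge_set /= -leqNgt => lx; apply/eqP; rewrite eqn_leq lx.
Qed.

Let tick_measurable i l : measurable (tick_set i l).
Proof. by rewrite tick_setE; apply: measurableD; apply: tick_ge_measurable. Qed.

Lemma ticks_eq n i l :
  P (noise eps e (inr n) @^-1` tick_set i l) = (th i ^+ l * (1 - th i))%:E.
Proof.
have -> : noise eps e (inr n) @^-1` tick_set i l =
    noise eps e (inr n) @^-1` tick_ge_set i l `\`
    noise eps e (inr n) @^-1` tick_ge_set i l.+1.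
  by rewrite tick_setE.
have mt l' : measurable (noise eps e (inr n) @^-1` tick_ge_set i l').
  exact: (noise_preim ind).
have fin : (P (noise eps e (inr n) @^-1` tick_ge_set i l) < +oo)%E.
  by apply: le_lt_trans (probability_le1 _ (mt l)) _; rewrite ltry.
apply: (eq_trans (measureD (mt l) (mt l.+1) fin)).
rewrite (_ : _ `&` _ = noise eps e (inr n) @^-1` tick_ge_set i l.+1).
  rewrite [X in (X - _)%E](ticks_ge n i l) [X in (_ - X)%E](ticks_ge n i l.+1).
  by rewrite -EFinB exprS; congr EFin; ring.
by rewrite setIC; apply/setIidPl => w /=; apply: ltnW.
Qed.

Definition at_step n m j : set T := [set w | [/\ embedded_chain eps n w = j,
  total_ticks n w = m & forall k, (k <= n)%N -> embedded_chain eps k w \in s]].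

Lemma embedded_chainS n w :
  embedded_chain eps n.+1 w = embedded_chain eps n w + eps n w.
Proof. by rewrite /embedded_chain big_ord_recr. Qed.

Lemma total_ticksS n w : total_ticks n.+1 w =
  (total_ticks n w + ticks n (embedded_chain eps n w) w)%N.
Proof. by rewrite /total_ticks big_ord_recr. Qed.

Lemma at_step0 m j : at_step 0 m j = if (m == 0%N) && (j == 0) then setT else set0.
Proof.
have E w : embedded_chain eps 0 w = 0 by rewrite /embedded_chain big_ord0.
have N w : total_ticks 0 w = 0%N by rewrite /total_ticks big_ord0.
case: ifP => [/andP[/eqP-> /eqP->]|ne].
  apply/seteqP; split => // w _; split => // k; rewrite leqn0 => /eqP ->.
  by rewrite E.
apply/seteqP; split => // w [Ew Nw _].
by rewrite -Ew -Nw E N !eqxx in ne.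
Qed.

Let pairs m := [seq (i, l) | i <- s, l <- index_iota 0 m.+1].

Let pairs_uniq m : uniq (pairs m).
Proof. by apply: allpairs_uniq => //; rewrite ?iota_uniq// => -[? ?] [? ?]. Qed.

Let mem_pairs m il : (il \in pairs m) = (il.1 \in s) && (il.2 <= m)%N.
Proof.
case: il => i l; apply/allpairsP/andP => /= [[[i' l']/= [i's]]|[iS lm]].
  by rewrite mem_index_iota => lm [-> ->].
by exists (i, l); rewrite mem_index_iota.
Qed.

(** Decomposition by the previous site and tick. Once these are fixed, so is the trap that scales
    [e n], and the last step depends on the two variables of index [n] alone. *)
Let at_stepS n m j : j \in s -> at_step n.+1 m j =
  \bigcup_(il in [set` pairs m]) (at_step n il.2 il.1 `&`
    step_event eps e n [set (j - il.1)%:~R] (tick_set il.1 (m - il.2))).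
Proof.
move=> js; apply/seteqP; split => w.
  move=> [Ew Nw Sw]; exists (embedded_chain eps n w, total_ticks n w).
    by rewrite /= mem_pairs /= Sw// -Nw total_ticksS leq_addr.
  split => /=; first by split => // k kn; apply: Sw; apply: leqW.
  split => /=; first by rewrite -Ew embedded_chainS addrC addKr.
  by rewrite /tick_set /= -Nw total_ticksS addKn.
move=> [[i l]]; rewrite /= mem_pairs /= => /andP[iS lm].
move=> [[Ew Nw Sw] [/= /eqP]]; rewrite eqr_int => /eqP epsw; rewrite /tick_set /= => tw.
have Ew' : embedded_chain eps n.+1 w = j by rewrite embedded_chainS Ew epsw addrC subrK.
split => //; first by rewrite total_ticksS Nw Ew /ticks tw subnKC.
move=> k; rewrite leq_eqVlt => /orP[/eqP->|]; first by rewrite Ew'.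
by rewrite ltnS; apply: Sw.
Qed.

Lemma at_step_out n m j : j \notin s -> at_step n m j = set0.
Proof.
by move=> js; apply/seteqP; split => // w [h _ /(_ n (leqnn n))]; rewrite h (negbTE js).
Qed.

(** Independence of the future and the value of the probability are proved together, since the
    induction step for the latter uses the former. *)
Lemma at_step_past n m j : past P eps e n (at_step n m j) /\
  pr P (at_step n m j) = arrival p s th n m j.
Proof.
elim: n m j => [|n IH] m j.
  rewrite at_step0 /=; case: ifP => _; last first.
    by split; [exact: past_set0|rewrite /pr measure0].
  by split; [exact: past0|rewrite /pr probability_setT].
have [js|js] := boolP (j \in s); last first.
  rewrite at_step_out//=; split; first exact: past_set0.
  by rewrite (negbTE js) /pr measure0.
have mB i : measurable ([set i%:~R] : set R) by [].
have tI : trivIset [set` pairs m] (fun il => at_step n il.2 il.1 `&`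
    step_event eps e n [set (j - il.1)%:~R] (tick_set il.1 (m - il.2))).
  by move=> [i l] [i' l'] _ _ [w [[[/= <- <- _] _] [[/= <- <- _] _]]].
have pst il := past_step ind (IH il.2 il.1).1 (mB (j - il.1)) (tick_measurable il.1 (m - il.2)).
rewrite at_stepS//; split.
  apply: (past_bigcup ind) => //=; first by move=> il _; apply: (pst il).1.
rewrite pr_bigcup//=; last by move=> il _; exact: (pst il).1.1.
rewrite big_allpairs_dep js; apply: eq_bigr => i _.
rewrite big_mkord /flux /pending !mulr_sumr; apply: eq_bigr => l _.
rewrite {1}/pr (pst (i, val l)).2 /= -eps_preim ticks_eq.
rewrite (prE P (IH l i).1.1) (prE P (eps_measurable ind n (j - i))) (pr_eps e idd).
by rewrite -!EFinM /= (IH l i).2 -/p; ring.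
Qed.

Variable L : nat.

(** A stay that begins at tick [l] still covers tick [M] when it lasts at least [M - l + 1] ticks;
    this is the extra factor [th i] in [occ]. *)
Let occ_set M (x : int * nat * nat) : set T := at_step x.1.2 x.2 x.1.1 `&`
  noise eps e (inr x.1.2) @^-1` tick_ge_set x.1.1 (M - x.2).+1.

Lemma total_ticks_mono w : {homo total_ticks^~ w : n m / (n <= m)%N}.
Proof.
apply: homo_leq => // [y x z|n]; first exact: leq_trans.
by rewrite total_ticksS leq_addr.
Qed.

Definition occupied M (i : int) : set T := [set w | exists2 n, (n < L)%N &
  [/\ embedded_chain eps n w = i, (total_ticks n w <= M < total_ticks n.+1 w)%N &
     forall k, (k <= n)%N -> embedded_chain eps k w \in s]].

Let occ_setP M i n l w : (l <= M)%N -> occ_set M (i, n, l) w <->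
  [/\ at_step n l i w & (M < total_ticks n.+1 w)%N].
Proof.
move=> lM; rewrite /occ_set /tick_ge_set /=; split => -[aw].
  case: (aw) => h0 h1 h2 h; split => //.
  by rewrite total_ticksS h1 h0 /ticks -leq_subLR subSn.
move: (aw) => [h0 h1 h2]; rewrite total_ticksS h1 h0 /ticks => h; split => //.
by rewrite -subSn// leq_subLR.
Qed.

(** Several jumps may share a tick, but the tick count is monotone, so only one jump number [n] has
    [M] between its arrival and its departure. *)
Lemma occupied_inj M i n w : occupied M i w ->
  (total_ticks n w <= M < total_ticks n.+1 w)%N -> embedded_chain eps n w = i.
Proof.
move=> [n' _ [<- /andP[h1 h2] _]] /andP[h3 h4]; congr (embedded_chain eps _ w).
apply/eqP; rewrite eqn_leq; apply/andP; split.
  rewrite leqNgt; apply/negP => /(total_ticks_mono w) h5.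
  by have := leq_trans (leq_trans h2 h5) h3; rewrite ltnn.
rewrite leqNgt; apply/negP => /(total_ticks_mono w) h5.
by have := leq_trans (leq_trans h4 h5) h1; rewrite ltnn.
Qed.

Let steps M := [seq (n, l) | n <- index_iota 0 L, l <- index_iota 0 M.+1].

Let steps_uniq M : uniq (steps M).
Proof. by apply: allpairs_uniq => //; rewrite ?iota_uniq// => -[? ?] [? ?]. Qed.

Let mem_steps M nl : (nl \in steps M) = (nl.1 < L)%N && (nl.2 <= M)%N.
Proof.
case: nl => n l; apply/allpairsP/andP => /= [[[n' l']/= []]|[nL lm]].
  by rewrite !mem_index_iota /= => nL lM [-> ->].
by exists (n, l); rewrite !mem_index_iota.
Qed.

Let occupiedE M i : occupied M i =
  \bigcup_(nl in [set` steps M]) occ_set M (i, nl.1, nl.2).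
Proof.
apply/seteqP; split => w.
  move=> [n nL [h1 /andP[h2 h3] h4]]; exists (n, total_ticks n w).
    by rewrite /= mem_steps /= nL.
  by apply/occ_setP => //.
move=> [[n l]]; rewrite /= mem_steps /= => /andP[nL lM] /occ_setP -/(_ lM) [[h1 h2 h3] h4].
by exists n => //; split => //; rewrite h2 lM.
Qed.

Let occ_set_pr M i n l : measurable (occ_set M (i, n, l)) /\
  pr P (occ_set M (i, n, l)) = arrival p s th n l i * th i ^+ (M - l).+1.
Proof.
have [pa pE] := at_step_past n l i.
have := past_step ind pa (@measurableT _ R) (tick_ge_measurable i (M - l).+1).
rewrite /step_event preimage_setT setTI => -[[mo _] Po]; split => //.
by rewrite {1}/pr Po probability_setT mul1e ticks_ge (prE P pa.1) -EFinM /= pE.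
Qed.

Lemma occupied_pr M i : measurable (occupied M i) /\
  pr P (occupied M i) = tocc p s th L M i.
Proof.
have tI : trivIset [set` steps M] (fun nl => occ_set M (i, nl.1, nl.2)).
  move=> [n l] [n' l']; rewrite /= !mem_steps /= => /andP[nL lM] /andP[nL' lM'].
  move=> [w [/occ_setP -/(_ lM) [[_ h1 _] h2] /occ_setP -/(_ lM') [[_ h1' _] h2']]].
  suff nn : n = n' by rewrite -h1 -h1' nn.
  apply/eqP; rewrite eqn_leq; apply/andP; split.
    rewrite leqNgt; apply/negP => /(total_ticks_mono w) h5.
    by have := leq_trans (leq_trans h2' h5) _; rewrite h1 => /(_ _ lM); rewrite ltnn.
  rewrite leqNgt; apply/negP => /(total_ticks_mono w) h5.
  by have := leq_trans (leq_trans h2 h5) _; rewrite h1' => /(_ _ lM'); rewrite ltnn.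
rewrite occupiedE; split.
  by apply: fin_bigcup_measurable => // -[n l] _; exact: (occ_set_pr M i n l).1.
rewrite pr_bigcup//; last by move=> [n l] _; exact: (occ_set_pr M i n l).1.
rewrite big_allpairs_dep big_mkord /tocc; apply: eq_bigr => n _.
rewrite big_mkord /occ /pending mulr_sumr; apply: eq_bigr => l _.
by rewrite (occ_set_pr M i n l).2 exprS; ring.
Qed.

(* A path that is at [i] at tick [M] lies in this set, whether or not it has left
   [s] or made more than [L] jumps before. *)
Definition occupied_or_lost M i := occupied M i `|` ~` \bigcup_(j in [set` s]) occupied M j.

Lemma occupied_or_lost_measurable M i : measurable (occupied_or_lost M i).
Proof.
apply: measurableU; first exact: (occupied_pr M i).1.
apply: measurableC; apply: fin_bigcup_measurable => // j _.
exact: (occupied_pr M j).1.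
Qed.

Lemma occupied_or_lost_pr M i : pr P (occupied_or_lost M i) <=
  (if i \in s then tocc p s th L M i else 0) + (1 - \sum_(j <- s) tocc p s th L M j).
Proof.
have mo j := (occupied_pr M j).1.
have mU : measurable (\bigcup_(j in [set` s]) occupied M j).
  exact: fin_bigcup_measurable.
apply: (le_trans (pr_setU _ _ _)) => //; first exact: measurableC.
rewrite pr_setC// pr_bigcup//; last first.
  move=> j j' _ _ [w [[n nL [h1 h2 _]] h3]].
  by rewrite -h1; apply: (occupied_inj h3 h2).
apply: lerD; last first.
  rewrite lerD2l lerN2 le_eqVlt; apply/orP; left; apply/eqP.
  by apply: eq_bigr => j _; rewrite (occupied_pr M j).2.
case: ifPn => iS; first by rewrite (occupied_pr M i).2.
rewrite (_ : occupied M i = set0) ?/pr ?measure0//.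
by apply/seteqP; split => // w [n nL [h1 _ /(_ n (leqnn n))]]; rewrite h1 (negbTE iS).
Qed.

Lemma at_tick_occupied_or_lost M i n w :
  (total_ticks n w <= M < total_ticks n.+1 w)%N -> embedded_chain eps n w = i ->
  occupied_or_lost M i w.
Proof.
move=> nM ni.
have [[j js jM]|h] := pselect ((\bigcup_(j in [set` s]) occupied M j) w).
  by left; have := occupied_inj jM nM; rewrite ni => ->.
by right.
Qed.

End discrete_clock.

(** * From ticks to the continuous clock *)

Section continuous_clock.
Context d (T : measurableType d) (R : realType) (P : probability T R).
Variables (eps : nat -> T -> int) (e : nat -> T -> R).
Hypothesis ind : mutually_independent P (noise eps e).
Hypothesis idd : identically_distributed P (fun j w => (eps j w)%:~R : R) 0%N.
Hypothesis e0 : forall k, P [set w | 0 < e k w] = 1%E.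
Hypothesis eS : forall k (x : R), 0 <= x -> P [set w | x < e k w] = (expR (- x))%:E.
Variable tau : int -> R.
Hypothesis tau0 : forall i, 0 < tau i.

Lemma embedded_chain_measurable n : 
  measurable_fun setT (fun w => (embedded_chain eps n w)%:~R : R).
Proof.
rewrite (_ : (fun w => _) = fun w => \sum_(j < n) (eps j w)%:~R); last first.
  by apply/funext => w; rewrite /embedded_chain raddf_sum.
by apply: measurable_sum => j; exact: (noise_measurable ind (inl (val j))).
Qed.

Lemma embedded_chain_fiber n z : measurable [set w | embedded_chain eps n w = z].
Proof.
rewrite (_ : [set w | _] = (fun w => (embedded_chain eps n w)%:~R : R) @^-1` [set z%:~R]).
  by rewrite -[X in measurable X]setTI; apply: embedded_chain_measurable.
by apply/seteqP; split => w /= => [->//|/eqP]; rewrite eqr_int => /eqP.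
Qed.

Lemma trap_depth_measurable n : measurable_fun setT (fun w => tau (embedded_chain eps n w)).
Proof. by apply: (int_fun_measurable tau) => z; exact: embedded_chain_fiber. Qed.

Lemma jump_time_measurable n : measurable_fun setT (jump_time tau eps e n).
Proof.
rewrite (_ : jump_time _ _ _ _ =
  fun w => \sum_(k < n) tau (embedded_chain eps k w) * e k w)//.
apply: measurable_sum => k; apply: measurable_realfun.measurable_funM; first exact: trap_depth_measurable.
exact: (noise_measurable ind (inr (val k))).
Qed.

Lemma trap_event_measurable t i : measurable (trap_event tau eps e t i).
Proof.
rewrite (_ : trap_event _ _ _ _ _ = \bigcup_n
   (jump_time tau eps e n @^-1` `]-oo, t] `&`
    (jump_time tau eps e n.+1 @^-1` `]t, +oo[ `&` [set w | embedded_chain eps n w = i]))).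
  apply: bigcupT_measurable => n; apply: measurableI.
    by rewrite -[X in measurable X]setTI; apply: jump_time_measurable.
  apply: measurableI; last exact: embedded_chain_fiber.
  by rewrite -[X in measurable X]setTI; apply: jump_time_measurable.
apply/seteqP; split => w.
  move=> [n [/andP[h1 h2] h3]]; exists n => //.
  by split; [|split => //]; rewrite /= in_itv/= ?andbT.
move=> [n _ [h1 [h2 h3]]]; exists n; split => //.
by move: h1 h2; rewrite /= !in_itv/= andbT => -> ->.
Qed.

Let pos_set := \bigcap_k [set w | 0 < e k w].

Let pos_measurable : measurable pos_set.
Proof.
apply: bigcapT_measurable => k.
rewrite (_ : [set w | _] = noise eps e (inr k) @^-1` `]0, +oo[).
  exact: (noise_preim ind).
by apply/seteqP; split => w /=; rewrite in_itv/= andbT.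
Qed.

Let pos_pr : pr P (~` pos_set) = 0.
Proof.
rewrite /pr /pos_set setC_bigcap.
have mk k : measurable [set w | 0 < e k w].
  rewrite (_ : [set w | _] = noise eps e (inr k) @^-1` `]0, +oo[).
    exact: (noise_preim ind).
  by apply/seteqP; split => w /=; rewrite in_itv/= andbT.
have mc k := measurableC (mk k).
have : P.-negligible (\bigcup_k ~` [set w | 0 < e k w]).
  apply: negligible_bigcup => k; apply/negligibleP; first exact: mc.
  apply: (eq_trans (probability_setC P (mk k))).
  by rewrite [X in (1 - X)%E](e0 k) subee.
by move/negligibleP => -> //; apply: bigcupT_measurable.
Qed.

Definition rate (k : nat) (i : int) : R := k.+1%:R * tau i.

Lemma rate_gt0 k i : 0 < rate k i.
Proof. by rewrite mulr_gt0. Qed.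

Lemma total_ticks_le k n w : (forall k, 0 < e k w) ->
  (total_ticks eps e (rate k) n w)%:R <= k.+1%:R * jump_time tau eps e n w.
Proof.
move=> ep; rewrite /total_ticks natr_sum /jump_time mulr_sumr; apply: ler_sum => j _.
by rewrite mulrA truncn_le mulr_ge0 ?ltW// rate_gt0.
Qed.

Lemma total_ticks_ge k n w :
  k.+1%:R * jump_time tau eps e n w <= (total_ticks eps e (rate k) n w)%:R + n%:R.
Proof.
rewrite /total_ticks natr_sum /jump_time mulr_sumr.
have -> : n%:R = \sum_(i < n) 1 :> R by rewrite sumr_const card_ord.
rewrite -big_split; apply: ler_sum => j _ /=.
by rewrite mulrA natr1 ltW// truncnS_gt.
Qed.

(* Rounding down makes [T_n <= t] pass to the ticks for every [k], and the strict
   inequality [t < T_(n+1)] passes for [k] large: no atomlessness is needed. *)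
Lemma trap_prob_le (s : seq int) (L : nat -> nat) k1 t i b :
  uniq s -> 0 \in s -> 0 <= t ->
  (forall k, (k1 <= k)%N -> pr P (occupied_or_lost eps e s (rate k) (L k)
     (Num.truncn (k.+1%:R * t)) i) <= b) ->
  quenched_prob P tau eps e t i <= b.
Proof.
move=> us s0 t0 kb.
have mt := trap_event_measurable t i.
have mtp := measurableI _ _ mt pos_measurable.
apply: (@le_trans _ _ (pr P (trap_event tau eps e t i `&` pos_set))).
  apply: (@le_trans _ _ (pr P (trap_event tau eps e t i `&` pos_set) + pr P (~` pos_set))).
    have mc := measurableC pos_measurable.
    apply: le_trans (pr_setU _ mtp mc); apply: pr_le => //; first exact: measurableU.
    by move=> w tw; have [pw|pw] := pselect (pos_set w); [left|right].
  by rewrite pos_pr addr0.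
apply: (pr_liminf_le (W := fun k => occupied_or_lost eps e s (rate k) (L k)
     (Num.truncn (k.+1%:R * t)) i) (k1 := k1)) => //.
  by move=> k; apply: (occupied_or_lost_measurable ind idd eS us s0 (rate_gt0 k)).
move=> w [[n [/andP[h1 h2] h3]] pw].
have ep j : 0 < e j w by apply: pw.
pose gap := jump_time tau eps e n.+1 w - t.
have gap0 : 0 < gap by rewrite subr_gt0.
(* Rounding loses at most one tick per jump, hence at most [n.+1] in all; [k] is such that the gap
   after [t], counted in ticks, exceeds this. *)
exists (Num.truncn (n.+1%:R / gap)).+1 => k kk.
apply: at_tick_occupied_or_lost h3; apply/andP; split.
  rewrite truncn_ge_nat ?mulr_ge0//; apply: le_trans (total_ticks_le k n ep) _.
  by rewrite ler_pM2l.
have kg : n.+1%:R < k.+1%:R * gap.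
  rewrite -ltr_pdivrMr//; apply: lt_trans (truncnS_gt _) _.
  by rewrite ltr_nat.
rewrite -(ltr_nat R); have := total_ticks_ge k n.+1 w.
have : (Num.truncn (k.+1%:R * t))%:R <= k.+1%:R * t by rewrite truncn_le mulr_ge0.
move: kg; rewrite /gap mulrBr; lra.
Qed.

(** With [c] the rate, [hold] is 1/(exp(1/c) - 1), and exp x >= 1 + x. Together with [hold_ge],
    [hold] equals the rate up to a factor e wherever the rate is at least 1. *)
Lemma hold_le k i : hold (tick_prob (rate k)) i <= rate k i.
Proof.
have c0 := rate_gt0 k i; rewrite /hold /tick_prob; set c := rate k i in c0 *.
have x0 : 0 < c^-1 by rewrite invr_gt0.
have th1 : expR (- c^-1) < 1 by rewrite expR_lt1 oppr_lt0.
rewrite ler_pdivrMr ?subr_gt0// mulrBr mulr1 lerBrDr -lerBrDl.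
have e1 : expR (c^-1) * expR (- c^-1) = 1 by rewrite -expRD subrr expR0.
have := expR_ge1Dx (c^-1); set a := expR (- _) in e1 *.
have a0 : 0 < a by exact: expR_gt0.
move=> h; have : c * (1 + c^-1) * a <= c * (expR c^-1 * a).
  by rewrite -mulrA ler_pM2l// ler_pM2r.
rewrite e1 mulr1 mulrDr mulr1 divff ?gt_eqF//; lra.
Qed.

Lemma hold_ge k i : 1 <= rate k i -> expR (-1) * rate k i <= hold (tick_prob (rate k)) i.
Proof.
move=> c1; have c0 := rate_gt0 k i; rewrite /hold /tick_prob; set c := rate k i in c0 c1 *.
have x1 : c^-1 <= 1 by rewrite invf_le1.
have x0 : 0 < c^-1 by rewrite invr_gt0.
have th1 : expR (- c^-1) < 1 by rewrite expR_lt1 oppr_lt0.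
rewrite ler_pdivlMr ?subr_gt0//.
have h : 1 - expR (- c^-1) <= c^-1 by have := expR_ge1Dx (- c^-1); lra.
apply: (@le_trans _ _ (expR (-1) * c * c^-1)).
  by rewrite ler_wpM2l// mulr_ge0// ?expR_ge0 ?ltW.
by rewrite mulfK ?gt_eqF// ler_expR lerN2.
Qed.

Lemma tick_prob01 k i : 0 < tick_prob (rate k) i < 1.
Proof.
by rewrite /tick_prob expR_gt0 expR_lt1 oppr_lt0 invr_gt0 rate_gt0.
Qed.

End continuous_clock.

(** * Fourier analysis of the energy *)

Section mean.
Context d (T : measurableType d) (R : realType) (P : probability T R).
Variable Y : T -> int.
Hypothesis mY : forall z, measurable [set w | Y w = z].

Definition mean (g : int -> R) : R := \int[P]_w g (Y w).
Definition summable_law (g : int -> R) := P.-integrable setT (EFin \o (g \o Y)).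

Lemma bounded_summable g K : (forall z, `|g z| <= K) -> summable_law g.
Proof.
move=> gK.
apply: (le_integrable measurableT (g := EFin \o cst K)).
- by apply/measurable_EFinP; exact: (int_fun_measurable _ mY).
- move=> w _ /=; rewrite lee_fin (le_trans (gK _))// ler_norm//.
- exact: finite_measure_integrable_cst.
Qed.

Lemma dominated_summable g h : summable_law h -> (forall z, `|g z| <= `|h z|) -> summable_law g.
Proof.
move=> ih gh; apply: (le_integrable measurableT _ _ ih).
  by apply/measurable_EFinP; exact: (int_fun_measurable _ mY).
by move=> w _ /=; rewrite lee_fin.
Qed.

Lemma summableD g h : summable_law g -> summable_law h -> summable_law (fun z => g z + h z).
Proof. by move=> ig ih; exact: (integrableD measurableT ig ih). Qed.

Lemma summableZ k g : summable_law g -> summable_law (fun z => k * g z).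
Proof. by move=> ig; exact: (integrableZl measurableT k ig). Qed.

Lemma summable_sum (I : Type) (s : seq I) (g : I -> int -> R) :
  (forall i, summable_law (g i)) -> summable_law (fun z => \sum_(i <- s) g i z).
Proof.
move=> ig; rewrite /summable_law.
rewrite (_ : _ \o _ = fun w => (\sum_(i <- s) (g i (Y w))%:E)%E).
  by apply: (integrable_sum measurableT) => i _; exact: ig.
by apply/funext => w /=; rewrite sumEFin.
Qed.

Lemma meanD g h : summable_law g -> summable_law h ->
  mean (fun z => g z + h z) = mean g + mean h.
Proof. by move=> ig ih; exact: (RintegralD measurableT ig ih). Qed.

Lemma meanZ k g : summable_law g -> mean (fun z => k * g z) = k * mean g.
Proof. by move=> ig; exact: (RintegralZl k measurableT ig). Qed.

Lemma mean_cst k : mean (fun=> k) = k.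
Proof. by rewrite /mean Rintegral_cst// [X in fine X](probability_setT P) mulr1. Qed.

Lemma mean_sum (I : Type) (s : seq I) (g : I -> int -> R) :
  (forall i, summable_law (g i)) ->
  mean (fun z => \sum_(i <- s) g i z) = \sum_(i <- s) mean (g i).
Proof.
move=> ig; elim: s => [|i s IH].
  rewrite big_nil -[RHS](mean_cst 0); apply: eq_Rintegral => w _.
  by rewrite big_nil.
rewrite big_cons -IH -meanD//; last exact: summable_sum.
by apply: eq_Rintegral => w _; rewrite big_cons.
Qed.

Lemma le_mean g h : summable_law g -> summable_law h -> (forall z, g z <= h z) ->
  mean g <= mean h.
Proof. by move=> ig ih gh; apply: (le_Rintegral measurableT ig ih) => w _; exact: gh. Qed.

Definition law (z : int) : R := fine (P [set w | Y w = z]).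

Lemma mean_indic a : mean (fun z => (z == a)%:R) = law a.
Proof.
rewrite /mean /law /Rintegral; congr fine.
rewrite -[in RHS](setIT [set w | Y w = a]) -integral_indic//.
apply: eq_integral => w _; rewrite indicE.
suff -> : (w \in [set w | Y w = a]) = (Y w == a) by [].
by apply/idP/eqP => [/set_mem//|h]; exact/mem_set.
Qed.

Lemma summable_indic a : summable_law (fun z => (z == a)%:R).
Proof. by apply: (@bounded_summable _ 1) => z; case: eqP; rewrite ?normr0 ?normr1. Qed.

Lemma law_sum_le1 (s : seq int) i : uniq s -> \sum_(j <- s) law (j - i) <= 1.
Proof.
move=> us.
have -> : \sum_(j <- s) law (j - i) = \sum_(j <- s) mean (fun z => (z == j - i)%:R).
  by apply: eq_bigr => j _; rewrite mean_indic.
rewrite -mean_sum; last by move=> j; exact: summable_indic.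
rewrite -[leRHS](mean_cst 1); apply: le_mean.
- by apply: summable_sum => j; exact: summable_indic.
- by apply: (@bounded_summable _ 1) => z; rewrite normr1.
move=> z; have [zs|zs] := boolP (z + i \in s).
  rewrite (bigD1_seq (z + i))//= addrK eqxx big1 ?addr0// => j jz.
  by case: eqP => // zE; rewrite zE subrK eqxx in jz.
rewrite big1_seq// => j /andP[_ js]; case: eqP => // zE.
by rewrite zE subrK js in zs.
Qed.

End mean.

Section fourier.
Context {R : realType}.
Variable M : nat.
Hypothesis M0 : (0 < M)%N.

Definition angle (a : nat) : R := 2 * pi * a%:R / M%:R.

Lemma cos_int_period (x : R) (k : int) : cos (x + 2 * pi * k%:~R) = cos x.
Proof.
have H (n : nat) y : cos (y + 2 * pi * n%:R) = cos y :> R.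
  elim: n => [|n IH]; first by rewrite mulr0 addr0.
  rewrite (_ : y + _ = y + 2 * pi * n%:R + pi *+ 2) ?cosD2pi//.
  by rewrite -natr1; ring.
case: k => n; first exact: H.
by rewrite NegzE mulrNz mulrN -[in RHS](subrK (2 * pi * n.+1%:R) x) H.
Qed.

(** Sum of the z-th powers of the M-th roots of unity, in real form. *)
Definition dft_sum (z : int) : R := \sum_(a < M) cos (angle a * z%:~R).

Lemma dft_sum_dvd z : (M%:Z %| z)%Z -> dft_sum z = M%:R.
Proof.
move=> /dvdzP[q ->]; rewrite -[in RHS](card_ord M) -sumr_const; apply: eq_bigr => a _.
rewrite -[RHS]cos0 -(cos_int_period 0 (a%:Z * q)) add0r; congr cos.
rewrite /angle !intrM -!pmulrn; field.
by rewrite pnatr_eq0 -lt0n.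
Qed.

Lemma dft_sum_ndvd z : ~~ (M%:Z %| z)%Z -> dft_sum z = 0.
Proof.
move=> nd.
have MR : 0 < M%:R :> R by rewrite ltr0n.
have MZ : M%:Z != 0 by rewrite eqz_nat -lt0n.
pose z' := (z %% M%:Z)%Z.
have z'0 : 0 < z' by rewrite lt_neqAle modz_ge0// andbT eq_sym; apply: contra nd => /eqP/dvdz_mod0P.
have z'M : z' < M%:Z by apply: ltz_pmod; rewrite ltz_nat.
have -> : dft_sum z = dft_sum z'.
  apply: eq_bigr => a _; rewrite {1}(divz_eq z M%:Z) -/z' addrC intrD mulrDr.
  rewrite -[RHS](cos_int_period _ (a%:Z * (z %/ M)%Z)); congr (cos (_ + _)).
  by rewrite /angle !intrM -!pmulrn; field; rewrite gt_eqF.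
pose x : R := pi * z'%:~R / M%:R.
have sx : 0 < sin x.
  apply: sin_gt0_pi; rewrite /x divr_gt0 ?mulr_gt0 ?pi_gt0 ?ltr0z//=.
  by rewrite ltr_pdivrMr// ltr_pM2l ?pi_gt0// -[M%:R]/(M%:Z%:~R) ltr_int.
(* As for the Dirichlet kernel, multiplying by [2 * sin x], with [x] half the angle increment,
   telescopes the sum; at [n = M] the two ends cancel by periodicity. *)
have tele n : 2 * sin x * \sum_(a < n) cos (angle a * z'%:~R) =
    sin (2 * n%:R * x - x) + sin x.
  elim: n => [|n IH]; first by rewrite big_ord0 mulr0 mulr0 mul0r sub0r sinN addNr.
  rewrite big_ord_recr mulrDr IH /=.
  have -> : angle n * z'%:~R = 2 * n%:R * x by rewrite /angle /x; field; rewrite gt_eqF.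
  have -> : 2 * n.+1%:R * x - x = 2 * n%:R * x + x by rewrite -natr1; ring.
  rewrite sinB sinD; ring.
have := tele M.
have -> : sin (2 * M%:R * x - x) = - sin x.
  rewrite -cosBpihalf -sinN -cosBpihalf.
  rewrite -[RHS](cos_int_period _ z'); congr cos.
  by rewrite /x; field; rewrite gt_eqF.
rewrite addNr => /eqP; rewrite mulf_eq0 mulf_eq0 (gt_eqF sx) pnatr_eq0 /= => /eqP //.
Qed.

Lemma dft_sum_ge0 z : 0 <= dft_sum z.
Proof.
have [/dft_sum_dvd ->|/dft_sum_ndvd ->//] := boolP (M%:Z %| z)%Z.
by rewrite ler0n.
Qed.

Lemma dft_sum_ge_indic z : M%:R * (z == 0)%:R <= dft_sum z.
Proof.
have [->|_] := eqVneq z 0; last by rewrite mulr0 dft_sum_ge0.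
by rewrite mulr1 dft_sum_dvd// dvdz0.
Qed.

Definition cos_coef (s : seq int) (F : int -> R) a := \sum_(y <- s) F y * cos (angle a * y%:~R).
Definition sin_coef (s : seq int) (F : int -> R) a := \sum_(y <- s) F y * sin (angle a * y%:~R).

Lemma dft_inversion s F x : uniq s -> (forall i, i \notin s -> F i = 0) ->
  (forall z, z \in s -> (M%:Z %| x - z)%Z -> x = z) ->
  M%:R * F x = \sum_(a < M) (cos_coef s F a * cos (angle a * x%:~R) +
                             sin_coef s F a * sin (angle a * x%:~R)).
Proof.
move=> us Fs sep.
transitivity (\sum_(z <- s) F z * dft_sum (x - z)).
  have [xs|xs] := boolP (x \in s).
    rewrite (bigD1_seq x)//= subrr dft_sum_dvd ?dvdz0// big1_seq ?addr0 1?mulrC//.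
    move=> z /andP[zx zs]; rewrite dft_sum_ndvd ?mulr0//.
    by apply/negP => /(sep _ zs) xz; rewrite xz eqxx in zx.
  rewrite Fs// mulr0 big1_seq// => z /andP[_ zs]; rewrite dft_sum_ndvd ?mulr0//.
  by apply/negP => /(sep _ zs) xz; rewrite xz zs in xs.
under eq_bigr do rewrite mulr_sumr.
rewrite exchange_big; apply: eq_bigr => a _ /=.
rewrite /cos_coef /sin_coef !mulr_suml -big_split; apply: eq_bigr => z _ /=.
by rewrite intrB mulrBr cosB; ring.
Qed.

Section energy_law.
Context d (T : measurableType d) (P : probability T R) (Y : T -> int).
Hypothesis mY : forall z, measurable [set w | Y w = z].
Let p := law P Y.

(** 1 - Re phi(t), phi being the characteristic function of the jump. *)
Definition symbol (t : R) : R := mean P Y (fun z => 1 - cos (t * z%:~R)).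

Let cos_summable t : summable_law P Y (fun z => 1 - cos (t * z%:~R)).
Proof.
apply: (@bounded_summable _ _ _ P Y mY _ 2) => z.
by rewrite ger0_norm ?subr_ge0 ?cos_le1//; have := cos_geN1 (t * z%:~R); lra.
Qed.

Let power_expand s F a z :
  (cos_coef s F a ^+ 2 + sin_coef s F a ^+ 2) * (1 - cos (angle a * z%:~R)) =
  \sum_(x <- s) \sum_(y <- s) F x * F y * (cos (angle a * (x - y)%:~R) -
    cos (angle a * (x - y + z)%:~R) / 2 - cos (angle a * (x - y - z)%:~R) / 2).
Proof.
rewrite !expr2 /cos_coef /sin_coef !mulr_suml -big_split mulr_suml /=.
apply: eq_bigr => x _; rewrite !mulr_sumr -big_split mulr_suml /=.
apply: eq_bigr => y _; rewrite !intrD !mulrDr !intrN !mulrN.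
by rewrite !cosB !cosD !cosN !sinN sinB; field.
Qed.

(* Wrapping the jump law around Z/MZ only lowers the energy, because [F >= 0]. *)
Lemma dft_energy s F : uniq s -> (forall i, 0 <= F i) ->
  (forall x y, x \in s -> y \in s -> (M%:Z %| x - y)%Z -> x = y) ->
  \sum_(a < M) (cos_coef s F a ^+ 2 + sin_coef s F a ^+ 2) * symbol (angle a) <=
  M%:R * form p s F.
Proof.
move=> us F0 sep.
rewrite (eq_bigr (fun a : 'I_M => mean P Y (fun z => (cos_coef s F a ^+ 2 + sin_coef s F a ^+ 2) *
   (1 - cos (angle a * z%:~R))))); last first.
  by move=> a _; rewrite meanZ//; exact: cos_summable.
rewrite -mean_sum; last by move=> a; apply: summableZ; exact: cos_summable.
have ind_s b : summable_law P Y (fun z => (z == b)%:R) by exact: summable_indic.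
pose h z := M%:R * \sum_(x <- s) \sum_(y <- s) F x * F y *
  ((x == y)%:R - (z == y - x)%:R / 2 - (z == x - y)%:R / 2).
have hs x y : summable_law P Y (fun z => F x * F y *
  ((x == y)%:R - (z == y - x)%:R / 2 - (z == x - y)%:R / 2)).
  apply: summableZ; apply: (@bounded_summable _ _ _ P Y mY _ 2) => z.
  by case: (x == y); case: (z == _); case: (z == _); rewrite ler_norml /=; apply/andP; split; lra.
have hss x : summable_law P Y (fun z => \sum_(y <- s) F x * F y *
  ((x == y)%:R - (z == y - x)%:R / 2 - (z == x - y)%:R / 2)).
  by apply: summable_sum.
apply: (@le_trans _ _ (mean P Y h)).
  apply: le_mean => [| |z].
  - by apply: summable_sum => a; apply: summableZ; exact: cos_summable.
  - by apply: summableZ; apply: summable_sum.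
  under eq_bigr do rewrite power_expand.
  rewrite exchange_big /= /h mulr_sumr big_seq [leRHS]big_seq; apply: ler_sum => x xs.
  rewrite exchange_big /= mulr_sumr big_seq [leRHS]big_seq; apply: ler_sum => y ys.
  rewrite -mulr_sumr mulrCA ler_wpM2l ?mulr_ge0//.
  rewrite !sumrB -!mulr_suml -!/(dft_sum _).
  have -> : dft_sum (x - y) = M%:R * (x == y)%:R.
    have [->|xy] := eqVneq x y; first by rewrite subrr dft_sum_dvd ?dvdz0// mulr1.
    by rewrite mulr0 dft_sum_ndvd//; apply: contraNN xy => /(sep _ _ xs ys)/eqP.
  have := dft_sum_ge_indic (x - y + z); have := dft_sum_ge_indic (x - y - z).
  have -> : (x - y + z == 0) = (z == y - x) by rewrite addrC addr_eq0 opprB.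
  have -> : (x - y - z == 0) = (z == x - y) by rewrite subr_eq0 eq_sym.
  lra.
rewrite /h meanZ; last exact: summable_sum.
rewrite ler_pM2l ?ltr0n// mean_sum//.
under eq_bigr do rewrite mean_sum//.
have E x y : mean P Y (fun z => F x * F y *
    ((x == y)%:R - (z == y - x)%:R / 2 - (z == x - y)%:R / 2)) =
    F x * F y * ((x == y)%:R - p (y - x) / 2 - p (x - y) / 2).
  rewrite meanZ; last first.
    apply: (@bounded_summable _ _ _ P Y mY _ 2) => z.
    by case: (x == y); case: (z == _); case: (z == _); rewrite ler_norml /=; apply/andP; split; lra.
  congr (_ * _).
  rewrite (_ : (fun z : int => _) = fun z => (x == y)%:R +
     (- 2^-1 * (z == y - x)%:R + - 2^-1 * (z == x - y)%:R)); last first.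
    by apply/funext => z; ring.
  have cs : summable_law P Y (fun=> (x == y)%:R).
    by apply: (@bounded_summable _ _ _ P Y mY _ 1) => z; case: (x == y); rewrite ?normr0 ?normr1.
  rewrite meanD//; last by apply: summableD; apply: summableZ.
  rewrite meanD; [|by apply: summableZ..].
  by rewrite !meanZ// mean_cst !mean_indic// -/p; ring.
under eq_bigr do under eq_bigr do rewrite E.
rewrite /form.
have -> : \sum_(i <- s) \sum_(y <- s) F i * F y * ((i == y)%:R - p (y - i) / 2 - p (i - y) / 2)
  = \sum_(i <- s) F i ^+ 2 - (\sum_(i <- s) \sum_(y <- s) F i * F y * p (y - i)) / 2 -
    (\sum_(i <- s) \sum_(y <- s) F i * F y * p (i - y)) / 2.
  rewrite !mulr_suml -!sumrB big_seq [RHS]big_seq; apply: eq_bigr => x xs.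
  rewrite !mulr_suml.
  have -> : F x ^+ 2 = \sum_(y <- s) F x * F y * (x == y)%:R.
    rewrite (bigD1_seq x)//= eqxx mulr1 big1 ?addr0 ?expr2// => y.
    by rewrite eq_sym => /negbTE ->; rewrite mulr0.
  by rewrite -!sumrB; apply: eq_bigr => y _; ring.
(* Exchanging the two variables identifies both sums: only the symmetric part of [p] enters the
   energy. *)
have -> : \sum_(i <- s) \sum_(y <- s) F i * F y * p (y - i) =
   \sum_(i <- s) \sum_(y <- s) F i * F y * p (i - y).
  rewrite exchange_big; apply: eq_bigr => x _; apply: eq_bigr => y _; ring.
rewrite le_eqVlt; apply/orP; left; apply/eqP.
rewrite (_ : _ - _ / 2 - _ = \sum_(i <- s) F i ^+ 2 - (\sum_(i <- s) \sum_(y <- s) F i * F y * p (i - y))); last by field.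
rewrite -sumrB; apply: eq_bigr => x _; rewrite mulrBr expr2 mulr_sumr; congr (_ - _).
by apply: eq_bigr => y _; ring.
Qed.

Lemma symbol_ge0 t : 0 <= symbol t.
Proof. by apply: Rintegral_ge0 => w _; rewrite subr_ge0 cos_le1. Qed.

(** Cauchy-Schwarz over frequencies, linearised with [lam]. The frequency 0, at which the symbol
    vanishes, cancels in [F x - F y]. *)
Lemma dft_variation s F x y lam : uniq s -> (forall i, 0 <= F i) ->
  (forall i, i \notin s -> F i = 0) ->
  (forall x y, x \in s -> y \in s -> (M%:Z %| x - y)%Z -> x = y) ->
  (forall z, z \in s -> (M%:Z %| x - z)%Z -> x = z) ->
  (forall z, z \in s -> (M%:Z %| y - z)%Z -> y = z) ->
  (forall a, (0 < a < M)%N -> 0 < symbol (angle a)) -> 0 < lam ->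
  F x - F y <= lam * form p s F +
    (\sum_(1 <= a < M) (2 - 2 * cos (angle a * (x - y)%:~R)) / symbol (angle a)) /
      (4 * lam * M%:R).
Proof.
move=> us F0 Fs seps sepx sepy pos lam0.
have MR : 0 < M%:R :> R by rewrite ltr0n.
pose f1 a := cos_coef s F a * cos (angle a * x%:~R) + sin_coef s F a * sin (angle a * x%:~R) -
  (cos_coef s F a * cos (angle a * y%:~R) + sin_coef s F a * sin (angle a * y%:~R)).
have E1 : M%:R * F x - M%:R * F y = \sum_(0 <= a < M) f1 a.
  by rewrite !(dft_inversion us Fs)// -sumrB big_mkord.
pose f2 a := (cos_coef s F a ^+ 2 + sin_coef s F a ^+ 2) * symbol (angle a).
have E2 : \sum_(0 <= a < M) f2 a <= M%:R * form p s F by rewrite big_mkord; exact: dft_energy.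
rewrite -(ler_pM2l MR) mulrBr E1 mulrDr mulrCA.
rewrite (_ : M%:R * (_ / _) =
  (\sum_(1 <= a < M) (2 - 2 * cos (angle a * (x - y)%:~R)) / symbol (angle a)) / (4 * lam)); last first.
  by field; rewrite !gt_eqF.
apply: (@le_trans _ _ (lam * (\sum_(0 <= a < M) f2 a) +
  (\sum_(1 <= a < M) (2 - 2 * cos (angle a * (x - y)%:~R)) / symbol (angle a)) / (4 * lam))); last first.
  by rewrite lerD2r ler_pM2l.
rewrite !(big_ltn M0).
set h0 := (X in X + _ <= _).
have -> : h0 = 0.
  by rewrite /h0 /f1 /angle !(mulr0, mul0r) !sin0 !cos0; ring.
rewrite add0r mulrDr mulr_suml -addrA.
apply: ler_wpDl.
  apply: mulr_ge0; first exact: ltW.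
  by apply: mulr_ge0; [rewrite addr_ge0 ?sqr_ge0|exact: symbol_ge0].
rewrite mulr_sumr -big_split /= big_nat [leRHS]big_nat; apply: ler_sum => a aM.
have ps := pos a aM.
rewrite /f1 /f2; set C := cos_coef _ _ _; set S := sin_coef _ _ _.
set c1 := cos (angle a * x%:~R); set c2 := cos (angle a * y%:~R).
set s1 := sin (angle a * x%:~R); set s2 := sin (angle a * y%:~R).
have -> : 2 - 2 * cos (angle a * (x - y)%:~R) = (c1 - c2) ^+ 2 + (s1 - s2) ^+ 2.
  have e1 : c1 ^+ 2 + s1 ^+ 2 = 1 by exact: cos2Dsin2.
  have e2 : c2 ^+ 2 + s2 ^+ 2 = 1 by exact: cos2Dsin2.
  rewrite intrB mulrBr cosB -/c1 -/c2 -/s1 -/s2.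
  have -> : (c1 - c2) ^+ 2 + (s1 - s2) ^+ 2 =
    (c1 ^+ 2 + s1 ^+ 2) + (c2 ^+ 2 + s2 ^+ 2) - 2 * (c1 * c2 + s1 * s2) by ring.
  by rewrite e1 e2; ring.
set w := symbol _ in ps *.
have amgm A B : A * B <= lam * (A ^+ 2 * w) + B ^+ 2 / w / (4 * lam).
  rewrite -subr_ge0 (_ : _ - _ = (2 * lam * w * A - B) ^+ 2 / (4 * lam * w)).
    by rewrite divr_ge0 ?sqr_ge0 ?mulr_ge0 ?ltW.
  by field; rewrite !gt_eqF.
have := amgm C (c1 - c2); have := amgm S (s1 - s2).
rewrite !mulrDl !mulrDr; lra.
Qed.

End energy_law.
End fourier.

(** * Lower bound for the symbol *)

Section real_estimates.
Context {R : realType}.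

Lemma norm_sin_le (x : R) : `|sin x| <= `|x|.
Proof.
wlog x0 : x / 0 < x.
  move=> H; have [x0|x0|->] := ltgtP x 0; [|exact: H|by rewrite sin0 normr0].
  by rewrite -normrN -sinN -(normrN x) H// oppr_gt0.
have [c _] : exists2 c, c \in `]0, x[%R & sin x - sin 0 = cos c * (x - 0).
  apply: (@MVT _ sin cos 0 x x0 (fun y _ => is_derive_sin y)).
  by apply: continuous_subspaceT => y; exact: continuous_sin.
rewrite sin0 !subr0 => ->; rewrite normrM ler_piMl//; exact: cos_max.
Qed.

Lemma cos_lipschitz (x y : R) : `|cos x - cos y| <= `|x - y|.
Proof.
have -> : cos x - cos y = - 2 * sin ((x + y) / 2) * sin ((x - y) / 2).
  have -> : x = (x + y) / 2 + (x - y) / 2 by field.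
  have -> : cos y = cos ((x + y) / 2 - (x - y) / 2) by congr cos; field.
  set u := (x + y) / 2; set v := (x - y) / 2.
  have -> : (u + v + y) / 2 = u by rewrite /u /v; field.
  have -> : (u + v - y) / 2 = v by rewrite /u /v; field.
  by rewrite cosD cosB; ring.
rewrite !normrM normrN (ger0_norm (_ : 0 <= 2 :> R))//.
have := norm_sin_le ((x - y) / 2); rewrite normrM (ger0_norm (_ : 0 <= 2^-1 :> R))//.
have := sin_max ((x + y) / 2).
have := normr_ge0 (sin ((x + y) / 2)); have := normr_ge0 (sin ((x - y) / 2)).
set a := `|sin _|; set b := `|sin _|; nra.
Qed.

Lemma cos_quadratic (x : R) : 2 - 2 * cos x <= x ^+ 2.
Proof.
have -> : 2 - 2 * cos x = 4 * sin (x / 2) ^+ 2.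
  have {1}-> : x = (x / 2) *+ 2 by rewrite mulr2n; field.
  by rewrite cos_mulr2n sin2cos2 mulr2n; ring.
have := norm_sin_le (x / 2); rewrite normrM (ger0_norm (_ : 0 <= 2^-1 :> R))// => h.
have : `|sin (x / 2)| ^+ 2 <= (`|x| / 2) ^+ 2 by rewrite lerXn2r ?nnegrE// divr_ge0.
by rewrite -(@real_normK _ (sin _)) ?num_real// -(@real_normK _ x) ?num_real// expr_div_n; lra.
Qed.

(** The index 0 collects the low frequencies, where the numerator [2 - 2 * cos] makes up for the
    smallness of the symbol; hence the value 1 there. *)
Definition zeta_term (b : R) (j : nat) : R := if j == 0%N then 1 else j%:R `^ (- b).

Lemma zeta_term_ge0 b j : 0 <= zeta_term b j.
Proof. by rewrite /zeta_term; case: ifP => // _; exact: powR_ge0. Qed.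

Lemma powR_expln (x b : R) : 0 < x -> x `^ b = expR (b * ln x).
Proof. by move=> x0; rewrite /powR gt_eqF. Qed.

(** Integral test by telescoping: each term is at most a difference of values of k y^(1 - b), with k
    = 1/(b - 1). *)
Lemma zeta_bounded (b : R) : 1 < b -> exists2 Z, 0 < Z &
  forall n, \sum_(j < n) zeta_term b j <= Z.
Proof.
move=> b1; pose k := (b - 1)^-1; pose s := b - 1.
have s0 : 0 < s by rewrite subr_gt0.
have k0 : 0 < k by rewrite invr_gt0.
have ks : k * s = 1 by rewrite /k mulVf// gt_eqF.
have main n : \sum_(j < n.+2) zeta_term b j <= 2 + k - k * n.+1%:R `^ (- s).
  elim: n => [|n IH].
    rewrite !big_ord_recr big_ord0 /zeta_term /= powR1 mulr1; lra.
  rewrite big_ord_recr /=; apply: le_trans (lerD IH (lexx _)) _.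
  rewrite /zeta_term /=.
  suff : n.+2%:R `^ (- b) <= k * n.+1%:R `^ (- s) - k * n.+2%:R `^ (- s) by lra.
  pose y : R := n.+1%:R; rewrite -/y; have y0 : 0 < y by rewrite ltr0n.
  have -> : n.+2%:R = y + 1 :> R by rewrite natr1.
  have y1 : 0 < y + 1 by rewrite addr_gt0.
  have -> : (y + 1) `^ (- b) = (y + 1) `^ (- s) / (y + 1).
    rewrite -[X in _ / X](powRr1 (ltW y1)) -powRB; last by rewrite (gt_eqF y1) implybT.
    by congr (_ `^ _); rewrite /s; ring.
  have yE : y `^ (- s) = (y + 1) `^ (- s) * expR (s * (ln (y + 1) - ln y)).
    by rewrite !powR_expln// -expRD; congr expR; ring.
  have ly : (y + 1)^-1 <= ln (y + 1) - ln y.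
    have := @le_ln1Dx _ (- (y + 1)^-1).
    rewrite (_ : 1 + - (y + 1)^-1 = y / (y + 1)); last by field; rewrite gt_eqF.
    rewrite ln_div ?posrE// => h; have : ln y - ln (y + 1) <= - (y + 1)^-1.
      by apply: h; rewrite ltrN2 invf_lt1// ltrDr.
    lra.
  have ex : 1 + s / (y + 1) <= expR (s * (ln (y + 1) - ln y)).
    apply: le_trans (expR_ge1Dx _); rewrite lerD2l ler_pM2l//.
  set B := (y + 1) `^ (- s); have B0 : 0 < B by exact: powR_gt0.
  have : k * B * (1 + s / (y + 1)) <= k * B * expR (s * (ln (y + 1) - ln y)).
    by rewrite ler_pM2l// mulr_gt0.
  rewrite (_ : k * B * (1 + s / (y + 1)) = k * B + (k * s) * (B / (y + 1))); last by ring.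
  rewrite ks mul1r yE -/B; lra.
exists (2 + k); first by lra.
case=> [|[|n]].
- by rewrite big_ord0; lra.
- by rewrite big_ord_recr big_ord0 /zeta_term /=; lra.
apply: le_trans (main n) _; rewrite gerBl mulr_ge0 ?powR_ge0// ltW//.
Qed.

Lemma sum_blocks (w : nat -> R) A r : (0 < A)%N ->
  \sum_(0 <= a < r * A) w (a %/ A)%N = A%:R * \sum_(j < r) w j.
Proof.
move=> A0; elim: r => [|r IH]; first by rewrite mul0n big_geq// big_ord0 mulr0.
rewrite mulSn addnC (big_cat_nat (n := r * A))//= ?leq_addr// IH big_ord_recr mulrDr; congr (_ + _).
rewrite -[X in \sum_(X <= _ < _) _]add0n big_addn addKn (eq_big_nat _ _ (F2 := fun=> w r)) => [|i /andP[_ iA]]; last first.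
  by rewrite addnC divnMDl// divn_small// addn0.
by rewrite big_const_nat subn0 iter_addr_0 mulr_natl.
Qed.

End real_estimates.

Section jump_law_estimates.
Context d (T : measurableType d) (R : realType) (P : probability T R).
Variable Y : T -> int.
Hypothesis mY : forall z, measurable [set w | Y w = z].
Variables (beta cplus : R).
Hypothesis beta12 : 1 < beta <= 2.
Hypothesis cplus0 : 0 < cplus.
Hypothesis iY : summable_law P Y (fun z => z%:~R).
Hypothesis lattice : forall t : R,
  (mean P Y (fun z => cos (t * z%:~R)) = 1 /\ mean P Y (fun z => sin (t * z%:~R)) = 0)
  <-> exists m : int, t = 2 * pi * m%:~R.
Hypothesis tail : (fun x : R => x `^ beta * pr P [set w | x < (Y w)%:~R]) @ +oo --> cplus.

Let sym := symbol P Y.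

Let cosS t : summable_law P Y (fun z => cos (t * z%:~R)).
Proof. by apply: (@bounded_summable _ _ _ P Y mY _ 1) => z; exact: cos_max. Qed.

Let sinS t : summable_law P Y (fun z => sin (t * z%:~R)).
Proof. by apply: (@bounded_summable _ _ _ P Y mY _ 1) => z; exact: sin_max. Qed.

Let cstS k : summable_law P Y (fun=> k).
Proof. by apply: (@bounded_summable _ _ _ P Y mY _ `|k|) => z. Qed.

Let symS t : summable_law P Y (fun z => 1 - cos (t * z%:~R)).
Proof.
apply: (@bounded_summable _ _ _ P Y mY _ 2) => z.
by rewrite ger0_norm ?subr_ge0 ?cos_le1//; have := cos_geN1 (t * z%:~R); lra.
Qed.

Let symE t : sym t = 1 - mean P Y (fun z => cos (t * z%:~R)).
Proof.
rewrite /sym /symbol (_ : (fun z : int => _) = fun z => 1 + -1 * cos (t * z%:~R)).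
  by rewrite meanD ?mean_cst// ?meanZ ?mulN1r//; apply: summableZ.
by apply/funext => z; rewrite mulN1r.
Qed.

(** A zero of the symbol forces the mean of the cosine to be 1 and that of the sine to be 0, so
    [lattice] puts [t] in 2 pi Z, which misses (0, pi]. *)
Lemma symbol_gt0 t : 0 < t <= pi -> 0 < sym t.
Proof.
move=> /andP[t0 tpi]; rewrite lt_neqAle symbol_ge0 andbT eq_sym; apply/eqP => st0.
have c1 : mean P Y (fun z => cos (t * z%:~R)) = 1 by have := symE t; rewrite st0; lra.
have s0 : mean P Y (fun z => sin (t * z%:~R)) = 0.
  (* From sin^2 <= 2 (1 - cos) and the square of [2 * lam - k * sin x]: k sin x <= lam + (1 - cos
     x)/(2 lam), and the right side has mean [lam]. *)
  have bound k : `|k| = 1 -> forall lam, 0 < lam -> k * mean P Y (fun z => sin (t * z%:~R)) <= lam.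
    move=> k1 lam lam0; rewrite -meanZ//.
    have -> : lam = mean P Y (fun z => lam + (2 * lam)^-1 * (1 - cos (t * z%:~R))).
      rewrite meanD//; last by apply: summableZ.
      by rewrite mean_cst meanZ// -/(symbol P Y t) -/sym st0 mulr0 addr0.
    apply: le_mean => [||z]; [exact: summableZ|by apply: summableD => //; apply: summableZ|].
    set x := t * _; have : sin x ^+ 2 <= 2 * (1 - cos x).
      by rewrite sin2cos2; have := cos_le1 x; have := cos_geN1 x; nra.
    have : 0 <= (2 * lam - k * sin x) ^+ 2 / (4 * lam) by rewrite divr_ge0 ?sqr_ge0// mulr_ge0// ltW.
    have k2 : k ^+ 2 = 1 by rewrite -(@real_normK _ k) ?num_real// k1 expr1n.
    rewrite (_ : _ / _ = lam - k * sin x + k ^+ 2 * sin x ^+ 2 / (4 * lam)); last by field; rewrite gt_eqF.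
    rewrite k2 mul1r => h1 h2.
    have : sin x ^+ 2 / (4 * lam) <= 2 * (1 - cos x) / (4 * lam).
      by rewrite ler_pM2r// invr_gt0 mulr_gt0.
    rewrite (_ : 2 * (1 - cos x) / (4 * lam) = (2 * lam)^-1 * (1 - cos x)); last by field; rewrite gt_eqF.
    lra.
  apply/eqP; rewrite eq_le; apply/andP; split; apply/ler_addgt0Pl => e e0.
    by rewrite addr0; have := bound 1 (normr1 _) e e0; rewrite mul1r.
  by have := bound (-1) (normrN1 _) e e0; rewrite mulN1r; lra.
have [m tm] := (lattice t).1 (conj c1 s0).
have pi0 : 0 < pi :> R := pi_gt0 R.
have : (0 < m%:~R :> R).
  by rewrite -(pmulr_rgt0 _ (_ : 0 < 2 * pi)) -?tm// mulr_gt0.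
rewrite ltr0z gtz0_ge1 => m1.
have : (1 <= m%:~R :> R) by rewrite ler1z.
by rewrite tm in tpi; nra.
Qed.

Lemma symbol_lipschitz t u : `|sym t - sym u| <= `|t - u| * mean P Y (fun z => `|z%:~R|).
Proof.
have nS : summable_law P Y (fun z => `|z%:~R : R|).
  by apply: (dominated_summable mY iY) => z; rewrite normr_id.
have half a b : sym a - sym b <= `|a - b| * mean P Y (fun z => `|z%:~R|).
  rewrite -meanZ// lerBlDr /sym /symbol -meanD//; last exact: summableZ.
  apply: le_mean => [||z]//; first by apply: summableD => //; exact: summableZ.
  rewrite -normrM mulrBl; have := cos_lipschitz (a * z%:~R) (b * z%:~R).
  by rewrite ler_norml => /andP[]; lra.
rewrite ler_norml half andbT lerNl opprB distrC; exact: half.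
Qed.

(** Jumps between [x] and [2 * x], with x = 1/t, give an angle in [1, 2], inside [0, pi], where 1 -
    cos >= 1 - cos 1. Their mass is of order x^(-beta): since 2^beta >= 2, the tolerance [cplus / 4]
    leaves 3/4 - 5/8 = 1/8 of [cplus]. *)
Lemma symbol_lower_near0 : exists2 c, 0 < c & exists2 t0, 0 < t0 &
  forall t, 0 < t <= t0 -> c * t `^ beta <= sym t.
Proof.
have q0 : 0 < cplus / 4 by rewrite divr_gt0.
have /cvgrPdist_lt/(_ _ q0) := tail.
move=> [x0 [_ Hx0]].
pose x1 := Num.max 1 (x0 + 1).
have x1_1 : 1 <= x1 by rewrite /x1 le_max lexx.
have x1_x0 : x0 < x1 by rewrite /x1 lt_max ltrDl ltr01 orbT.
pose k : R := 1 - cos 1.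
have k0 : 0 < k.
  rewrite /k subr_gt0 -[X in _ < X](@cos0 R) ltr_cos ?ltr01// in_itv/=.
    by rewrite lexx pi_ge0.
  by rewrite ?ler01 (le_trans _ (pi_ge2 R))// ler1n.
exists (k * (cplus / 8)); first by rewrite mulr_gt0// divr_gt0.
exists x1^-1 => [|t /andP[t0 tx1]]; first by rewrite invr_gt0 (lt_le_trans _ x1_1).
pose x := t^-1; have xx1 : x1 <= x by rewrite /x -[x1]invrK lef_pV2 ?posrE// invr_gt0 (lt_le_trans _ x1_1).
have xp : 0 < x by rewrite invr_gt0.
have mt y : measurable [set w | y < ((Y w)%:~R : R)].
  rewrite (_ : [set w | _] = ((fun z => z%:~R) \o Y) @^-1` `]y, +oo[).
    by rewrite -[X in measurable X]setTI; apply: (int_fun_measurable _ mY).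
  by apply/seteqP; split => w /=; rewrite in_itv/= andbT.
have tl1 : cplus * 3 / 4 <= x `^ beta * pr P [set w | x < (Y w)%:~R].
  have := Hx0 x (lt_le_trans x1_x0 xx1); rewrite ltr_norml => /andP[_]; lra.
have tl2 : x `^ beta * pr P [set w | 2 * x < (Y w)%:~R] <= cplus * 5 / 8.
  have := Hx0 (2 * x) _; rewrite (_ : x0 < 2 * x); last by rewrite (lt_le_trans x1_x0)// (le_trans xx1)//; lra.
  move=> /(_ isT); rewrite ltr_norml => /andP[h _].
  rewrite powRM// ?ltW// in h.
  have two : 2 <= 2 `^ beta :> R by rewrite le1r_powR ?ler1n//; case/andP: beta12 => /ltW.
  have pp := powR_ge0 x beta; have ppr := pr_ge0 P [set w | 2 * x < ((Y w)%:~R : R)].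
  have : 2 * (x `^ beta * pr P [set w | 2 * x < ((Y w)%:~R : R)]) <=
     2 `^ beta * (x `^ beta * pr P [set w | 2 * x < ((Y w)%:~R : R)]).
    by rewrite ler_wpM2r// mulr_ge0.
  by rewrite mulrA; lra.
have low : k * (pr P [set w | x < (Y w)%:~R] - pr P [set w | 2 * x < (Y w)%:~R]) <= sym t.
  pose I (y : R) (z : int) : R := (y < z%:~R :> R)%:R.
  have IS y : summable_law P Y (I y).
    by apply: (@bounded_summable _ _ _ P Y mY _ 1) => z; rewrite /I; case: (_ < _); rewrite ?normr0 ?normr1.
  have mI y : mean P Y (I y) = pr P [set w | y < (Y w)%:~R].
    rewrite /mean /pr /Rintegral; congr fine.
    rewrite -[in RHS](setIT [set w | _]) -integral_indic//.
    apply: eq_integral => w _; rewrite indicE /I.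
    suff -> : (w \in [set w | y < (Y w)%:~R]) = (y < (Y w)%:~R) by [].
    by apply/idP/idP => [/set_mem//|h]; exact/mem_set.
  rewrite -!mI (_ : k * _ = k * mean P Y (I x) + (- k) * mean P Y (I (2 * x))); last by ring.
  rewrite -!meanZ// -meanD//; [|exact: summableZ..].
  apply: le_mean => [||z]//; first by apply: summableD; exact: summableZ.
  rewrite /I; have [h1|h1] := ltP x z%:~R; last first.
    rewrite (_ : (2 * x < z%:~R) = false); last by apply/negbTE; rewrite -leNgt; lra.
    by rewrite !mulr0 addr0 subr_ge0 cos_le1.
  have [h2|h2] := ltP (2 * x) z%:~R.
    by rewrite !mulr1 subrr subr_ge0 cos_le1.
  rewrite mulr1 mulr0 addr0 /k lerD2l lerN2.
  have tz1 : 1 <= t * z%:~R by rewrite -ler_pdivrMl// mulr1; exact: ltW.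
  have tz2 : t * z%:~R <= 2.
    by rewrite -ler_pdivlMl// mulrC.
  have m1 : (1 : R) \in `[0, pi] by rewrite in_itv/= ler01 (le_trans _ (pi_ge2 R))// ler1n.
  have m2 : t * z%:~R \in `[0, pi].
    by rewrite in_itv/= (le_trans ler01 tz1) (le_trans tz2 (pi_ge2 R)).
  by rewrite leNgt (ltr_cos m2 m1) -leNgt.
apply: le_trans low; rewrite -mulrA ler_pM2l//.
have xb : x `^ beta * t `^ beta = 1 by rewrite -powRM ?ltW// /x mulVf ?gt_eqF// powR1.
have tb : 0 < t `^ beta by exact: powR_gt0.
set p1 := pr _ _ in tl1 *; set p2 := pr _ _ in tl2 *.
rewrite -(ler_pM2l (powR_gt0 beta xp)) mulrCA xb mulr1 mulrBr; lra.
Qed.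

(** Away from 0 by compactness: the symbol is continuous and positive on [t0, pi]. *)
Lemma symbol_lower : exists2 c, 0 < c & forall t, 0 < t <= pi -> c * t `^ beta <= sym t.
Proof.
have [c c0 [t0 t00 H]] := symbol_lower_near0.
have pi0 : 0 < pi :> R := pi_gt0 R.
have cont : continuous sym.
  move=> t; apply/cvgrPdist_le => e e0.
  set K := mean P Y (fun z => `|z%:~R|).
  have K1 : 0 < K + 1 by rewrite ltr_wpDl// Rintegral_ge0.
  near=> u; apply: le_trans (symbol_lipschitz t u) _; rewrite -/K.
  apply: (@le_trans _ _ (`|t - u| * (K + 1))); first by rewrite ler_wpM2l// lerDl.
  rewrite -ler_pdivlMr//; near: u.
  by apply: cvgr_dist_le => //; rewrite divr_gt0.
have [t0pi|pit0] := leP t0 pi; last first.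
  by exists c => // t /andP[h1 h2]; apply: H; rewrite h1 (le_trans h2)// ltW.
have [u uI um] := EVT_min t0pi (continuous_subspaceT cont).
have su : 0 < sym u.
  by apply: symbol_gt0; move: uI; rewrite in_itv/= => /andP[h ->]; rewrite (lt_le_trans t00).
have pb : 0 < pi `^ beta :> R by exact: powR_gt0.
exists (Num.min c (sym u / pi `^ beta)); first by rewrite lt_min c0 divr_gt0.
move=> t /andP[h1 h2]; have [h3|h3] := leP t t0.
  apply: le_trans (H t _); last by rewrite h1.
  by rewrite ler_wpM2r ?powR_ge0// ge_min lexx.
apply: le_trans (um t _); last by rewrite in_itv/= h2 ltW.
apply: (@le_trans _ _ (sym u / pi `^ beta * pi `^ beta)); last by rewrite divfK// gt_eqF.
apply: ler_pM; rewrite ?powR_ge0//.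
- by rewrite le_min ltW//= divr_ge0// ltW.
- by rewrite ge_min lexx orbT.
- by rewrite ge0_ler_powR ?nnegrE// ?ltW//; case/andP: beta12 => b1 _; rewrite (lt_trans _ b1).
Unshelve. all: by end_near. Qed.

End jump_law_estimates.

(** * Resistance bound *)

Section variation_bound.
Context d (T : measurableType d) (R : realType) (P : probability T R).
Variable Y : T -> int.
Hypothesis mY : forall z, measurable [set w | Y w = z].
Variables (beta c : R).
Hypothesis beta12 : 1 < beta <= 2.
Hypothesis c0 : 0 < c.
Hypothesis sym_lower : forall t, 0 < t <= pi -> c * t `^ beta <= symbol P Y t.

Let sym := symbol P Y.

Lemma symbol_reflect t : sym (2 * pi - t) = sym t.
Proof.
rewrite /sym /symbol; congr mean; apply/funext => z; congr (1 - _).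
rewrite mulrBl addrC cos_int_period -[in RHS]cosN; congr cos; ring.
Qed.

Lemma small_dvdz (M : nat) (z : int) : (`|z| < M)%N -> (M%:Z %| z)%Z -> z = 0.
Proof.
move=> zM; rewrite dvdzE /= => dv; apply/eqP; rewrite -absz_eq0 -leqn0 leqNgt.
by apply/negP => z0; have := dvdn_leq z0 dv; rewrite leqNgt zM.
Qed.

Section fixed_modulus.
Variables (r A : nat) (z : int).
Hypotheses (r0 : (0 < r)%N) (A0 : (0 < A)%N) (zr : (`|z| <= r)%N).
Let M := (r * A)%N.
Let h a := (2 - 2 * cos (angle M a * z%:~R)) / sym (angle M a) : R.
(** The angle times [r] is 2 pi a / A, so [a %/ A] measures the frequency on the scale of the
    distance [r]. Summing [u] yields a factor [A] that cancels against the modulus [r * A], which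
    can therefore be arbitrarily large. *)
Let u a := 4 * r%:R `^ beta / c * zeta_term beta (a %/ A)%N.

Let M0 : (0 < M)%N. Proof. by rewrite muln_gt0 r0. Qed.
Let MR : 0 < M%:R :> R. Proof. by rewrite ltr0n. Qed.
Let pi0 : 0 < pi :> R. Proof. exact: pi_gt0. Qed.

Let angle_pi a : (0 < a)%N -> (2 * a <= M)%N -> 0 < (angle M a : R) <= pi.
Proof.
move=> a0 aM; rewrite /angle divr_gt0 ?mulr_gt0 ?ltr0n//=.
rewrite ler_pdivrMr// -mulrA mulrCA ler_pM2l//.
by rewrite -natrM ler_nat.
Qed.

Let angle_reflect a : (a <= M)%N -> angle M (M - a) = 2 * pi - angle M a :> R.
Proof. by move=> aM; rewrite /angle natrB//; field; rewrite gt_eqF. Qed.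

Lemma symbol_angle_gt0 a : (0 < a < M)%N -> 0 < sym (angle M a).
Proof.
move=> /andP[a0 aM].
have pos b : (0 < b)%N -> (2 * b <= M)%N -> 0 < sym (angle M b).
  move=> b0 bM; have tb := angle_pi b0 bM; apply: lt_le_trans (sym_lower tb).
  by case/andP: tb => tb _; rewrite mulr_gt0// powR_gt0.
have [h1|h1] := leqP (2 * a) M; first exact: pos.
rewrite -symbol_reflect -angle_reflect ?(ltnW aM)//; apply: pos.
  by rewrite subn_gt0.
by rewrite mulnBr leq_subLR mulSn mul1n leq_add2r; apply: ltnW.
Qed.

Let h_reflect a : (a <= M)%N -> h (M - a) = h a.
Proof.
move=> aM; rewrite /h angle_reflect// symbol_reflect; congr ((2 - 2 * _) / _).
rewrite mulrBl addrC cos_int_period -[in RHS]cosN; congr cos; ring.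
Qed.

Let u_ge0 a : 0 <= u a.
Proof. by rewrite mulr_ge0 ?zeta_term_ge0// divr_ge0 ?mulr_ge0 ?powR_ge0// ltW. Qed.

Let h_le a : (0 < a)%N -> (2 * a <= M)%N -> h a <= u a.
Proof.
move=> a0 aM; have /andP[t0 tpi] := angle_pi a0 aM.
have := sym_lower (angle_pi a0 aM); rewrite /h /u.
set t := angle M a in t0 tpi *; rewrite -/(sym t) => low.
have tb : 0 < t `^ beta by exact: powR_gt0.
have s0 : 0 < sym t by rewrite (lt_le_trans _ low)// mulr_gt0.
set num := 2 - _.
have rR : 0 < r%:R :> R by rewrite ltr0n.
have AR : 0 < A%:R :> R by rewrite ltr0n.
pose x := t * r%:R; have x0 : 0 < x by rewrite mulr_gt0.
have num4 : num <= 4 by rewrite /num; have := cos_geN1 (t * z%:~R); lra.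
have numx : num <= x ^+ 2.
  apply: le_trans (cos_quadratic _) _; rewrite -(@real_normK _ (t * _)) ?num_real//.
  rewrite lerXn2r ?nnegrE ?(ltW x0)// normrM (gtr0_norm t0) ler_pM2l//.
  by rewrite -intr_norm -abszE -[leRHS]/(r%:Z%:~R) ler_int lez_nat.
have num0 : 0 <= num by rewrite /num; have := cos_le1 (t * z%:~R); lra.
rewrite ler_pdivrMr// (le_trans _ (ler_wpM2l (u_ge0 a) low))// /u.
set w := zeta_term _ _.
rewrite (_ : _ * w * _ = 4 * (x `^ beta) * w); last first.
  by rewrite /x powRM ?(ltW t0) ?(ltW rR)//; field; rewrite gt_eqF.
case/andP: beta12 => b1 b2.
have b0 : 0 <= beta by rewrite ltW// (lt_trans _ b1).
(* For [a < A]: the quadratic numerator is used when [x <= 1], where x^2 <= x^beta because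
   [beta <= 2], and the constant 4 beyond. For [a >= A], [x] is at least [a %/ A]. *)
rewrite /w /zeta_term; case: ifPn => [_|].
  rewrite mulr1; have [x1|x1] := leP x 1.
    apply: le_trans numx _; apply: (@le_trans _ _ (x `^ beta)).
      by rewrite -powR_mulrn ?(ltW x0)// ger_powR ?x0.
    by have := powR_ge0 x beta; lra.
  apply: le_trans num4 _; rewrite ler_peMr//.
  by rewrite -[X in X <= _](powRr0 x) ler_powR// ltW.
rewrite -lt0n; set j := (a %/ A)%N => j0.
have jR : 0 < j%:R :> R by rewrite ltr0n.
have jx : j%:R <= x.
  apply: (@le_trans _ _ (a%:R / A%:R)).
    by rewrite ler_pdivlMr// -natrM ler_nat; exact: leq_trunc_div.
  rewrite /x /t /angle /M natrM.
  rewrite (_ : 2 * pi * a%:R / (r%:R * A%:R) * r%:R = 2 * pi * (a%:R / A%:R)); last first.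
    by field; rewrite !gt_eqF.
  by rewrite ler_peMl ?divr_ge0//; have := pi_ge2 R; lra.
apply: le_trans num4 _; rewrite -mulrA ler_peMr// powRN ler_pdivlMr ?powR_gt0// mul1r.
by rewrite ge0_ler_powR// ?nnegrE ltW.
Qed.

Lemma variation_sum_le Z : (\sum_(j < r) zeta_term beta j <= Z) ->
  \sum_(1 <= a < M) h a <= 8 * r%:R `^ beta / c * (A%:R * Z).
Proof.
move=> ZZ.
have step a : (0 < a < M)%N -> h a <= u a + u (M - a).
  move=> /andP[a0 aM]; have [h1|h1] := leqP (2 * a) M.
    by apply: ler_wpDr => //; exact: h_le.
  apply: ler_wpDl => //; rewrite -h_reflect ?(ltnW aM)//; apply: h_le.
    by rewrite subn_gt0.
  by rewrite mulnBr leq_subLR mulSn mul1n leq_add2r; apply: ltnW.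
apply: (@le_trans _ _ (\sum_(1 <= a < M) (u a + u (M - a)%N))).
  by rewrite big_nat [leRHS]big_nat; apply: ler_sum.
rewrite big_split /= [X in _ + X]big_nat_rev /=.
rewrite [X in _ + X](eq_big_nat _ _ (F2 := u)); last first.
  by move=> a /andP[a1 aM]; rewrite add1n subSS subKn// ltnW.
have ule : \sum_(1 <= a < M) u a <= \sum_(0 <= a < M) u a.
  by rewrite [leRHS](big_ltn M0) lerDr.
have uE : \sum_(0 <= a < M) u a = 4 * r%:R `^ beta / c * (A%:R * \sum_(j < r) zeta_term beta j).
  by rewrite -sum_blocks// mulr_sumr.
have q0 : 0 <= 4 * r%:R `^ beta / c by rewrite divr_ge0 ?mulr_ge0 ?powR_ge0// ltW.
have : 4 * r%:R `^ beta / c * (A%:R * \sum_(j < r) zeta_term beta j) <=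
  4 * r%:R `^ beta / c * (A%:R * Z) by rewrite ler_wpM2l// ler_wpM2l.
rewrite (_ : 8 * _ / c * _ = 2 * (4 * r%:R `^ beta / c * (A%:R * Z))); last by ring.
lra.
Qed.

End fixed_modulus.

Lemma law_var_bound : exists2 C, 0 < C & forall (s : seq int) (r : nat), uniq s -> (0 < r)%N ->
  var_bound (law P Y) s r%:R (C * r%:R `^ (beta - 1)).
Proof.
have [Z Z0 HZ] := zeta_bounded (andP beta12).1.
exists (2 * Z / c) => [|s r us r0 F F0 Fs x y xyr lam lam0]; first by rewrite divr_gt0 ?mulr_gt0.
pose D := (\sum_(v <- [:: x, y & s]) `|v|)%N.
have Dv v : v \in [:: x, y & s] -> (`|v| <= D)%N.
  by move=> vs; rewrite /D (big_rem v)//= leq_addr.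
(* Large enough for [x], [y] and the points of [s] to stay distinct modulo [r * A], so that Fourier
   inversion has no aliasing. *)
pose A := (2 * D).+1.
have AM : (A <= r * A)%N by rewrite leq_pmull.
have M0 : (0 < r * A)%N by rewrite muln_gt0 r0.
have sep u v : u \in [:: x, y & s] -> v \in [:: x, y & s] -> ((r * A)%N%:Z %| u - v)%Z -> u = v.
  move=> us' vs' dv; apply/eqP; rewrite -subr_eq0; apply/eqP; apply: small_dvdz dv.
  apply: leq_trans AM; rewrite ltnS mulSn mul1n.
  by apply: leq_trans (leqD_dist _ 0 _) _; rewrite subr0 sub0r abszN leq_add ?Dv.
have ms v : v \in s -> v \in [:: x, y & s] by move=> vs; rewrite !inE vs !orbT.
have mx : x \in [:: x, y & s] by rewrite inE eqxx.
have my : y \in [:: x, y & s] by rewrite !inE eqxx orbT.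
have xyr' : (`|x - y| <= r)%N.
  by move: xyr; rewrite -abszE -[X in _ <= X]/(r%:Z%:~R) ler_int lez_nat.
have := @dft_variation R (r * A)%N M0 _ T P Y mY s F x y lam us F0 Fs
  (fun u v us' vs' => sep u v (ms u us') (ms v vs')) (fun v vs' => sep x v mx (ms v vs'))
  (fun v vs' => sep y v my (ms v vs')) _ lam0.
move=> /(_ (fun a aM => symbol_angle_gt0 r0 (ltn0Sn _ : (0 < A)%N) aM)) /le_trans; apply; rewrite lerD2l.
have MR : 0 < (r * A)%:R :> R by rewrite ltr0n.
have q0 : 0 < 4 * lam * (r * A)%:R by rewrite !mulr_gt0.
rewrite ler_pdivrMr//; apply: le_trans (variation_sum_le r0 (ltn0Sn _ : (0 < A)%N) xyr' (HZ r)) _.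
have rR : 0 < r%:R :> R by rewrite ltr0n.
rewrite powRB; last by rewrite (gt_eqF rR) implybT.
rewrite powRr1 ?(ltW rR)// natrM le_eqVlt; apply/orP; left; apply/eqP.
by field; rewrite !gt_eqF.
Qed.

End variation_bound.

(** * Moments and exit from a window *)

Lemma nneseries_le (R : realType) (u : nat -> \bar R) (K : \bar R) :
  (forall n, 0 <= u n)%E -> (forall n, \sum_(0 <= i < n) u i <= K)%E ->
  (\sum_(0 <= i <oo) u i <= K)%E.
Proof.
move=> u0 uK; apply: lime_le; first by apply: is_cvg_nneseries => n _ _; exact: u0.
by near=> n; exact: uK.
Unshelve. all: by end_near. Qed.

Lemma geometric_sum_le (R : realType) (q : R) n : 0 <= q < 1 ->
  \sum_(0 <= i < n) q ^+ i <= (1 - q)^-1.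
Proof.
move=> /andP[q0 q1]; have q10 : 0 < 1 - q by rewrite subr_gt0.
have -> : \sum_(0 <= i < n) q ^+ i = (1 - q ^+ n) / (1 - q).
  elim: n => [|n IH]; first by rewrite big_geq// expr0 subrr mul0r.
  by rewrite big_nat_recr//= IH exprS; field; rewrite gt_eqF.
by rewrite ler_piMl ?invr_ge0 ?(ltW q10)// gerBl exprn_ge0.
Qed.

Definition window (N : nat) : seq int := [seq i%:Z - N%:Z | i <- iota 0 (2 * N).+1].

Lemma window_uniq N : uniq (window N).
Proof. by rewrite map_inj_uniq ?iota_uniq// => i j /addIr[]. Qed.

Lemma mem_window N z : (z \in window N) = (`|z| <= N)%N.
Proof.
apply/mapP/idP => [[i]|zN].
  rewrite mem_iota add0n ltnS => /andP[_ iN ->].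
  by rewrite -lez_nat abszE ler_norml; apply/andP; split; lia.
exists (`|(z + N%:Z)%R|)%N; last by rewrite gez0_abs; lia.
by rewrite mem_iota; lia.
Qed.

Lemma size_window N : size (window N) = (2 * N).+1.
Proof. by rewrite size_map size_iota. Qed.

Section moments.
Context d (T : measurableType d) (R : realType) (P : probability T R).
Variable Y : T -> int.
Hypothesis mY : forall z, measurable [set w | Y w = z].
Variables (beta cplus cminus : R).
Hypothesis beta12 : 1 < beta <= 2.
Hypothesis iY : summable_law P Y (fun z => z%:~R).
Hypothesis mean0 : mean P Y (fun z => z%:~R) = 0.
Hypothesis tailp : (fun x : R => x `^ beta * pr P [set w | x < (Y w)%:~R]) @ +oo --> cplus.
Hypothesis tailm : (fun x : R => x `^ beta * pr P [set w | (Y w)%:~R < - x]) @ +oo --> cminus.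

Lemma regular_tail_bound (f : R -> R) (l : R) : (forall x, f x <= 1) ->
  (fun x : R => x `^ beta * f x) @ +oo --> l ->
  exists2 C, 0 < C & forall x, 1 <= x -> x `^ beta * f x <= C.
Proof.
move=> f1 /cvgrPdist_lt/(_ 1 ltr01) [x0 [_ Hx0]].
exists (`|l| + 1 + (Num.max 1 x0) `^ beta).
  by rewrite ltr_wpDr ?powR_ge0// ltr_wpDl.
move=> x x1; have [h|h] := ltP x0 x.
  have := Hx0 x h; rewrite ltr_norml => /andP[h1 h2].
  have := ler_norm l; have := powR_ge0 (Num.max 1 x0) beta; lra.
apply: (@le_trans _ _ (x `^ beta)); first by rewrite ler_piMr ?powR_ge0.
apply: (@le_trans _ _ (Num.max 1 x0 `^ beta)).
  apply: ge0_ler_powR; rewrite ?nnegrE ?le_max ?ler01 ?h ?orbT//.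
    by case/andP: beta12 => /(lt_trans ltr01)/ltW.
  by rewrite (le_trans ler01).
by rewrite lerDr addr_ge0.
Qed.

Let big_set (x : R) := [set w | x < `|(Y w)%:~R|].

Let big_measurable x : measurable (big_set x).
Proof.
rewrite (_ : big_set x = ((fun z => `|z%:~R|) \o Y) @^-1` `]x, +oo[).
  by rewrite -[X in measurable X]setTI; apply: (int_fun_measurable _ mY).
by apply/seteqP; split => w /=; rewrite /big_set/= in_itv/= andbT.
Qed.

Let half_measurable (B : set R) : measurable B -> measurable [set w | B (Y w)%:~R].
Proof.
move=> mB; rewrite -[X in measurable X]setTI.
exact: (int_fun_measurable (fun z => z%:~R) mY measurableT mB).
Qed.

Lemma tail_bound : exists2 C, 0 < C &
  forall x, 1 <= x -> pr P (big_set x) <= C / x `^ beta.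
Proof.
have pr1 A : measurable A -> pr P A <= 1.
  by move=> mA; rewrite -lee_fin -prE// probability_le1.
have mp x : measurable [set w | x < ((Y w)%:~R : R)].
  rewrite (_ : [set w | _] = [set w | `]x, +oo[%classic (Y w)%:~R]).
    exact: half_measurable.
  by apply/seteqP; split => w /=; rewrite in_itv/= andbT.
have mm x : measurable [set w | ((Y w)%:~R : R) < - x].
  rewrite (_ : [set w | _] = [set w | `]-oo, (- x)[%classic (Y w)%:~R]).
    exact: half_measurable.
  by apply/seteqP; split => w /=; rewrite in_itv/=.
have [C1 C10 H1] := regular_tail_bound (fun x => pr1 _ (mp x)) tailp.
have [C2 C20 H2] := regular_tail_bound (fun x => pr1 _ (mm x)) tailm.
exists (C1 + C2); first by rewrite addr_gt0.
move=> x x1; have x0 : 0 < x by rewrite (lt_le_trans ltr01).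
have xb : 0 < x `^ beta by exact: powR_gt0.
rewrite ler_pdivlMr// mulrC.
apply: le_trans (lerD (H1 x x1) (H2 x x1)); rewrite -mulrDr ler_pM2l//.
apply: le_trans (pr_setU _ (mp x) (mm x)); apply: pr_le => //; first exact: measurableU.
move=> w; rewrite /big_set /= lter_normr => /orP[h|h]; [by left|right => /=; lra].
Qed.

(** Dyadic layers: |Y|^gam is at most 1 plus the sum of 2^(gam (j + 1)) over the j with |Y| > 2^j,
    and by the tail bound the means form a geometric series of ratio 2^(gam - beta). *)
Lemma moment_summable gam : 0 < gam < beta -> summable_law P Y (fun z => `|z%:~R| `^ gam).
Proof.
move=> /andP[g0 gb]; have [C C0 HC] := tail_bound.
pose a j : R := 2 `^ gam * (2 `^ gam) ^+ j.
have a0 j : 0 <= a j by rewrite mulr_ge0 ?exprn_ge0 ?powR_ge0.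
pose q : R := 2 `^ (gam - beta).
have q01 : 0 <= q < 1.
  rewrite powR_ge0 /= /q powR_expln// expR_lt1 nmulr_rlt0 ?subr_lt0//.
  by rewrite ln_gt0// ltr1n.
pose E j := big_set (2 ^+ j).
apply/integrableP; split.
  by apply/measurable_EFinP; exact: (int_fun_measurable _ mY).
apply: (@le_lt_trans _ _ (\int[P]_w (1%:E + \sum_(0 <= j <oo) (a j * \1_(E j) w)%:E))%E).
  have nn w : (0 <= \sum_(0 <= j <oo) (a j * \1_(E j) w)%:E)%E.
    by apply: nneseries_ge0 => j _ _; rewrite lee_fin mulr_ge0.
  have mf1 : measurable_fun setT (fun w => `|(`|(Y w)%:~R| `^ gam : R)%:E|%E).
    rewrite (_ : (fun w => _) = EFin \o ((fun z => `| `|z%:~R| `^ gam : R|) \o Y))//.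
    by apply/measurable_EFinP; exact: (int_fun_measurable _ mY).
  have mf2 : measurable_fun setT (fun w => (1%:E + \sum_(0 <= j <oo) (a j * \1_(E j) w)%:E)%E).
    apply: emeasurable_funD => //; apply: ge0_emeasurable_sum => [j w _ _|j _].
      by rewrite lee_fin mulr_ge0.
    by apply/measurable_EFinP/measurable_funM => //; apply: measurable_indic; exact: big_measurable.
  apply: ge0_le_integral => //=.
  move=> w _; rewrite /= ger0_norm ?powR_ge0//.
  have s0 : (0 <= \sum_(0 <= j <oo) (a j * \1_(E j) w)%:E)%E.
    by apply: nneseries_ge0 => j _ _; rewrite lee_fin mulr_ge0.
  set n := `|Y w|%N; have nE : `|(Y w)%:~R| = n%:R :> R by rewrite -intr_norm -abszE.
  have [n1|n1] := leqP n 1.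
    apply: (@le_trans _ _ (1%:E)); last by rewrite leeDl.
    rewrite lee_fin nE; apply: (@le_trans _ _ (1 `^ gam)); last by rewrite powR1.
    by rewrite ge0_ler_powR ?nnegrE ?(ltW g0)// lern1.
  pose j := trunc_log 2 n.-1.
  have /andP[j1 j2] : (2 ^ j <= n.-1 < 2 ^ j.+1)%N by apply: (@trunc_log_bounds 2) => //; case: (n) n1 => [|[]].
  have jn : (2 ^ j < n)%N by rewrite -(prednK (ltnW n1)) ltnS.
  have nj : (n <= 2 ^ j.+1)%N by rewrite -(prednK (ltnW n1)).
  have Ejw : E j w by rewrite /E /big_set /= nE -natrX ltr_nat.
  apply: (@le_trans _ _ (\sum_(0 <= j <oo) (a j * \1_(E j) w)%:E)%E); last by rewrite leeDr.
  apply: le_trans (nneseries_lim_ge j.+1 _); last by move=> i _ _; rewrite lee_fin mulr_ge0.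
  rewrite big_nat_recr//= indicE mem_set// mulr1.
  apply: (@le_trans _ _ (a j)%:E); last by rewrite leeDr// sume_ge0// => i _; rewrite lee_fin mulr_ge0.
  rewrite lee_fin nE /a -exprS -powR_mulrn ?powR_ge0// -powRrM mulrC powRrM powR_mulrn//.
  rewrite ge0_ler_powR ?nnegrE ?exprn_ge0 ?(ltW g0)// -natrX ler_nat//.
rewrite ge0_integralD//; last 2 first.
- by move=> w _; apply: nneseries_ge0 => j _ _; rewrite lee_fin mulr_ge0.
- apply: ge0_emeasurable_sum => [j w _ _|j _]; first by rewrite lee_fin mulr_ge0.
  by apply/measurable_EFinP/measurable_funM => //; apply: measurable_indic; exact: big_measurable.
rewrite integral_nneseries//; last 2 first.
- by move=> j; apply/measurable_EFinP/measurable_funM => //; apply: measurable_indic; exact: big_measurable.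
- by move=> j w _; rewrite lee_fin mulr_ge0.
apply: lte_add_pinfty; first by rewrite integral_cst// mul1e [X in (X < _)%E](probability_setT P) ltry.
apply: (@le_lt_trans _ _ (C * 2 `^ gam * (1 - q)^-1)%:E); last by rewrite ltry.
apply: nneseries_le => [n|n].
  by apply: integral_ge0 => w _; rewrite lee_fin mulr_ge0.
apply: (@le_trans _ _ (\sum_(0 <= i < n) (C * 2 `^ gam * q ^+ i)%:E)%E).
  apply: lee_sum => j _.
  under eq_integral do rewrite EFinM.
  rewrite ge0_integralZl//; last 2 first.
  - by apply/measurable_EFinP; apply: measurable_indic; exact: big_measurable.
  - by rewrite lee_fin.
  have mE : measurable (E j) by exact: big_measurable.
  rewrite integral_indic// setIT [X in (_ * X)%E](prE P mE) -EFinM lee_fin.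
  have e1 : 1 <= 2 ^+ j :> R by rewrite exprn_ege1// ler1n.
  apply: le_trans (ler_wpM2l (a0 j) (HC _ e1)) _.
  rewrite /a /q powRB; last by rewrite pnatr_eq0 implybT.
  rewrite expr_div_n le_eqVlt; apply/orP; left; apply/eqP.
  have -> : (2 ^+ j) `^ beta = (2 `^ beta) ^+ j :> R.
    by rewrite -!powR_mulrn ?powR_ge0// -!powRrM mulrC.
  by field; rewrite expf_neq0// gt_eqF// powR_gt0.
rewrite sumEFin lee_fin -mulr_sumr ler_wpM2l ?mulr_ge0 ?powR_ge0 ?(ltW C0)//.
exact: geometric_sum_le.
Qed.

Definition bump (N : nat) (j : int) : R := 1 - (j%:~R / N%:R) ^+ 2.

(** Up to a linear term, of mean 0, a jump [z] lowers [bump] by at most 3 |z/N|^gam. The exponent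
    stays below [beta] because the second moment may be infinite. *)
Lemma bump_exit gam N i : 1 <= gam <= 2 -> gam < beta -> (0 < N)%N -> i \in window N ->
  bump N i - 3 * mean P Y (fun z => `|z%:~R| `^ gam) / N%:R `^ gam <=
  \sum_(j <- window N) law P Y (j - i) * bump N j.
Proof.
move=> /andP[g1 g2] gb N0 iN.
have NR : 0 < N%:R :> R by rewrite ltr0n.
have Ng : 0 < N%:R `^ gam :> R by exact: powR_gt0.
have g0 : 0 < gam by rewrite (lt_le_trans ltr01).
have mS : summable_law P Y (fun z => `|z%:~R| `^ gam) by apply: moment_summable; rewrite g0.
have iS a : summable_law P Y (fun z => (z == a)%:R) by exact: summable_indic.
have cS (k : R) : summable_law P Y (fun=> k).
  by apply: (@bounded_summable _ _ _ P Y mY _ `|k|).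
have -> : \sum_(j <- window N) law P Y (j - i) * bump N j =
    mean P Y (fun z => \sum_(j <- window N) bump N j * (z == j - i)%:R).
  rewrite mean_sum => [|j]; last exact: summableZ.
  by apply: eq_bigr => j _; rewrite meanZ// mean_indic// mulrC.
pose I : R := i%:~R / N%:R.
have -> : bump N i - 3 * mean P Y (fun z => `|z%:~R| `^ gam) / N%:R `^ gam =
    mean P Y (fun z => bump N i + (- (2 * I / N%:R) * z%:~R +
       - (3 / N%:R `^ gam) * `|z%:~R| `^ gam)).
  rewrite meanD//; last by apply: summableD; exact: summableZ.
  rewrite mean_cst meanD; [|by apply: summableZ..].
  by rewrite !meanZ// mean0; field; rewrite !gt_eqF.
apply: le_mean => [||z].
- by apply: summableD => //; apply: summableD; exact: summableZ.
- by apply: summable_sum => j; exact: summableZ.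
pose V : R := z%:~R / N%:R.
have -> : - (2 * I / N%:R) * z%:~R + - (3 / N%:R `^ gam) * `|z%:~R| `^ gam =
   - 2 * I * V - 3 * `|V| `^ gam.
  rewrite /V normrM normfV (gtr0_norm NR) powRM ?invr_ge0 ?(ltW NR)//.
  have -> : N%:R^-1 `^ gam = (N%:R `^ gam)^-1 :> R.
    by rewrite -(powR_inv1 (ltW NR)) powRAC powR_inv1// powR_ge0.
  by field; rewrite !gt_eqF.
have I1 : `|I| <= 1.
  move: iN; rewrite mem_window => iN.
  by rewrite /I normrM normfV (gtr0_norm NR) ler_pdivrMr// mul1r -intr_norm -abszE ler_nat.
have v0 := normr_ge0 V; set v := `|V| in v0 *.
have V2 : V ^+ 2 = v ^+ 2 by rewrite real_normK// num_real.
have IV : - 2 * I * V <= 2 * v.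
  rewrite (_ : - 2 * I * V = 2 * - (I * V)); last by ring.
  by rewrite ler_pM2l// (le_trans (ler_norm _))// normrN normrM ler_piMl.
have small : v <= 1 -> v ^+ 2 <= v `^ gam.
  move=> v1; have [->|vn0] := eqVneq v 0; first by rewrite expr0n powR_ge0.
  by rewrite -powR_mulrn// ger_powR// lt_def vn0 v0.
have large : 1 <= v -> v <= v `^ gam by move=> v1; exact: le1r_powR.
have vg := powR_ge0 v gam.
have bE : bump N i = 1 - I ^+ 2 by [].
have [ziN|ziN] := boolP (z + i \in window N).
  (* Inside the window [v <= 2], so a jump with [v > 1] still satisfies v^2 <= 2 v <= 2 v^gam. *)
  rewrite (bigD1_seq (z + i)) ?window_uniq//= addrK eqxx mulr1 big1 ?addr0 => [|j jz]; last first.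
    by case: eqP => [zE|]; [rewrite zE subrK eqxx in jz|rewrite mulr0].
  rewrite bE /bump (_ : (z + i)%:~R / N%:R = V + I); last by rewrite /V /I -mulrDl -intrD.
  have v2 : v <= 2.
    have zN : `|V + I| <= 1.
      rewrite /V /I -mulrDl -intrD normrM normfV (gtr0_norm NR) ler_pdivrMr// mul1r.
      by rewrite -intr_norm -abszE ler_nat -mem_window.
    have := ler_normB (V + I) I; rewrite addrK -/v; lra.
  have : v ^+ 2 <= 3 * v `^ gam.
    have [/small|/ltW/large] := leP v 1; first by lra.
    by rewrite expr2; nra.
  rewrite -V2 (_ : (V + I) ^+ 2 = I ^+ 2 + 2 * (I * V) + V ^+ 2); last by ring.
  rewrite (_ : - 2 * I * V = - (2 * (I * V))); last by ring.
  lra.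
(* Outside, the value 0 lies above the parabola, so short jumps are treated as before; for [v >= 1]
   one has 1 + 2 v <= 3 v^gam. *)
rewrite big1_seq => [|j /andP[_ jN]]; last first.
  by case: eqP => [zE|]; [rewrite zE subrK jN in ziN|rewrite mulr0].
rewrite bE; have [v1|/ltW v1] := leP v 1; last first.
  by have := large v1; have := sqr_ge0 I; lra.
have : 1 <= (V + I) ^+ 2.
  rewrite -(@real_normK _ (V + I)) ?num_real// exprn_ege1//.
  rewrite /V /I -mulrDl -intrD normrM normfV (gtr0_norm NR) ler_pdivlMr// mul1r.
  by rewrite -intr_norm -abszE ler_nat ltnW// ltnNge -mem_window.
have := small v1.
rewrite -V2 (_ : (V + I) ^+ 2 = I ^+ 2 + 2 * (I * V) + V ^+ 2); last by ring.
rewrite (_ : - 2 * I * V = - (2 * (I * V))); last by ring.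
lra.
Qed.

End moments.

(** * The environment *)

Section environment.
Context d (T : measurableType d) (R : realType) (P : probability T R).
Variable tau : int -> T -> R.
Hypothesis ind : mutually_independent P tau.
Hypothesis idd : identically_distributed P tau 0.
Hypothesis tau0 : forall i w, 0 < tau i w.

Let mtau i : measurable_fun setT (tau i). Proof. exact: ind.1. Qed.

Let tau_preim i B : measurable B -> measurable (tau i @^-1` B).
Proof. by move=> mB; rewrite -[X in measurable X]setTI; exact: mtau. Qed.

Lemma pr_bigcup_le (I : choiceType) (r : seq I) (A : I -> set T) :
  (forall i, measurable (A i)) ->
  pr P (\bigcup_(i in [set` r]) A i) <= \sum_(i <- r) pr P (A i).
Proof.
move=> mA; elim: r => [|i r IH].
  by rewrite big_nil (_ : \bigcup_(_ in _) _ = set0) ?/pr ?measure0// -subset0 => w [].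
rewrite big_cons.
have -> : \bigcup_(j in [set` i :: r]) A j = A i `|` \bigcup_(j in [set` r]) A j.
  apply/seteqP; split => w.
    move=> [j /=]; rewrite inE => /orP[/eqP->|jr] Aw; first by left.
    by right; exists j.
  move=> [Aw|[j /= jr Aw]]; first by exists i => //=; rewrite mem_head.
  by exists j => //=; rewrite inE jr orbT.
apply: le_trans (lerD (lexx _) IH); apply: pr_setU => //.
exact: fin_bigcup_measurable.
Qed.

Lemma borel_cantelli (F : nat -> set T) (K : R) : (forall n, measurable (F n)) ->
  (forall n, \sum_(0 <= i < n) pr P (F i) <= K) ->
  {ae P, forall w, exists n0, forall n, (n0 <= n)%N -> ~ F n w}.
Proof.
move=> mF FK; exists (lim_sup_set F); split.
- by apply: bigcapT_measurable => n; apply: bigcup_measurable => *.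
- apply: (@lim_sup_set_cvg0 _ _ R P F mF).
  apply: (@le_lt_trans _ _ K%:E); last by rewrite ltry.
  apply: nneseries_le => // n.
  by rewrite (eq_bigr (fun i => (pr P (F i))%:E)) ?sumEFin ?lee_fin// => i _; exact: prE.
move=> w /= nw n _; apply: contrapT => nF; apply: nw; exists n => m nm Fm.
by apply: nF; exists m.
Qed.

Lemma layer_count (x : R) n : 0 <= x ->
  \sum_(0 <= i < n) (i.+1%:R < x :> R)%:R <= x /\ \sum_(0 <= i < n) (i.+1%:R < x :> R)%:R <= n%:R :> R.
Proof.
move=> x0; elim: n => [|n [IH1 IH2]]; first by rewrite !big_geq.
rewrite !big_nat_recr//=; have [h|h] := ltP n.+1%:R x.
  have : \sum_(0 <= i < n) (i.+1%:R < x :> R)%:R + 1 <= n.+1%:R :> R by rewrite -natr1 lerD2r.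
  by move=> h1; split => //; rewrite (le_trans h1)// ltW.
by rewrite addr0; split => //; rewrite (le_trans IH2)// ler_nat.
Qed.

(** Borel-Cantelli, as the probabilities of tau_0^p > n + 1 sum to at most the p-th moment. The
    finitely many exceptional sites go into the random constant. *)
Lemma trap_growth (p : R) : 0 < p -> ('E_P[(fun w => tau 0 w `^ p)%R] < +oo)%E ->
  {ae P, forall w, exists2 C, 0 < C &
    forall i, tau i w <= C * (1 + `|i|%:R) `^ p^-1}.
Proof.
move=> p0 Ep.
pose F n := [set w | n.+1%:R < tau (Posz n) w `^ p] `|` [set w | n.+1%:R < tau (Negz n) w `^ p].
pose B n : set R := [set x | n.+1%:R < x `^ p].
have mB n : measurable (B n).
  rewrite (_ : B n = (fun x => x `^ p) @^-1` `]n.+1%:R, +oo[).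
    by rewrite -[X in measurable X]setTI; apply: measurable_powR.
  by apply/seteqP; split => x /=; rewrite in_itv/= andbT.
have mF n : measurable (F n) by apply: measurableU; exact: (tau_preim _ (mB n)).
have EX0 : (0 <= 'E_P[(fun w => tau 0 w `^ p)%R])%E.
  by apply: expectation_ge0 => w; exact: powR_ge0.
pose K := fine ('E_P[(fun w => tau 0 w `^ p)%R])%E.
have EK : ('E_P[(fun w => tau 0 w `^ p)%R] = K%:E)%E by rewrite fineK// ge0_fin_numE.
have mt0 n : measurable (tau 0 @^-1` B n) by exact: tau_preim.
have sumK n : \sum_(0 <= i < n) pr P (F i) <= 2 * K.
  apply: (@le_trans _ _ (\sum_(0 <= i < n) 2 * pr P (tau 0 @^-1` B i))).
    apply: ler_sum => i _.
    apply: le_trans (pr_setU _ (tau_preim _ (mB i)) (tau_preim _ (mB i))) _.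
    have same j : pr P (tau j @^-1` B i) = pr P (tau 0 @^-1` B i).
      by rewrite /pr; congr fine; exact: idd.
    by rewrite -!/(_ @^-1` _) !same mulr2n mulrDl mul1r.
  rewrite -mulr_sumr ler_pM2l// -lee_fin -EK -sumEFin.
  rewrite (eq_bigr (fun i => \int[P]_w (\1_(tau 0 @^-1` B i) w)%:E)%E); last first.
    by move=> i _; rewrite integral_indic// setIT; apply/esym/prE.
  rewrite -ge0_integral_sum//; last first.
    by move=> i; apply/measurable_EFinP; apply: measurable_indic.
  have -> : ('E_P[(fun w => tau 0 w `^ p)%R] = \int[P]_w (tau 0 w `^ p)%:E)%E by rewrite unlock.
  apply: ge0_le_integral => //.
  - by move=> w _; apply: sume_ge0 => i _; rewrite lee_fin.
  - by apply: emeasurable_sum => i; apply/measurable_EFinP; exact: measurable_indic.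
  - by apply/measurable_EFinP; exact: (measurableT_comp (measurable_powR p) (mtau 0)).
  move=> w _; rewrite sumEFin lee_fin.
  apply: le_trans (layer_count n (powR_ge0 (tau 0 w) p)).1.
  apply: ler_sum => i _; rewrite indicE ler_nat.
  by case: (boolP (w \in _)) => [/set_mem|]//; rewrite /B /= => ->.
have := borel_cantelli mF sumK.
apply: filterS => w [n0 Hn0].
pose C := 1 + \sum_(0 <= n < n0) (tau (Posz n) w + tau (Negz n) w).
have tn0 i : 0 <= tau i w by exact: ltW.
have C1 : 1 <= C by rewrite lerDl sumr_ge0// => n _; rewrite addr_ge0.
exists C; first by rewrite (lt_le_trans _ C1).
have big1 i : 1 <= (1 + `|i|%:R) `^ p^-1 :> R.
  by rewrite -[X in X <= _](powRr0 (1 + `|i|%:R)) ler_powR ?lerDl// invr_ge0 ltW.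
have small n i : (n < n0)%N -> tau i w <= tau (Posz n) w + tau (Negz n) w ->
    tau i w <= C * (1 + `|i|%:R) `^ p^-1.
  move=> nn h; apply: (@le_trans _ _ C); last by rewrite ler_peMr// (le_trans _ C1).
  apply: le_trans h _; rewrite /C (bigD1_seq n) ?iota_uniq ?mem_index_iota//=.
  rewrite addrCA lerDl addr_ge0// sumr_ge0// => m _; exact: addr_ge0.
have large n i : (n <= `|i|)%N -> ~ (n.+1%:R < tau i w `^ p) ->
    tau i w <= C * (1 + `|i|%:R) `^ p^-1.
  move=> ni /negP; rewrite -leNgt => h.
  apply: (@le_trans _ _ ((1 + `|i|%:R) `^ p^-1)); last by rewrite ler_peMl ?powR_ge0.
  rewrite [leLHS](_ : _ = (tau i w `^ p) `^ p^-1); last by rewrite -powRrM divff ?gt_eqF// powRr1.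
  apply: ge0_ler_powR; rewrite ?nnegrE ?invr_ge0 ?(ltW p0) ?powR_ge0 ?addr_ge0//.
  by apply: le_trans h _; rewrite -natr1 addrC lerD2l ler_nat.
move=> [] n; have [nn|nn] := ltnP n n0.
- by apply: (small n) => //; rewrite lerDl.
- by apply: (large n) => // h; apply: (Hn0 n nn); left.
- by apply: (small n) => //; rewrite lerDr.
- by apply: (large n) => // h; apply: (Hn0 n nn); right.
Qed.

Definition site (j : int) (r a : nat) : int := j * r%:Z + a%:Z.

Lemma site_inj j r : injective (site j r).
Proof. by move=> a b /addrI[]. Qed.

(** * Blocks with many traps above a fixed depth *)

Section blocks.
Variable ts : R.
Hypothesis ts_small : pr P [set w | tau 0 w < ts] <= 64^-1.

Let bad i := [set w | tau i w < ts].

Let bad_preim i : bad i = tau i @^-1` `]-oo, ts[.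
Proof. by apply/seteqP; split => w /=; rewrite in_itv. Qed.

Let bad_measurable i : measurable (bad i).
Proof. by rewrite bad_preim; exact: tau_preim. Qed.

Let bad_pr i : P (bad i) = (pr P (bad 0))%:E.
Proof. by rewrite -prE// !bad_preim; apply: idd. Qed.

Lemma all_bad_pr (K : {fset int}) :
  pr P (\bigcap_(i in [set` K]) bad i) <= 64^-1 ^+ #|` K|.
Proof.
have -> : \bigcap_(i in [set` K]) bad i = \bigcap_(i in [set` K]) (tau i @^-1` `]-oo, ts[).
  by apply: eq_bigcapr => i _; rewrite bad_preim.
rewrite /pr (ind.2 K (fun=> `]-oo, ts[%classic))//.
rewrite (eq_bigr (fun=> (pr P (bad 0))%:E)); last by move=> i _; rewrite -bad_preim bad_pr.
rewrite prodEFin /= big_const_seq count_predT iter_mulr_1.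
by rewrite lerXn2r ?nnegrE ?pr_ge0// invr_ge0.
Qed.

(* The union is over the possible sets [J] of bad sites: the product rule then
   gives an exponential bound without any concentration inequality. *)
Definition bad_block (r : nat) (j : int) : set T :=
  \bigcup_(J in [set` [seq J : {set 'I_r} <- enum (@predT {set 'I_r}) | (r <= 2 * #|J|)%N]])
    \bigcap_(i in [set` [fset site j r (val a) | a in J]%fset]) bad i.

Let some_block_measurable (r : nat) j (J : {set 'I_r}) :
  measurable (\bigcap_(i in [set` [fset site j r (val a) | a in J]%fset]) bad i).
Proof. exact: fin_bigcap_measurable. Qed.

Lemma bad_block_measurable r j : measurable (bad_block r j).
Proof. by apply: fin_bigcup_measurable => // J _; exact: some_block_measurable. Qed.

(** There are at most 2^r sets [J], each of probability at most 64^(-r/2) = 8^(-r). This is the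
    origin of the level 1/64. *)
Lemma bad_block_pr r j : pr P (bad_block r j) <= 4^-1 ^+ r.
Proof.
apply: le_trans (pr_bigcup_le _ (some_block_measurable j)) _.
apply: (@le_trans _ _ (\sum_(J <- [seq J : {set 'I_r} <- enum (@predT {set 'I_r}) | (r <= 2 * #|J|)%N]) 8^-1 ^+ r)).
  rewrite big_seq [leRHS]big_seq; apply: ler_sum => J.
  rewrite mem_filter => /andP[rJ _]; apply: le_trans (all_bad_pr _) _.
  rewrite card_imfset/=; last by move=> a b /site_inj/val_inj.
  rewrite (_ : 64^-1 = 8^-1 ^+ 2 :> R); last by field.
  rewrite -exprM -cardE ler_wiXn2l// ?invr_ge0// invf_le1//; lra.
rewrite big_const_seq count_predT iter_addr_0.
apply: (@le_trans _ _ (8^-1 ^+ r *+ 2 ^ r)).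
  rewrite -[leLHS]mulr_natl -[leRHS]mulr_natl ler_wpM2r ?exprn_ge0 ?invr_ge0// ler_nat.
  rewrite size_filter (leq_trans (count_size _ _))//.
  by rewrite -cardT -cardsT -powersetT card_powerset cardsT card_ord.
rewrite -mulr_natr natrX -exprMn le_eqVlt; apply/orP; left; apply/eqP.
by congr (_ ^+ _); field.
Qed.

(** Borel-Cantelli along r = 2^l: the 2 r + 1 blocks considered fail with total probability at most
    (2 r + 1) 4^(-r), summable in l. *)
Lemma good_blocks : {ae P, forall w, exists l0, forall l, (l0 <= l)%N ->
  forall j, (`|j| <= 2 ^ l)%N ->
  (2 ^ l < 2 * #|finset (fun a : 'I_(2 ^ l) => ts <= tau (site j (2 ^ l) (val a)) w : bool)%R|)%N}.
Proof.
pose F l := \bigcup_(j in [set` window (2 ^ l)]) bad_block (2 ^ l) j.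
have mF l : measurable (F l) by apply: fin_bigcup_measurable => // j _; exact: bad_block_measurable.
have Fpr l : pr P (F l) <= 3 * 2^-1 ^+ l.
  apply: le_trans (pr_bigcup_le _ (bad_block_measurable _)) _.
  apply: (@le_trans _ _ (\sum_(j <- window (2 ^ l)) 4^-1 ^+ (2 ^ l))).
    by apply: ler_sum => j _; exact: bad_block_pr.
  rewrite big_const_seq count_predT iter_addr_0 size_window.
  set r := (2 ^ l)%N.
  have r2 : (r < 2 ^ r)%N by rewrite ltn_expl.
  have lr : (l <= r)%N by rewrite ltnW// ltn_expl.
  rewrite (_ : 4^-1 = 2^-1 * 2^-1 :> R); last by field.
  rewrite exprMn (_ : (2^-1 ^+ r * 2^-1 ^+ r) *+ _ = 2^-1 ^+ r * (2 * r).+1%:R * 2^-1 ^+ r); last first.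
    by rewrite -[LHS]mulr_natr; ring.
  have h1 : 2^-1 ^+ r <= 2^-1 ^+ l :> R by rewrite ler_wiXn2l// ?invr_ge0// invf_le1//; lra.
  have h2 : 2^-1 ^+ r * (2 * r).+1%:R <= 3 :> R.
    rewrite exprVn mulrC ler_pdivrMr ?exprn_gt0// -natrX -natrM ler_nat; lia.
  by apply: ler_pM.
have sumF n : \sum_(0 <= l < n) pr P (F l) <= 6.
  apply: (@le_trans _ _ (\sum_(0 <= l < n) 3 * 2^-1 ^+ l)); first by apply: ler_sum => l _.
  rewrite -mulr_sumr; have q01 : 0 <= (2^-1 : R) < 1 by apply/andP; split; lra.
  have := geometric_sum_le n q01; rewrite (_ : (1 - 2^-1)^-1 = 2 :> R); last by field.
  lra.
have := borel_cantelli mF sumF; apply: filterS => w [l0 H]; exists l0 => l ll j jl.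
rewrite ltnNge; apply/negP => few; apply: (H l ll).
exists j; first by rewrite /= mem_window.
pose G := finset (fun a : 'I_(2 ^ l) => ts <= tau (site j (2 ^ l) (val a)) w).
exists (~: G).
  rewrite /= mem_filter mem_enum andbT.
  have := cardsC G; rewrite card_ord; move: few; rewrite (_ : #|_| = #|G|)//.
  by move: (#|G|) (#|~: G|) => x y; lia.
move=> i /= /imfsetP[a /=]; rewrite !inE -ltNge => h ->; exact: h.
Qed.

End blocks.

(** Positivity suffices: otherwise the events tau_0 < 1/(n + 1), which decrease to the empty set,
    would all have probability above 1/64. *)
Lemma trap_lower_quantile : exists2 ts, 0 < ts & pr P [set w | tau 0 w < ts] <= 64^-1.
Proof.
apply: contrapT => H.
have mb (x : R) : measurable [set w | tau 0 w < x].
  rewrite (_ : [set w | _] = tau 0 @^-1` `]-oo, x[); first exact: tau_preim.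
  by apply/seteqP; split => w /=; rewrite in_itv.
have big n : 64^-1 < pr P [set w | tau 0 w < n.+1%:R^-1].
  rewrite ltNge; apply/negP => h; apply: H; exists n.+1%:R^-1; [by rewrite invr_gt0|exact: h].
have : pr P setT <= 1 - 64^-1.
  apply: (pr_liminf_le (W := fun n => ~` [set w | tau 0 w < n.+1%:R^-1]) (k1 := 0)) => //.
  - by move=> n; apply: measurableC.
  - by move=> n _; rewrite pr_setC// lerD2l lerN2 ltW.
  move=> w _; exists (Num.truncn (tau 0 w)^-1) => n hn /= h.
  have : n.+1%:R <= (tau 0 w)^-1.
    by rewrite -[n.+1%:R]invrK lef_pV2 ?posrE// ?invr_gt0// ltW.
  rewrite -truncn_gt_nat; lia.
rewrite /pr probability_setT /=; lra.
Qed.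

End environment.

(** * Conclusion *)

Lemma bump01 (R : realType) N i : (0 < N)%N -> i \in window N -> 0 <= bump R N i <= 1.
Proof.
move=> N0; rewrite mem_window => iN; have NR : 0 < N%:R :> R by rewrite ltr0n.
rewrite /bump gerBl sqr_ge0 andbT subr_ge0 -(@real_normK _ (_ / _)) ?num_real//.
rewrite expr_le1// normrM normfV (gtr0_norm NR) ler_pdivrMr// mul1r.
by rewrite -intr_norm -abszE ler_nat.
Qed.

Section fixed_scale.
Context d (T : measurableType d) (R : realType) (P : probability T R).
Variables (eps : nat -> T -> int) (e : nat -> T -> R).
Hypothesis ind : mutually_independent P (noise eps e).
Hypothesis idd : identically_distributed P (fun j w => (eps j w)%:~R : R) 0%N.
Hypothesis e0 : forall k, P [set w | 0 < e k w] = 1%E.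
Hypothesis eS : forall k (x : R), 0 <= x -> P [set w | x < e k w] = (expR (- x))%:E.
Variable tau : int -> R.
Hypothesis tau0 : forall i, 0 < tau i.
Variables (r N : nat) (t K ts kap a : R).
Hypotheses (r0 : (0 < r)%N) (N0 : (0 < N)%N) (t1 : 1 <= t) (K0 : 0 < K) (ts0 : 0 < ts).
Let p := jump_law P eps.
Hypothesis vb : var_bound p (window N) r%:R K.
Hypothesis blocks : forall x, x \in window N -> exists j,
  (forall b, (b < r)%N -> (`|x - site j r b| <= r)%N) /\
  (r < 2 * #|finset (fun b : 'I_r => (ts <= tau (site j r (val b)))%R)|)%N.
Hypothesis kap0 : 0 <= kap.
Hypothesis hkap : forall i, i \in window N ->
  bump R N i - kap <= \sum_(j <- window N) p (j - i) * bump R N j.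
Hypothesis a0 : 0 <= a.
Hypothesis ha : forall i, i \in window N ->
  tau i * Num.max (4 * expR 1 / (ts * r%:R)) (16 * K / t) <= a ^+ 2.

(** The bound of [green_le] in real time: [M.+1] is at most 2 (k + 1) t and [nu] is proportional to
    k + 1, so the mesh cancels. *)
Let S := 4 * K + 8 * expR 1 * t / (ts * r%:R).

Let rR : 0 < r%:R :> R. Proof. by rewrite ltr0n. Qed.

Lemma has_blocks_hold k : 1 <= k.+1%:R * ts ->
  has_blocks (hold (tick_prob (rate tau k))) (window N) r%:R
    (expR (-1) * (k.+1%:R * ts) * (r%:R / 2)).
Proof.
move=> kts x /blocks[j [jr jG]].
exists [seq site j r b | b <- iota 0 r]; split.
- by rewrite map_inj_uniq ?iota_uniq//; exact: site_inj.
- move=> y /mapP[b]; rewrite mem_iota /= add0n => br ->.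
  by rewrite -abszE -[X in _ <= X]/(r%:Z%:~R) ler_int lez_nat jr.
set G := finset _ in jG.
have hold0 i : 0 <= hold (tick_prob (rate tau k)) i.
  by apply/ltW/hold_gt0; exact: tick_prob01.
rewrite big_map -[X in iota 0 X]subn0 -/(index_iota 0 r) big_mkord.
apply: (@le_trans _ _ (\sum_(b < r | b \in G) expR (-1) * (k.+1%:R * ts))).
  rewrite sumr_const -[leRHS]mulr_natr ler_wpM2l ?mulr_ge0 ?expR_ge0 ?(ltW ts0)//.
  by rewrite ler_pdivrMr// -natrM ler_nat mulnC ltnW.
rewrite [leRHS](bigID (mem G)) /=.
apply: ler_wpDr; first by apply: sumr_ge0 => b _; exact: hold0.
apply: ler_sum => b; rewrite inE => bG.
have kb : k.+1%:R * ts <= rate tau k (site j r b) by rewrite /rate ler_pM2l// ltr0n.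
apply: le_trans (hold_ge tau0 (le_trans kts kb)).
by rewrite ler_pM2l ?expR_gt0.
Qed.

(** The three terms account for the occupation of [i], for exit from the window and for paths with
    too many jumps. None depends on the mesh [k]. *)
Lemma trap_prob_scale_le del i : 0 < del ->
  quenched_prob P tau eps e t i <= a + kap * ((2 * N).+1%:R * S) + del.
Proof.
move=> del0.
have t0 : 0 < t by rewrite (lt_le_trans ltr01).
have S0 : 0 <= S.
  by rewrite addr_ge0// ?divr_ge0 ?mulr_ge0 ?expR_ge0 ?(ltW K0) ?(ltW t0) ?(ltW ts0) ?(ltW rR).
pose q := (2 * N).+1%:R * S; have q0 : 0 <= q by rewrite mulr_ge0.
pose L := (Num.truncn (q / del)).+1.
have Lq : L%:R^-1 * q <= del.
  rewrite mulrC ler_pdivrMr ?ltr0n// mulrC -ler_pdivrMr// ltW// truncnS_gt//.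
(* The three summands ensure [1 <= k.+1%:R * ts], a rate at least 1 at the origin, and the initial
   L^2 bound [h0]. *)
pose k1 := (Num.truncn (ts^-1) + Num.truncn ((tau 0)^-1) +
  Num.truncn (expR 1 / (16 * K * tau 0)))%N.
have s0 : 0 \in window N by rewrite mem_window.
apply: (trap_prob_le ind idd e0 eS tau0 (window_uniq N) s0 (ltW t0) (L := fun=> L) (k1 := k1)).
move=> k kk1; set M := Num.truncn _.
have kR : 0 < k.+1%:R :> R by rewrite ltr0n.
have over (x : R) n : (Num.truncn x <= n)%N -> (n <= k1)%N -> x <= k.+1%:R.
  move=> xn nk; apply: le_trans (ltW (truncnS_gt x)) _.
  by rewrite ler_nat ltnS (leq_trans xn)// (leq_trans nk).
have kts : 1 <= k.+1%:R * ts.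
  by rewrite -ler_pdivrMr// mul1r; apply: (over _ _ (leqnn _)); rewrite /k1 -addnA leq_addr.
have kt0 : 1 <= rate tau k 0.
  rewrite /rate -ler_pdivrMr// mul1r; apply: (over _ _ (leqnn _)).
  by rewrite /k1 addnAC leq_addl.
have kK : expR 1 / (16 * K * tau 0) <= k.+1%:R.
  by apply: (over _ _ (leqnn _)); rewrite /k1 leq_addl.
set th := tick_prob (rate tau k).
have th01 := tick_prob01 tau0 k.
have mY z := eps_measurable ind 0 z.
have p0 z : 0 <= p z by exact: pr_ge0.
have p1 j : \sum_(i <- window N) p (i - j) <= 1 := law_sum_le1 P mY j (window_uniq N).
pose nu := expR (-1) * (k.+1%:R * ts) * (r%:R / 2).
have nu0 : 0 < nu by rewrite !mulr_gt0 ?expR_gt0 ?divr_gt0.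
have hb := has_blocks_hold kts.
have hold_pos := hold_gt0 th01.
have e1 : expR (-1) * expR 1 = 1 :> R by rewrite -expRD addNr expR0.
have e1' : expR (-1) = (expR 1)^-1 :> R by rewrite expRN.
have ep : 0 < expR 1 :> R by exact: expR_gt0.
have h0 : (hold th 0)^-1 <= 16 * K.
  have := hold_ge tau0 kt0; rewrite -/th => hh.
  have hp := hold_pos 0; have K16 : 0 < 16 * K by rewrite mulr_gt0.
  rewrite -[leRHS]invrK lef_pV2 ?posrE ?invr_gt0//; apply: le_trans hh.
  rewrite e1' /rate -ler_pdivrMl ?invr_gt0// invrK.
  rewrite -ler_pdivrMr// (_ : _ / tau 0 = expR 1 / (16 * K * tau 0))//.
  by field; rewrite !gt_eqF.
have Mt : k.+1%:R * t <= M.+1%:R by exact/ltW/truncnS_gt.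
have Mt2 : M.+1%:R <= 2 * (k.+1%:R * t).
  have : M%:R <= k.+1%:R * t by rewrite truncn_le mulr_ge0// ltW.
  have : 1 <= k.+1%:R * t by rewrite mulr_ege1// ler1n.
  by rewrite -natr1; lra.
have green j : j \in window N -> \sum_(l < M.+1) tflux p (window N) th L l j <= S.
  move=> jN; apply: le_trans (green_le (window_uniq N) s0 p0 p1 th01 L nu0 vb hb M jN) _.
  rewrite /S lerD2l.
  have : M.+1%:R / nu <= 2 * (k.+1%:R * t) / nu by rewrite ler_pM2r// invr_gt0.
  rewrite (_ : 2 * (k.+1%:R * t) / nu = 4 * expR 1 * t / (ts * r%:R)); last first.
    by rewrite /nu e1'; field; rewrite !gt_eqF.
  rewrite (_ : 8 * _ * _ / _ = 2 * (4 * expR 1 * t / (ts * r%:R))); last by ring.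
  by rewrite ler_pM2l.
have bump0 : bump R N 0 = 1 by rewrite /bump mul0r expr0n subr0.
have mass := mass_ge (window_uniq N) s0 p0 p1 th01 (ltn0Sn _ : (0 < L)%N) kap0
  (fun i => @bump01 R N i N0) bump0 hkap green.
apply: le_trans (occupied_or_lost_pr ind idd eS (window_uniq N) s0 (rate_gt0 tau0 k) L M i) _.
rewrite -addrA; apply: lerD; last first.
  move: mass; rewrite size_window -/q mulrDl -/p -/th; lra.
case: ifPn => // iN.
have := tocc_sqr_le (window_uniq N) s0 p0 p1 th01 L (ltW rR) nu0 K0 vb hb M iN h0.
rewrite -/p -/th => occ2.
have : tocc p (window N) th L M i ^+ 2 <= a ^+ 2.
  apply: le_trans occ2 _; apply: le_trans (ha iN).
  apply: (@le_trans _ _ (rate tau k i * Num.max (2 / nu) (16 * K / M.+1%:R))).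
    rewrite ler_wpM2r ?hold_le// le_max divr_ge0// ltW//.
  rewrite /rate -mulrA (mulrCA k.+1%:R) ler_pM2l// maxr_pMr ?(ltW kR)// ge_max.
  apply/andP; split; rewrite le_max; apply/orP; [left|right].
    rewrite le_eqVlt; apply/orP; left; apply/eqP.
    by rewrite /nu e1'; field; rewrite !gt_eqF.
  rewrite mulrA ler_pdivrMr ?ltr0n// mulrAC ler_pdivlMr//.
  rewrite (_ : k.+1%:R * _ * t = 16 * K * (k.+1%:R * t)); last by ring.
  by rewrite ler_pM2l// mulr_gt0.
rewrite ler_sqr ?nnegrE// /tocc sumr_ge0// => n _; apply: occ_ge0 => //.
by move=> *; apply: arrival_ge0.
Qed.

End fixed_scale.

(** * Dyadic scales and covering of the window by blocks *)

Lemma pow2_decay (R : realType) (D b ep : R) : 0 < b -> 0 < ep ->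
  exists l1, forall l, (l1 <= l)%N -> D * (2 ^ l)%:R `^ (- b) <= ep.
Proof.
move=> b0 ep0; pose q : R := 2 `^ (- b).
have q01 : `|q| < 1.
  rewrite ger0_norm ?powR_ge0// /q powR_expln// expR_lt1 nmulr_rlt0 ?oppr_lt0//.
  by rewrite ln_gt0// ltr1n.
have D1 : 0 < `|D| + 1 by rewrite ltr_wpDl.
have /cvgrPdist_le/(_ (ep / (`|D| + 1)) (divr_gt0 ep0 D1)) [l1 _ H] := cvg_expr q01.
exists l1 => l /H /=; rewrite sub0r normrN ger0_norm ?exprn_ge0 ?powR_ge0// => h.
have -> : (2 ^ l)%:R `^ (- b) = q ^+ l :> R.
  by rewrite /q natrX -!powR_mulrn ?powR_ge0// -!powRrM mulrC.
apply: (@le_trans _ _ ((`|D| + 1) * q ^+ l)).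
  rewrite ler_wpM2r ?exprn_ge0 ?powR_ge0// (le_trans (ler_norm _))// lerDl//.
by rewrite mulrC -ler_pdivlMr.
Qed.

Lemma dyadic_scale (R : realType) (b t : R) l1 : 0 < b -> (2 ^ l1)%:R `^ b <= t ->
  exists2 l, (l1 <= l)%N & (2 ^ l)%:R `^ b <= t < (2 ^ l.+1)%:R `^ b.
Proof.
move=> b0 lt; pose u := t `^ b^-1.
have t0 : 0 < t by apply: lt_le_trans lt; rewrite powR_gt0// ltr0n expn_gt0.
have uE : u `^ b = t by rewrite /u -powRrM mulVf ?gt_eqF// powRr1// ltW.
have u0 : 0 <= u by exact: powR_ge0.
have bpow (x y : R) : 0 <= x -> 0 <= y -> x <= y -> x `^ b <= y `^ b.
  by move=> x0 y0 xy; rewrite ge0_ler_powR ?nnegrE// ltW.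
have l1u : (2 ^ l1)%:R <= u.
  rewrite leNgt; apply/negP => h.
  have : u `^ b < (2 ^ l1)%:R `^ b by rewrite gt0_ltr_powR ?nnegrE.
  by rewrite uE ltNge lt.
pose n := Num.truncn u.
have n0 : (2 ^ l1 <= n)%N by rewrite truncn_ge_nat.
have n1 : (0 < n)%N by rewrite (leq_trans _ n0)// expn_gt0.
have /andP[h1 h2] : (2 ^ trunc_log 2 n <= n < 2 ^ (trunc_log 2 n).+1)%N.
  exact: (@trunc_log_bounds 2).
exists (trunc_log 2 n); first by rewrite -(@trunc_expnK 2 l1)// leq_trunc_log.
apply/andP; split.
  by rewrite -uE; apply: bpow => //; rewrite -truncn_ge_nat.
rewrite -uE; apply: gt0_ltr_powR; rewrite ?nnegrE//.
by apply: lt_le_trans (truncnS_gt u) _; rewrite ler_nat.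
Qed.

Lemma powR_add (R : realType) (x u v : R) : 0 < x -> x `^ (u + v) = x `^ u * x `^ v.
Proof. by move=> x0; rewrite powRD// (gt_eqF x0) implybT. Qed.

(** The block through [x] has index [x %/ r]; the condition [2 * N <= r * r] keeps this index in the
    range that [good_blocks] controls. *)
Lemma window_block (r N : nat) (x : int) : (1 < r)%N -> (2 * N <= r * r)%N ->
  x \in window N -> exists j, (`|j| <= r)%N /\
  forall b, (b < r)%N -> (`|x - site j r b| <= r)%N.
Proof.
move=> r1 Nr; rewrite mem_window => xN; exists (x %/ r%:Z)%Z.
have rZ : r%:Z != 0 by rewrite eqz_nat; lia.
have xE := divz_eq x r%:Z.
have m0 : 0 <= (x %% r%:Z)%Z by rewrite modz_ge0.
have m1 : (x %% r%:Z)%Z < r%:Z by rewrite ltz_pmod// ltz_nat; lia.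
set q := (x %/ r%:Z)%Z in xE *; set y := (x %% r%:Z)%Z in xE m0 m1 *.
split => [|b br]; last by rewrite /site {1}xE; lia.
have xb : - (r%:Z * r%:Z) <= 2 * x <= r%:Z * r%:Z by lia.
rewrite -lez_nat abszE ler_norml; apply/andP; split; nia.
Qed.

Section vanishing.
Context d (T : measurableType d) (R : realType) (P : probability T R).
Variables (eps : nat -> T -> int) (e : nat -> T -> R).
Hypothesis ind : mutually_independent P (noise eps e).
Hypothesis idd : identically_distributed P (fun j w => (eps j w)%:~R : R) 0%N.
Hypothesis e0 : forall k, P [set w | 0 < e k w] = 1%E.
Hypothesis eS : forall k (x : R), 0 <= x -> P [set w | x < e k w] = (expR (- x))%:E.
Let law_eps := jump_law P eps.
Variables (beta C gam m : R).
Hypothesis beta12 : 1 < beta <= 2.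
Hypothesis C0 : 0 < C.
Hypothesis vb : forall (s : seq int) (r : nat), uniq s -> (0 < r)%N ->
  var_bound law_eps s r%:R (C * r%:R `^ (beta - 1)).
Hypothesis m0 : 0 <= m.
Hypothesis exits : forall (N : nat) i, (0 < N)%N -> i \in window N ->
  bump R N i - 3 * m / N%:R `^ gam <= \sum_(j <- window N) law_eps (j - i) * bump R N j.
Variables (tau : int -> R) (p C1 ts eta : R) (l0 : nat).
Hypothesis tau0 : forall i, 0 < tau i.
Hypothesis p0 : 0 < p.
Hypothesis C10 : 0 < C1.
Hypothesis growth : forall i, tau i <= C1 * (1 + `|i|%:R) `^ p^-1.
Hypothesis ts0 : 0 < ts.
Hypothesis good : forall l, (l0 <= l)%N -> forall j, (`|j| <= 2 ^ l)%N ->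
  (2 ^ l < 2 * #|finset (fun a : 'I_(2 ^ l) => (ts <= tau (site j (2 ^ l) (val a)))%R)|)%N.
Hypothesis eta01 : 0 < eta < 1.
Hypothesis p1 : 1 < p.
Hypothesis eta_p : (1 + eta) / p < 1.
Hypothesis gam12 : 1 <= gam <= 2.
Hypothesis eta_gam : beta - 1 < (1 + eta) * (gam - 1).

Let D1 := Num.max (4 * expR 1 / ts) (16 * C).
Let D2 := 4 * C + 32 * expR 1 / ts.

Lemma trap_prob_vanish ep : 0 < ep -> exists t0, forall t, t0 <= t ->
  forall i, quenched_prob P tau eps e t i <= ep.
Proof.
move=> ep0; pose del := ep / 3; have del0 : 0 < del by rewrite divr_gt0.
have /andP[eta0 eta1] := eta01; have /andP[gam1 gam2] := gam12; have /andP[beta1 beta2] := beta12.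
have ep1 : 0 < expR 1 :> R by exact: expR_gt0.
have D20 : 0 < D2 by rewrite /D2 addr_gt0 ?divr_gt0 ?mulr_gt0.
(* Three exponents to be positive: [ba] for covering the window by controlled blocks, [bb] for the
   deepest trap in it, [bc] for the exit probability. *)
have ba : 0 < 1 - eta by rewrite subr_gt0.
have bb : 0 < 1 - (1 + eta) / p by rewrite subr_gt0.
have bc : 0 < (1 + eta) * (gam - 1) - (beta - 1) by rewrite subr_gt0.
have [la Ha] := pow2_decay 2 ba ltr01.
have [lb Hb] := pow2_decay (2 * C1 * D1) bb (exprn_gt0 2 del0).
have [lc Hc] := pow2_decay (18 * m * D2) bc del0.
pose l1 := (maxn (maxn l0 la) (maxn lb lc)).+1.
have b0 : 0 < beta by rewrite (lt_trans ltr01).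
exists ((2 ^ l1)%:R `^ beta) => t /(dyadic_scale b0)[l l1l /andP[tl tu]] i.
have la1 : (la <= l1)%N by rewrite /l1 ltnW// ltnS !leq_max leqnn ?orbT.
have lb1 : (lb <= l1)%N by rewrite /l1 ltnW// ltnS !leq_max leqnn ?orbT.
have lc1 : (lc <= l1)%N by rewrite /l1 ltnW// ltnS !leq_max leqnn ?orbT.
have ll0 : (l0 <= l)%N by rewrite (leq_trans _ l1l)// /l1 ltnW// ltnS !leq_max leqnn ?orbT.
have {}Ha  := Ha l (leq_trans la1 l1l).
have {}Hb  := Hb l (leq_trans lb1 l1l).
have {}Hc  := Hc l (leq_trans lc1 l1l).
have lpos : (0 < l)%N by rewrite (leq_trans _ l1l).
have r2 : (1 < 2 ^ l)%N by rewrite -[1%N](expn0 2) ltn_exp2l.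
have tu' : t < (2 * (2 ^ l)%:R) `^ beta by rewrite -natrM -expnS.
have := good ll0; move: r2 tl tu' Ha Hb Hc; set r := (2 ^ l)%N => r2 tl tu' Ha Hb Hc gd.
have r0 : (0 < r)%N by exact: ltnW.
have rR : 0 < r%:R :> R by rewrite ltr0n.
have r1 : 1 <= r%:R :> R by rewrite ler1n.
pose y : R := r%:R `^ (1 + eta).
have y0 : 0 < y by exact: powR_gt0.
have y1 : 1 <= y by rewrite /y -[leLHS](powRr0 r%:R) ler_powR// addr_ge0// ltW.
pose N := Num.truncn y.
have Ny : N%:R <= y by rewrite truncn_le ltW.
have yN : y < N.+1%:R by exact: truncnS_gt.
have N0 : (0 < N)%N by rewrite truncn_gt0.
have N2 : y <= 2 * N%:R.
  have : 1 <= N%:R :> R by rewrite ler1n.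
  by move: yN; rewrite -natr1; lra.
have Nr : (2 * N <= r * r)%N.
  rewrite -(ler_nat R) !natrM; apply: (@le_trans _ _ (2 * y)); first by rewrite ler_pM2l.
  have yE : y = r%:R * r%:R * r%:R `^ (- (1 - eta)).
    rewrite /y (_ : 1 + eta = 1 + 1 + - (1 - eta)); last by ring.
    by rewrite !powR_add// powRr1// ltW.
  rewrite yE mulrCA ler_piMr// mulr_ge0// ltW//.
pose K := C * r%:R `^ (beta - 1).
have K0 : 0 < K by rewrite mulr_gt0// powR_gt0.
have rb : r%:R `^ beta = r%:R * r%:R `^ (beta - 1).
  rewrite [LHS](_ : _ = r%:R `^ (1 + (beta - 1))); last by congr (_ `^ _); ring.
  by rewrite (powR_add 1 (beta - 1) rR) powRr1// ltW.
have t1 : 1 <= t.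
  by apply: le_trans tl; rewrite -[leLHS](powRr0 r%:R) ler_powR// ltW.
have t0 : 0 < t by exact: lt_le_trans t1.
pose kap := 3 * m / N%:R `^ gam.
have NR : 0 < N%:R :> R by rewrite ltr0n.
have kap0 : 0 <= kap by rewrite divr_ge0 ?powR_ge0// mulr_ge0.
have blocks x : x \in window N -> exists j,
    (forall b, (b < r)%N -> (`|x - site j r b| <= r)%N) /\
    (r < 2 * #|finset (fun b : 'I_r => (ts <= tau (site j r (val b)))%R)|)%N.
  by move=> /(window_block r2 Nr)[j [jr jb]]; exists j; split => //; exact: gd.
have ha j : j \in window N ->
    tau j * Num.max (4 * expR 1 / (ts * r%:R)) (16 * K / t) <= del ^+ 2.
  rewrite mem_window => jN; apply: le_trans Hb.
  have tj : tau j <= 2 * C1 * r%:R `^ ((1 + eta) / p).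
    apply: le_trans (growth j) _; rewrite [in leRHS](mulrC 2) -mulrA ler_pM2l//.
    apply: (@le_trans _ _ ((2 * y) `^ p^-1)).
      apply: ge0_ler_powR; rewrite ?nnegrE ?invr_ge0 ?(ltW p0) ?addr_ge0 ?mulr_ge0 ?(ltW y0)//.
      have : `|j|%:R <= N%:R :> R by rewrite ler_nat.
      lra.
    rewrite powRM ?(ltW y0)// /y -powRrM ler_wpM2r ?powR_ge0//.
    by rewrite ler1_powR ?ler1n// invf_le1// ltW.
  (* The balance of scales: since [t >= r^beta], the Nash decay [K / t] is of order 1/r, like the
     inverse block mass. *)
  have mx : Num.max (4 * expR 1 / (ts * r%:R)) (16 * K / t) <= D1 / r%:R.
    rewrite ge_max; apply/andP; split.
      rewrite (_ : _ / (ts * _) = 4 * expR 1 / ts / r%:R); last by field; rewrite !gt_eqF.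
      by rewrite ler_pM2r ?invr_gt0// /D1 le_max lexx.
    apply: (@le_trans _ _ (16 * C / r%:R)); last first.
      by rewrite ler_pM2r ?invr_gt0// /D1 le_max lexx orbT.
    rewrite ler_pdivrMr// (le_trans _ (ler_wpM2l _ tl)) ?divr_ge0 ?mulr_ge0 ?(ltW C0) ?(ltW rR)//.
    rewrite rb /K le_eqVlt; apply/orP; left; apply/eqP; field; exact: lt0r_neq0.
  apply: (@le_trans _ _ (2 * C1 * r%:R `^ ((1 + eta) / p) * (D1 / r%:R))).
    apply: ler_pM => //; first exact: ltW.
    by rewrite le_max divr_ge0// mulr_ge0// ltW.
  rewrite (_ : - (1 - (1 + eta) / p) = (1 + eta) / p + - 1); last by ring.
  rewrite (powR_add ((1 + eta) / p) (- 1) rR) powR_inv1 ?(ltW rR)// le_eqVlt; apply/orP; left; apply/eqP.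
  by field; rewrite gt_eqF.
have main := trap_prob_scale_le ind idd e0 eS tau0 r0 N0 t1 K0 ts0
  (vb (window_uniq N) r0) blocks kap0 (fun j => exits N0) (ltW del0) ha i del0.
apply: le_trans main _; rewrite (_ : ep = del + del + del); last by rewrite /del; field.
rewrite lerD2r lerD2l; apply: le_trans Hc.
set S := 4 * K + _.
have Sle : S <= D2 * r%:R `^ (beta - 1).
  rewrite (_ : D2 * _ = 4 * K + 32 * expR 1 / ts * r%:R `^ (beta - 1)); last by rewrite /D2 /K; ring.
  rewrite /S lerD2l.
  have t4 : t <= 4 * r%:R `^ beta.
    apply: le_trans (ltW tu') _; rewrite powRM ?ler_wpM2r ?powR_ge0 ?(ltW rR)//.
    rewrite (_ : 4 = 2 `^ 2); first by rewrite ler_powR ?ler1n.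
    by rewrite (powR_mulrn 2)//; ring.
  have : 8 * expR 1 / (ts * r%:R) * t <= 8 * expR 1 / (ts * r%:R) * (4 * r%:R `^ beta).
    by rewrite ler_wpM2l// divr_ge0 ?mulr_ge0 ?(ltW ts0) ?(ltW rR) ?(ltW ep1).
  rewrite rb (_ : 8 * _ / _ * (4 * _) = 32 * expR 1 / ts * r%:R `^ (beta - 1)); last first.
    by field; rewrite !gt_eqF.
  by rewrite (_ : 8 * expR 1 / (ts * r%:R) * t = 8 * expR 1 * t / (ts * r%:R)) //; ring.
have N3 : (2 * N).+1%:R <= 3 * N%:R :> R by rewrite -natrM ler_nat (mulnDl 1 2 N) mul1n -add1n leq_add2r.
apply: (@le_trans _ _ (kap * (3 * N%:R * (D2 * r%:R `^ (beta - 1))))).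
  apply: ler_wpM2l => //; apply: ler_pM => //.
  have h1 : 0 <= 4 * K by apply: mulr_ge0 => //; exact: ltW.
  have h2 : 0 <= 8 * expR 1 * t by apply: mulr_ge0; [apply: mulr_ge0 => //|]; exact: ltW.
  have h3 : 0 <= ts * r%:R by apply: mulr_ge0; exact: ltW.
  by apply: addr_ge0 => //; apply: divr_ge0.
(* Exit cost: of order [N] sites, each left at most [S] times in mean (in units of the embedded
   walk), at a price of order N^(-gam) per departure. *)
have Nz : N%:R / N%:R `^ gam <= 2 * r%:R `^ (- ((1 + eta) * (gam - 1))).
  have -> : N%:R / N%:R `^ gam = N%:R `^ (- (gam - 1)) :> R.
    rewrite -[X in X / _](powRr1 (ltW NR)) -powRN -powR_add//; congr (_ `^ _); ring.
  have -> : r%:R `^ (- ((1 + eta) * (gam - 1))) = y `^ (- (gam - 1)) by rewrite -mulrN powRrM.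
  have ys : 0 < y `^ (gam - 1) by exact: powR_gt0.
  have Ns : 0 < N%:R `^ (gam - 1) :> R by exact: powR_gt0.
  rewrite !powRN ler_pdivlMr// mulrC ler_pdivrMr//.
  apply: (@le_trans _ _ ((2 * N%:R) `^ (gam - 1))).
    by rewrite ge0_ler_powR ?nnegrE ?subr_ge0 ?mulr_ge0 ?(ltW y0).
  rewrite powRM// ler_wpM2r ?powR_ge0//.
  by rewrite -[leRHS]powRr1// ler_powR ?ler1n//; lra.
rewrite opprB (powR_add (beta - 1) (- ((1 + eta) * (gam - 1))) rR).
have q0 : 0 <= 9 * m * D2 * r%:R `^ (beta - 1).
  by rewrite !mulr_ge0 ?powR_ge0// ltW.
have := ler_wpM2l q0 Nz.
rewrite (_ : 9 * m * D2 * _ * (N%:R / _) = kap * (3 * N%:R * (D2 * r%:R `^ (beta - 1)))); last first.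
  by rewrite /kap; field; rewrite gt_eqF// powR_gt0.
rewrite (_ : 9 * m * D2 * _ * (2 * _) = 18 * m * D2 * (r%:R `^ (beta - 1) * r%:R `^ (- ((1 + eta) * (gam - 1))))); last by ring.
by [].
Qed.

End vanishing.

Theorem theorem8 (R : realType) (beta p cminus cplus : R)
  (* environment space carrying the traps tau *)
  (d : measure_display) (Omega : measurableType d) (P : probability Omega R)
  (tau : int -> Omega -> R)
  (* walk space carrying the jumps eps_j and standard exponentials e_k *)
  (d' : measure_display) (Omega' : measurableType d') (P' : probability Omega' R)
  (eps : nat -> Omega' -> int) (e : nat -> Omega' -> R) :
  1 < beta <= 2 -> 1 < p <= 2 -> 0 < cminus -> 0 < cplus ->
  (* tau: i.i.d. positive, with finite p-th moment *)
  mutually_independent P tau ->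
  identically_distributed P tau 0 ->
  (forall i w, 0 < tau i w) ->
  ('E_P[(fun w => tau 0 w `^ p)%R] < +oo)%E ->
  (* eps_j and e_k all mutually independent; eps i.i.d., e i.i.d. Exp(1) *)
  mutually_independent P'
    (fun (s : nat + nat) (w : Omega') => match s with
                          | inl j => ((eps j w)%:~R : R)
                          | inr k => e k w
                          end) ->
  identically_distributed P' (fun j w => ((eps j w)%:~R : R)) 0%N ->
  (forall k, P' [set w | 0 < e k w] = 1%E) ->
  (forall k (s : R), 0 <= s -> P' [set w | s < e k w] = (expR (- s))%:E) ->
  (* E eps_1 = 0 *)
  P'.-integrable setT (fun w => ((eps 0%N w)%:~R : R)%:E) ->
  ('E_P'[(fun w => ((eps 0%N w)%:~R : R))%R] = 0)%E ->
  (* E(e^{i t eps_1}) = 1 iff t in 2 pi Z *)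
  (forall t : R,
     ('E_P'[(fun w => cos (t * (eps 0%N w)%:~R))%R] = 1 /\
      'E_P'[(fun w => sin (t * (eps 0%N w)%:~R))%R] = 0)%E
     <-> exists m : int, t = 2 * pi * m%:~R) ->
  (* tails with h = 1 *)
  (fun x : R => x `^ beta * fine (P' [set w | ((eps 0%N w)%:~R : R) < - x]))
     @ +oo --> cminus ->
  (fun x : R => x `^ beta * fine (P' [set w | x < ((eps 0%N w)%:~R : R)]))
     @ +oo --> cplus ->
  (* absence of localization, for a.e. realization of tau *)
  {ae P, forall w : Omega,
     (fun t : R => sup (range (quenched_prob P' (fun i => tau i w) eps e t)))
       @ +oo --> (0 : R)}.
Proof.
move=> beta12 p12 cminus0 cplus0 ind_tau idd_tau tau0 Etau ind idd e0 eS ieps meps lat tailm tailp.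
have /andP[p1 p2] := p12; have /andP[beta1 beta2] := beta12.
have ind' : mutually_independent P' (noise eps e) := ind.
have mY z := eps_measurable ind' 0 z.
have iY : summable_law P' (eps 0%N) (fun z => z%:~R : R) := ieps.
have E_mean (g : int -> R) : summable_law P' (eps 0%N) g ->
    ('E_P'[(fun w => g (eps 0%N w))] = (mean P' (eps 0%N) g)%:E)%E.
  by move=> ig; rewrite unlock /mean /Rintegral fineK//; exact: integrable_fin_num.
have mean0 : mean P' (eps 0%N) (fun z => z%:~R : R) = 0.
  by apply: EFin_inj; rewrite -E_mean.
have bounded_law (g : int -> R) : (forall z, `|g z| <= 1) -> summable_law P' (eps 0%N) g.
  by move=> g1; apply: (@bounded_summable _ _ _ P' _ mY _ 1).
have lattice (t : R) :
    (mean P' (eps 0%N) (fun z => cos (t * z%:~R)) = 1 /\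
     mean P' (eps 0%N) (fun z => sin (t * z%:~R)) = 0) <->
    exists m : int, t = 2 * pi * m%:~R.
  rewrite -lat !(E_mean (fun z => cos (t * z%:~R))) ?(E_mean (fun z => sin (t * z%:~R))).
  - by split => -[h1 h2]; split; [rewrite h1|rewrite h2|exact: EFin_inj h1|exact: EFin_inj h2].
  - by apply: bounded_law => z; exact: sin_max.
  - by apply: bounded_law => z; exact: cos_max.
have [c c0 low] := symbol_lower mY beta12 cplus0 iY lattice tailp.
have [C C0 vb] := law_var_bound mY beta12 c0 low.
(* Then (1 + eta)/p = (p + 1)/(2 p) < 1, and [gam] solves (1 + eta/2)(gam - 1) = beta - 1, so that
   [gam < beta] while (1 + eta)(gam - 1) still exceeds beta - 1. *)
pose eta := (p - 1) / 2; pose gam := 1 + (beta - 1) / (1 + eta / 2).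
have eta0 : 0 < eta by rewrite /eta; lra.
have eta1 : eta < 1 by rewrite /eta; lra.
have p0 : 0 < p by rewrite (lt_trans ltr01).
have eta_p : (1 + eta) / p < 1 by rewrite ltr_pdivrMr// mul1r /eta; lra.
have den0 : 0 < 1 + eta / 2 by lra.
have gam1 : 1 <= gam by rewrite /gam lerDl divr_ge0 ?(ltW den0)// subr_ge0 ltW.
have gamb : gam < beta.
  rewrite /gam -ltrBrDl ltr_pdivrMr// ltr_pMr ?subr_gt0//; lra.
have gam2 : gam <= 2 by lra.
have eta_gam : beta - 1 < (1 + eta) * (gam - 1).
  rewrite /gam addrAC subrr add0r mulrA ltr_pdivlMr// mulrC ltr_pM2r ?subr_gt0//; lra.
have exits := bump_exit mY beta12 iY mean0 tailp tailm.
have [ts ts0 ts_small] := trap_lower_quantile ind_tau tau0.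
(* Only these two almost sure properties of the environment enter; from here on it is a fixed
   function. *)
apply: filterS2 (trap_growth ind_tau idd_tau tau0 p0 Etau) (good_blocks ind_tau idd_tau ts_small).
move=> w [C1 C10 growth] [l0 good].
apply/cvgrPdist_le => ep ep0.
have m0 : 0 <= mean P' (eps 0%N) (fun z => `|z%:~R| `^ gam : R).
  by apply: Rintegral_ge0 => v _; exact: powR_ge0.
have eta01 : 0 < eta < 1 by rewrite eta0.
have gam12 : 1 <= gam <= 2 by rewrite gam1.
have [t0 H] := trap_prob_vanish ind' idd e0 eS beta12 C0 vb m0
  (fun N i => exits gam N i gam12 gamb) (fun i => tau0 i w) p0 C10 growth ts0 good
  eta01 p1 eta_p gam12 eta_gam ep0.
exists t0; split; first exact: num_real.
move=> t t0t; rewrite sub0r normrN.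
(* [sup] is meaningful on nonempty bounded sets only, so both facts are supplied. *)
have nonempty : range (quenched_prob P' (fun i => tau i w) eps e t) !=set0.
  by exists (quenched_prob P' (fun i => tau i w) eps e t 0); exists 0.
have ub : ubound (range (quenched_prob P' (fun i => tau i w) eps e t)) ep.
  by move=> _ [i _ <-]; apply: H; exact: ltW.
rewrite ger0_norm; first exact: ge_sup.
apply: (@le_trans _ _ (quenched_prob P' (fun i => tau i w) eps e t 0)).
  by rewrite /quenched_prob fine_ge0.
by apply: ub_le_sup; [exists ep|exists 0].
Qed.
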